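(* Let $\bar f:\mathbb{R}^n\times\mathbb{R}^m\times\mathbb{R}^l\to\mathbb{R}$, $\bar h:\mathbb{R}^n\times\mathbb{R}^m\times\mathbb{R}^l\to\mathbb{R}^{m_1}$, $\bar g:\mathbb{R}^n\times\mathbb{R}^m\times\mathbb{R}^l\to\mathbb{R}^{m_2}$, $\bar H:\mathbb{R}^n\times\mathbb{R}^l\to\mathbb{R}^{n_1}$, $\bar G:\mathbb{R}^n\times\mathbb{R}^l\to\mathbb{R}^{n_2}$, and for $\vartheta\in\mathbb{R}^l$ let $(\mathrm{P}_\vartheta)$ be the minimax problem $$\min_{x\in\Phi(\vartheta)}\ \max_{y\in\bar Y(x,\vartheta)}\ \bar f(x,y,\vartheta),$$ where $\Phi(\vartheta)=\{x:\bar H(x,\vartheta)=0,\ \bar G(x,\vartheta)\le 0\}$ and $\bar Y(x,\vartheta)=\{y:\bar h(x,y,\vartheta)=0,\ \bar g(x,y,\vartheta)\le 0\}$. Let $\vartheta_0\in\mathbb{R}^l$ and let $f=\bar f(\cdot,\cdot,\vartheta_0)$, $h=\bar h(\cdot,\cdot,\vartheta_0)$, $g=\bar g(\cdot,\cdot,\vartheta_0)$, $H=\bar H(\cdot,\vartheta_0)$, $G=\bar G(\cdot,\vartheta_0)$, so that $(\mathrm{P}_{\vartheta_0})$ is the minimax problem $\min_{x\in\Phi}\max_{y\in Y(x)}f(x,y)$ with data $(f,h,g,H,G)$. Suppose that this problem satisfies the Jacobian uniqueness condition (defined in the context) at $(x^*,u^*,v^*,y^*,\mu^*,\lambda^* )\in\mathbb{R}^n\times\mathbb{R}^{n_1}\times\mathbb{R}^{n_2}\times\mathbb{R}^m\times\mathbb{R}^{m_1}\times\mathbb{R}^{m_2}$,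 and that $(\mathrm{P}_\vartheta)$ is a local $\mathcal{C}^2$ perturbation of it around $(x^*,y^* )$, i.e. there are open sets $\mathcal{O}_1\subset\mathbb{R}^n$, $\mathcal{O}_2\subset\mathbb{R}^m$, $\Theta\subset\mathbb{R}^l$ with $x^*\in\mathcal{O}_1$, $y^*\in\mathcal{O}_2$, $\vartheta_0\in\Theta$ such that $\bar f,\bar h,\bar g$ are twice continuously differentiable on $\mathcal{O}_1\times\mathcal{O}_2\times\Theta$ and $\bar H,\bar G$ are twice continuously differentiable on $\mathcal{O}_1\times\Theta$. Then there exist $\varepsilon>0$ and $\delta>0$ with $\mathbf{B}(\vartheta_0,\delta)\subset\Theta$, $\mathbf{B}(x^*,\varepsilon)\subset\mathcal{O}_1$, $\mathbf{B}(y^*,\varepsilon)\subset\mathcal{O}_2$, and there is a mapping $$(x(\cdot),y(\cdot),u(\cdot),v(\cdot),\mu(\cdot),\lambda(\cdot)):\mathbf{B}(\vartheta_0,\delta)\to \mathbf{B}(x^*,\varepsilon)\times\mathbf{B}(y^*,\varepsilon)\times\mathbf{B}(u^*,\varepsilon)\times\mathbf{B}(v^*,\varepsilon)\times\mathbf{B}(\mu^*,\varepsilon)\times\mathbf{B}(\lambda^*,\varepsilon),$$ with $v(\vartheta)=w(\vartheta)^+$ and $\lambda(\vartheta)=\xi(\vartheta)^+$ (componentwise positive parts) for some mappings $w:\mathbf{B}(\vartheta_0,\delta)\to\mathbb{R}^{n_2}$ and $\xi:\mathbf{B}(\vartheta_0,\delta)\to\mathbb{R}^{m_2}$, such that: (1)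 $(x(\vartheta_0),y(\vartheta_0),u(\vartheta_0),v(\vartheta_0),\mu(\vartheta_0),\lambda(\vartheta_0))=(x^*,y^*,u^*,v^*,\mu^*,\lambda^* )$; (2) for every $\vartheta\in\mathbf{B}(\vartheta_0,\delta)$, the mapping $(x(\cdot),y(\cdot),u(\cdot),v(\cdot),\mu(\cdot),\lambda(\cdot))$ is continuously differentiable at $\vartheta$; (3) for every $\vartheta\in\mathbf{B}(\vartheta_0,\delta)$, Problem $(\mathrm{P}_\vartheta)$ satisfies the Jacobian uniqueness condition at $(x(\vartheta),u(\vartheta),v(\vartheta),y(\vartheta),\mu(\vartheta),\lambda(\vartheta))$.
   Context: $\mathbf{B}(a,r)=\{a':\|a'-a\|\le r\}$ (Euclidean norm). $\mathcal{J}$ denotes Jacobian matrices, $\mathcal{J}_x,\mathcal{J}_y$ partial Jacobians, $\nabla$ gradients (columns). For an index set $\alpha$, $g_\alpha$ is the subvector of $g$ indexed by $\alpha$. $0\le a\perp b\le 0$ means $a\ge0$, $b\le 0$, $a^Tb=0$. Minimax problem with data $(f,h,g,H,G)$: $\min_{x\in\Phi}\max_{y\in Y(x)}f(x,y)$, with $f:\mathbb{R}^n\times\mathbb{R}^m\to\mathbb{R}$, $h:\mathbb{R}^n\times\mathbb{R}^m\to\mathbb{R}^{m_1}$, $g:\mathbb{R}^n\times\mathbb{R}^m\to\mathbb{R}^{m_2}$, $H:\mathbb{R}^n\to\mathbb{R}^{n_1}$, $G:\mathbb{R}^n\to\mathbb{R}^{n_2}$, $\Phi=\{x: H(x)=0,\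 G(x)\le0\}$, $Y(x)=\{y: h(x,y)=0,\ g(x,y)\le0\}$. Lower-level Lagrangian: $\mathcal{L}(x,y,\mu,\lambda)=f(x,y)+\mu^Th(x,y)-\lambda^Tg(x,y)$. The lower-level problem $(\mathrm{P}_{x})$ is $\max_z\{f(x,z): h(x,z)=0,\ g(x,z)\le0\}$. Jacobian uniqueness conditions of $(\mathrm{P}_{x^*})$ at $(y^*,\mu^*,\lambda^* )$, where $\alpha=\{i: g_i(x^*,y^* )=0\}$: (a) $\nabla_y\mathcal{L}(x^*,y^*,\mu^*,\lambda^* )=0$, $h(x^*,y^* )=0$, $0\le\lambda^*\perp g(x^*,y^* )\le0$; (b) the vectors $\nabla_yh_j(x^*,y^* )$ ($1\le j\le m_1$), $\nabla_yg_i(x^*,y^* )$ ($i\in\alpha$) are linearly independent; (c) $\lambda_i^*-g_i(x^*,y^* )>0$ for $i=1,\dots,m_2$; (d) $\langle\nabla^2_{yy}\mathcal{L}(x^*,y^*,\mu^*,\lambda^* )d_y,d_y\rangle<0$ for all $d_y\in\mathcal{C}_{x^*}(y^* )\setminus\{0\}$, where $\mathcal{C}_{x^*}(y^* )=\{d_y\in\mathbb{R}^m:\mathcal{J}_yh(x^*,y^* )d_y=0;\ \nabla_yg_i(x^*,y^* )^Td_y\le0,\ i\in\alpha;\ \nabla_yf(x^*,y^* )^Td_y\ge0\}$. Upper-level KKT conditions at $(x^*,u^*,v^*,y^*,\mu^*,\lambda^* )$: $\nabla_x\mathcal{L}(x^*,y^*,\mu^*,\lambda^* )+\mathcal{J}H(x^*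 )^Tu^*+\mathcal{J}G(x^* )^Tv^*=0$, $H(x^* )=0$, $0\le v^*\perp G(x^* )\le0$. $\Lambda(x^* )$ is the set of all $(u,v)$ satisfying these conditions in place of $(u^*,v^* )$. $I(x^* )=\{i:G_i(x^* )=0\}$. Critical cone: $\mathcal{C}(x^* )=\{d_x\in\mathbb{R}^n:\mathcal{J}H(x^* )d_x=0;\ \nabla G_i(x^* )^Td_x\le0,\ i\in I(x^* );\ \nabla_x\mathcal{L}(x^*,y^*,\mu^*,\lambda^* )^Td_x\le0\}$. With all functions evaluated at $(x^*,y^*,\mu^*,\lambda^* )$, put $$K_\alpha=\begin{bmatrix}\nabla^2_{yy}\mathcal{L}&\mathcal{J}_yh^T&-\mathcal{J}_yg_\alpha^T\\ \mathcal{J}_yh&0&0\\-\mathcal{J}_yg_\alpha&0&0\end{bmatrix},\qquad N_\alpha=\begin{bmatrix}M\\ \mathcal{J}_xh\\-\mathcal{J}_xg_\alpha\end{bmatrix},$$ where $M$ is the $m\times n$ matrix with entries $\partial^2\mathcal{L}/\partial y_i\partial x_j$ ($K_\alpha$ is nonsingular under the Jacobian uniqueness conditions of $(\mathrm{P}_{x^*})$). The minimax problem satisfies the Jacobian uniqueness condition at $(x^*,u^*,v^*,y^*,\mu^*,\lambda^* )$ if: (i) $x^*\in\Phi$ and the upper-level KKT conditions hold at $(x^*,u^*,v^*,y^*,\mu^*,\lambda^* )$; (ii) the vectors $\nabla H_j(x^* )$ ($1\le j\le n_1$), $\nabla G_i(x^* )$ ($i\in I(x^* )$) are linearly independent; (iii)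 $v_i^*-G_i(x^* )>0$ for $i\in I(x^* )$; (iv) $y^*\in Y(x^* )$ and $(\mathrm{P}_{x^*})$ satisfies the Jacobian uniqueness conditions at $(y^*,\mu^*,\lambda^* )$; (v) for every $d_x\in\mathcal{C}(x^* )\setminus\{0\}$, $$\sup_{(u,v)\in\Lambda(x^* )}\Big\langle\Big[\sum_{j=1}^{n_1}u_j\nabla^2H_j(x^* )+\sum_{i=1}^{n_2}v_i\nabla^2G_i(x^* )\Big]d_x,d_x\Big\rangle+\big\langle[\nabla^2_{xx}\mathcal{L}(x^*,y^*,\mu^*,\lambda^* )-N_\alpha^TK_\alpha^{-1}N_\alpha]d_x,d_x\big\rangle>0.$$ The Jacobian uniqueness condition for $(\mathrm{P}_\vartheta)$ is this same condition for the data $\bar f(\cdot,\cdot,\vartheta),\bar h(\cdot,\cdot,\vartheta),\bar g(\cdot,\cdot,\vartheta),\bar H(\cdot,\vartheta),\bar G(\cdot,\vartheta)$. *)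

(* Defs.v *)
From HB Require Import structures.
From mathcomp Require Import all_boot all_order all_algebra.
From mathcomp Require Import mathcomp_extra boolp classical_sets functions reals ereal.
From mathcomp Require Import topology normedtype derive.

Set Implicit Arguments.
Unset Strict Implicit.
Unset Printing Implicit Defensive.

Import Order.TTheory GRing.Theory Num.Theory.
Import numFieldNormedType.Exports.

Local Open Scope classical_set_scope.
Local Open Scope ring_scope.

(* R^p is 'cV[R]_p. The norm that the library puts on matrices is the sup
   norm; it is equivalent to the Euclidean one, so it is used for open sets,
   continuity and differentiability, but not for the balls below. *)

Definition dot (R : realType) (p : nat) (a b : 'cV[R]_p) : R :=
  \sum_(i < p) a i 0 * b i 0.

Definition enorm (R : realType) (p : nat) (a : 'cV[R]_p) : R :=
  Num.sqrt (dot a a).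

Definition eball (R : realType) (p : nat) (a : 'cV[R]_p) (r : R) :
    set 'cV[R]_p :=
  [set a' | enorm (a' - a) <= r].

Definition pospart (R : realType) (p : nat) (a : 'cV[R]_p) : 'cV[R]_p :=
  \col_i Num.max (a i 0) 0.

(* 0 <= a _|_ b <= 0 *)
Definition complementary (R : realType) (p : nat) (a b : 'cV[R]_p) : Prop :=
  [/\ forall i, 0 <= a i 0, forall i, b i 0 <= 0 & dot a b = 0].

Definition partial (R : realType) (p : nat) (j : 'I_p) (f : 'cV[R]_p -> R)
    (a : 'cV[R]_p) : R :=
  'D_(delta_mx j 0) f a.

Definition grad (R : realType) (p : nat) (f : 'cV[R]_p -> R) (a : 'cV[R]_p) :
    'cV[R]_p :=
  \col_j partial j f a.

Definition jac (R : realType) (p q : nat) (F : 'cV[R]_p -> 'cV[R]_q)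
    (a : 'cV[R]_p) : 'M[R]_(q, p) :=
  \matrix_(i, j) partial j (fun z => F z i 0) a.

Definition hess (R : realType) (p : nat) (f : 'cV[R]_p -> R) (a : 'cV[R]_p) :
    'M[R]_p :=
  \matrix_(i, j) partial i (partial j f) a.

Definition rows_in (R : realType) (p q : nat) (A : {set 'I_q})
    (M : 'M[R]_(q, p)) : 'M[R]_(#|A|, p) :=
  rowsub (fun k : 'I_#|A| => enum_val k) M.

(* On the finite-dimensional spaces where it is used, continuity of all the
   directional derivatives is continuity of the derivative as a linear map. *)
Fixpoint Ck_on (R : realType) (V W : normedModType R) (k : nat) (A : set V)
    (F : V -> W) : Prop :=
  if k is k'.+1 then
    (forall a, A a -> differentiable F a) /\ (forall d, Ck_on k' A ('D_d F))
  else forall a, A a -> {for a, continuous F}.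

Definition C1_at (R : realType) (V W : normedModType R) (F : V -> W) (a : V) :
    Prop :=
  (\forall b \near a, differentiable F b) /\
  (forall d, {for a, continuous ('D_d F)}).

Record minimax (R : realType) (n m m1 m2 n1 n2 : nat) := Minimax {
  mm_f : 'cV[R]_n -> 'cV[R]_m -> R;
  mm_h : 'cV[R]_n -> 'cV[R]_m -> 'cV[R]_m1;
  mm_g : 'cV[R]_n -> 'cV[R]_m -> 'cV[R]_m2;
  mm_H : 'cV[R]_n -> 'cV[R]_n1;
  mm_G : 'cV[R]_n -> 'cV[R]_n2 }.

Section Minimax.
Context {R : realType} {n m m1 m2 n1 n2 : nat}.
Variable P : minimax R n m m1 m2 n1 n2.

Local Notation f := (mm_f P).
Local Notation h := (mm_h P).
Local Notation g := (mm_g P).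
Local Notation H := (mm_H P).
Local Notation G := (mm_G P).

Definition upper_feasible : set 'cV[R]_n :=
  [set x | H x = 0 /\ forall i, G x i 0 <= 0].

Definition lower_feasible (x : 'cV[R]_n) : set 'cV[R]_m :=
  [set y | h x y = 0 /\ forall i, g x y i 0 <= 0].

Definition lagrangian (x : 'cV[R]_n) (y : 'cV[R]_m) (mu : 'cV[R]_m1)
    (lam : 'cV[R]_m2) : R :=
  f x y + dot mu (h x y) - dot lam (g x y).

Definition gradxL (x : 'cV[R]_n) (y : 'cV[R]_m) (mu : 'cV[R]_m1)
    (lam : 'cV[R]_m2) : 'cV[R]_n :=
  grad (fun x' => lagrangian x' y mu lam) x.

Definition gradyL (x : 'cV[R]_n) (y : 'cV[R]_m) (mu : 'cV[R]_m1)
    (lam : 'cV[R]_m2) : 'cV[R]_m :=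
  grad (fun y' => lagrangian x y' mu lam) y.

Definition hessxxL (x : 'cV[R]_n) (y : 'cV[R]_m) (mu : 'cV[R]_m1)
    (lam : 'cV[R]_m2) : 'M[R]_n :=
  hess (fun x' => lagrangian x' y mu lam) x.

Definition hessyyL (x : 'cV[R]_n) (y : 'cV[R]_m) (mu : 'cV[R]_m1)
    (lam : 'cV[R]_m2) : 'M[R]_m :=
  hess (fun y' => lagrangian x y' mu lam) y.

Definition hessyxL (x : 'cV[R]_n) (y : 'cV[R]_m) (mu : 'cV[R]_m1)
    (lam : 'cV[R]_m2) : 'M[R]_(m, n) :=
  \matrix_(i, j)
    partial i (fun y' => partial j (fun x' => lagrangian x' y' mu lam) x) y.

Definition lower_active (x : 'cV[R]_n) (y : 'cV[R]_m) : {set 'I_m2} :=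
  [set i | g x y i 0 == 0].

Definition upper_active (x : 'cV[R]_n) : {set 'I_n2} :=
  [set i | G x i 0 == 0].

Definition Jxh (x : 'cV[R]_n) (y : 'cV[R]_m) : 'M[R]_(m1, n) :=
  jac (fun x' => h x' y) x.
Definition Jyh (x : 'cV[R]_n) (y : 'cV[R]_m) : 'M[R]_(m1, m) := jac (h x) y.

Definition Jxg_act (x : 'cV[R]_n) (y : 'cV[R]_m) :
    'M[R]_(#|lower_active x y|, n) :=
  rows_in (lower_active x y) (jac (fun x' => g x' y) x).
Definition Jyg_act (x : 'cV[R]_n) (y : 'cV[R]_m) :
    'M[R]_(#|lower_active x y|, m) :=
  rows_in (lower_active x y) (jac (g x) y).

Definition lower_critical_cone (x : 'cV[R]_n) (y : 'cV[R]_m) : set 'cV[R]_m :=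
  [set d | [/\ Jyh x y *m d = 0,
    forall i, i \in lower_active x y ->
      dot (grad (fun y' => g x y' i 0) y) d <= 0
    & 0 <= dot (grad (f x) y) d]].

(* The rows of a Jacobian are the transposed gradients, so row_free states
   the linear independence of the gradients. *)
Definition lower_jacobian_uniqueness (x : 'cV[R]_n) (y : 'cV[R]_m)
    (mu : 'cV[R]_m1) (lam : 'cV[R]_m2) : Prop :=
  [/\ [/\ gradyL x y mu lam = 0, h x y = 0 & complementary lam (g x y)],
      row_free (col_mx (Jyh x y) (Jyg_act x y)),
      forall i, 0 < lam i 0 - g x y i 0
    & forall d, lower_critical_cone x y d -> d != 0 ->
        dot (hessyyL x y mu lam *m d) d < 0].

Definition upper_KKT (x : 'cV[R]_n) (u : 'cV[R]_n1) (v : 'cV[R]_n2)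
    (y : 'cV[R]_m) (mu : 'cV[R]_m1) (lam : 'cV[R]_m2) : Prop :=
  [/\ gradxL x y mu lam + (jac H x)^T *m u + (jac G x)^T *m v = 0,
      H x = 0 & complementary v (G x)].

Definition upper_multipliers (x : 'cV[R]_n) (y : 'cV[R]_m) (mu : 'cV[R]_m1)
    (lam : 'cV[R]_m2) : set ('cV[R]_n1 * 'cV[R]_n2) :=
  [set uv | upper_KKT x uv.1 uv.2 y mu lam].

Definition upper_critical_cone (x : 'cV[R]_n) (y : 'cV[R]_m) (mu : 'cV[R]_m1)
    (lam : 'cV[R]_m2) : set 'cV[R]_n :=
  [set d | [/\ jac H x *m d = 0,
    forall i, i \in upper_active x -> dot (grad (fun x' => G x' i 0) x) d <= 0
    & dot (gradxL x y mu lam) d <= 0]].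

Definition Kmx (x : 'cV[R]_n) (y : 'cV[R]_m) (mu : 'cV[R]_m1)
    (lam : 'cV[R]_m2) : 'M[R]_(m + (m1 + #|lower_active x y|)) :=
  block_mx (hessyyL x y mu lam) (row_mx (Jyh x y)^T (- (Jyg_act x y)^T))
           (col_mx (Jyh x y) (- Jyg_act x y)) 0.

Definition Nmx (x : 'cV[R]_n) (y : 'cV[R]_m) (mu : 'cV[R]_m1)
    (lam : 'cV[R]_m2) : 'M[R]_(m + (m1 + #|lower_active x y|), n) :=
  col_mx (hessyxL x y mu lam) (col_mx (Jxh x y) (- Jxg_act x y)).

Definition upper_constraint_hess (x : 'cV[R]_n) (u : 'cV[R]_n1)
    (v : 'cV[R]_n2) : 'M[R]_n :=
  \sum_(j < n1) u j 0 *: hess (fun x' => H x' j 0) x +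
  \sum_(i < n2) v i 0 *: hess (fun x' => G x' i 0) x.

(* invmx is the genuine inverse here: Kmx is nonsingular whenever
   lower_jacobian_uniqueness holds and the data are C^2. *)
Definition upper_second_order (x : 'cV[R]_n) (y : 'cV[R]_m) (mu : 'cV[R]_m1)
    (lam : 'cV[R]_m2) : Prop :=
  forall d, upper_critical_cone x y mu lam d -> d != 0 ->
    (0 < ereal_sup [set (dot (upper_constraint_hess x uv.1 uv.2 *m d) d)%:E
                   | uv in upper_multipliers x y mu lam]
         + (dot ((hessxxL x y mu lam
                  - (Nmx x y mu lam)^T *m invmx (Kmx x y mu lam)
                    *m Nmx x y mu lam) *m d) d)%:E)%E.

Definition jacobian_uniqueness (x : 'cV[R]_n) (u : 'cV[R]_n1)
    (v : 'cV[R]_n2) (y : 'cV[R]_m) (mu : 'cV[R]_m1) (lam : 'cV[R]_m2) : Prop :=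
  [/\ upper_feasible x /\ upper_KKT x u v y mu lam,
      row_free (col_mx (jac H x) (rows_in (upper_active x) (jac G x))),
      forall i, i \in upper_active x -> 0 < v i 0 - G x i 0,
      lower_feasible x y /\ lower_jacobian_uniqueness x y mu lam
    & upper_second_order x y mu lam].

End Minimax.

Section Perturbation.
Context {R : realType} {n m m1 m2 n1 n2 l : nat}.
Variables (fb : 'cV[R]_n -> 'cV[R]_m -> 'cV[R]_l -> R)
  (hb : 'cV[R]_n -> 'cV[R]_m -> 'cV[R]_l -> 'cV[R]_m1)
  (gb : 'cV[R]_n -> 'cV[R]_m -> 'cV[R]_l -> 'cV[R]_m2)
  (Hb : 'cV[R]_n -> 'cV[R]_l -> 'cV[R]_n1)
  (Gb : 'cV[R]_n -> 'cV[R]_l -> 'cV[R]_n2).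

Definition perturbed (t : 'cV[R]_l) : minimax R n m m1 m2 n1 n2 :=
  Minimax (fun x y => fb x y t) (fun x y => hb x y t) (fun x y => gb x y t)
          (fun x => Hb x t) (fun x => Gb x t).

Definition local_C2_perturbation (O1 : set 'cV[R]_n) (O2 : set 'cV[R]_m)
    (Theta : set 'cV[R]_l) (x : 'cV[R]_n) (y : 'cV[R]_m) (t0 : 'cV[R]_l) :
    Prop :=
  [/\ [/\ open O1, open O2 & open Theta],
      [/\ O1 x, O2 y & Theta t0],
      [/\ Ck_on 2 (O1 `*` O2 `*` Theta) (fun p => fb p.1.1 p.1.2 p.2),
          Ck_on 2 (O1 `*` O2 `*` Theta) (fun p => hb p.1.1 p.1.2 p.2)
        & Ck_on 2 (O1 `*` O2 `*` Theta) (fun p => gb p.1.1 p.1.2 p.2)]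
    & Ck_on 2 (O1 `*` Theta) (fun p => Hb p.1 p.2) /\
      Ck_on 2 (O1 `*` Theta) (fun p => Gb p.1 p.2)].

End Perturbation.

(* Main.v *)
(* Put Phi(e, t) = f + mu.h - lam.g + u.H + v.G, a function of the parameter t
   and of all unknowns e = (x, y, u, v, mu, lam).  Every gradient and matrix in
   the Jacobian uniqueness condition is a block of the gradient or the Hessian
   of Phi in e.  Keeping the active sets of t0, the KKT conditions of both
   levels become a square system: the partial derivatives of Phi vanish in the
   directions of x, y and of the active multipliers, and the inactive
   multipliers vanish.  If d is in the kernel of its derivative, eliminating
   (dy, dmu, dlam) through K makes the quadratic form of (v) vanish at dx on the
   critical subspace, so dx = 0; then K gives dy = dmu = dlam = 0, and the linear
   independence (ii) gives du = dv = 0.  The implicit function theorem yields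
   the C^1 path.  Strict complementarity keeps the active sets constant along
   it, linear independence is an open condition, and so is positivity on a
   kernel because the unit sphere is compact; hence the Jacobian uniqueness
   condition persists.  The multiplier set is a singleton by (ii), so the
   supremum in (v) is attained at (u, v); since v and lam are nonnegative along
   the path, one takes w = v and xi = lam. *)

Require Import Defs.
From HB Require Import structures.
From mathcomp Require Import all_boot all_order all_algebra.
From mathcomp Require Import mathcomp_extra boolp classical_sets functions reals ereal prodnormedzmodule.
From mathcomp Require Import topology normedtype landau sequences derive.
From mathcomp Require Import ring lra.

Set Implicit Arguments.
Unset Strict Implicit.
Unset Printing Implicit Defensive.

Import Order.TTheory GRing.Theory Num.Theory.
Import numFieldNormedType.Exports.

Local Open Scope classical_set_scope.
Local Open Scope ring_scope.

(** * Calculus of [Ck_on] functions *)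

(** The hypothesis is joint smoothness, while the condition speaks of partial derivatives of slices.
    The bridge: the partial derivative of a slice and the directional derivative of [Phi] in a
    coordinate direction have the same difference quotients, so they agree at every point. As [Phi]
    is affine in the multipliers, its derivatives in them are the constraints themselves. Two
    features of the condition resist perturbation as stated: the critical cones are cut out by
    inequalities, and the sizes of [Kmx] and [Nmx] vary with the active set. Strict complementarity
    removes the first, since both cones become kernels of active Jacobians; index sets kept as
    parameters remove the second. The outcome is [regular], a statement about nine matrices, used
    both for the injectivity behind the implicit function and for openness. The path must be C^1 at
    every nearby parameter. The bound that makes the Newton map a contraction also keeps the partial
    Jacobian invertible on the whole box, which gives the derivative formula at each of these
    parameters. *)

Section Differentiable.
Context {R : realType} {V W : normedModType R}.
Implicit Types (f g : V -> W) (a h : V).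

Lemma differentiable_approx f a : differentiable f a -> forall e : R, 0 < e ->
  \forall h \near 0, `|f (h + a) - f a - 'd f a h| <= e * `|h|.
Proof.
move=> /diff_locallyP[_ fE] e e0.
move/eqaddoP: fE => /(_ e e0); apply: filterS => h.
by rewrite /= !fctE opprD addrA.
Qed.

(** Serves when the differential is guessed in advance: [diff_unique] identifies the candidate with
    ['d f a], so differentiability and the value of the differential come together. *)
Lemma approx_is_diff f a (df : {linear V -> W}) : continuous df ->
  (forall e : R, 0 < e ->
    \forall h \near 0, `|f (h + a) - f a - df h| <= e * `|h|) ->
  is_diff a f df.
Proof.
move=> cdf fE.
have E : f \o shift a = cst (f a) + df +o_ 0 id.
  apply/eqaddoP => e e0; move: (fE e e0); apply: filterS => h.
  by rewrite /= !fctE opprD addrA.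
have dE := diff_unique cdf E.
by apply: DiffDef => //; apply/diff_locallyP; rewrite dE.
Qed.

Lemma near_eq_differentiable f g a :
  (\forall b \near a, f b = g b) -> differentiable f a -> differentiable g a.
Proof.
move=> fg df.
have fga : f a = g a by exact: nbhs_singleton fg.
have : is_diff a g ('d f a).
  apply: approx_is_diff => [|e e0]; first exact: diff_continuous.
  have fg0 : \forall h \near 0, f (h + a) = g (h + a).
    by move/nbhs0P: fg; apply: filterS => h; rewrite addrC.
  near=> h; rewrite -fga.
  rewrite -[g (h + a)](_ : f (h + a) = _); last by near: h.
  by near: h; exact: differentiable_approx.
by case.
Unshelve. all: by end_near. Qed.

End Differentiable.

(** * Directional derivatives along lines and affine maps *)

Section DeriveAlong.
Context {R : realType}.
Implicit Types U V W : normedModType R.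

(** Both sides are limits of the same function of [h], so they agree even where neither limit
    exists. This turns partial derivatives of slices into directional derivatives. *)
Lemma derive_affine U V W (f : V -> W) (phi : U -> V) a d d' :
  (forall h : R, phi (h *: d + a) = h *: d' + phi a) ->
  'D_d (fun x => f (phi x)) a = 'D_d' f (phi a).
Proof.
move=> phiE; rewrite /derive; congr (lim (_ @ 0^')); apply/funext => h.
by rewrite /= phiE.
Qed.

Lemma derive_eq_along V W (f g : V -> W) a d (c : W) :
  (forall h : R, f (h *: d + a) = g (h *: d + a) + c) -> 'D_d f a = 'D_d g a.
Proof.
move=> fg; rewrite /derive; congr (lim (_ @ 0^')); apply/funext => h /=.
have := fg 0; rewrite scale0r add0r => ->.
by rewrite fg opprD addrACA subrr addr0.
Qed.

(** Here [f] plays the inner affine map of [derive_affine] and [id] the outer function. *)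
Lemma derive_affine_along V W (f : V -> W) a d (c : W) :
  (forall h : R, f (h *: d + a) = h *: c + f a) -> 'D_d f a = c.
Proof.
by move=> fE; rewrite (@derive_affine _ _ _ id f a d c)// derive_id.
Qed.

End DeriveAlong.

Section CkOn.
Context {R : realType}.
Implicit Types U V W : normedModType R.

Lemma Ck_on_sub V W k (A B : set V) (f : V -> W) :
  A `<=` B -> Ck_on k B f -> Ck_on k A f.
Proof.
move=> AB; elim: k f => [f Bf a /AB|k IH f [df Df]]; first exact: Bf.
by split=> [a /AB|d]; [exact: df|exact: IH (Df d)].
Qed.

(** Openness of [A] spreads the pointwise equality to a neighbourhood of each point, hence to
    differentials and directional derivatives of every order. *)
Lemma Ck_on_eq V W k (A : set V) (f g : V -> W) : open A ->
  (forall a, A a -> f a = g a) -> Ck_on k A f -> Ck_on k A g.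
Proof.
move=> oA; elim: k f g => [|k IH] f g fg.
  move=> cf a Aa; rewrite /prop_for /continuous_at -fg//.
  apply: cvg_trans (cf a Aa); apply: near_eq_cvg.
  by apply: filterS (open_nbhs_nbhs (conj oA Aa)) => b /fg.
have nfg a : A a -> \forall b \near a, f b = g b.
  by move=> Aa; apply: filterS (open_nbhs_nbhs (conj oA Aa)) => b /fg.
move=> [df Df]; split=> [a Aa|d].
  by apply: near_eq_differentiable (df a Aa); exact: nfg.
by apply: IH (Df d) => a Aa; apply: near_eq_derive; exact: nfg.
Qed.

Lemma Ck_onW V W k (A : set V) (f : V -> W) : Ck_on k.+1 A f -> Ck_on k A f.
Proof.
elim: k f => [|k IH] f [df Df].
  by move=> a Aa; apply: differentiable_continuous; exact: df.
by split=> // d; exact: IH (Df d).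
Qed.

Lemma Ck_on_cst V W k (A : set V) (c : W) : Ck_on k A (cst c).
Proof.
elim: k c => [|k IH] c; first by move=> a _; exact: cvg_cst.
split=> [a _|d]; first exact: differentiable_cst.
suff -> : 'D_d (cst c : V -> W) = cst 0 by exact: IH.
by apply/funext => a; exact: derive_cst.
Qed.

Lemma Ck_on_linear V W k (A : set V) (f : {linear V -> W}) :
  continuous f -> Ck_on k A f.
Proof.
case: k => [|k] cf; first by move=> a _; exact: cf.
split=> [a _|d]; first exact: linear_differentiable.
suff -> : 'D_d (f : V -> W) = cst (f d) by exact: Ck_on_cst.
by apply/funext => a; apply: derive_affine_along => h; rewrite linearP.
Qed.

Lemma Ck_onD V W k (A : set V) (f g : V -> W) : open A ->
  Ck_on k A f -> Ck_on k A g -> Ck_on k A (fun a => f a + g a).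
Proof.
move=> oA; elim: k f g => [|k IH] f g.
  by move=> cf cg a Aa; apply: cvgD; [exact: cf|exact: cg].
move=> [df Df] [dg Dg]; split=> [a Aa|d].
  by apply: (@differentiableD _ _ _ f g); [exact: df|exact: dg].
apply: (@Ck_on_eq _ _ _ _ (fun a => 'D_d f a + 'D_d g a)) => // [a Aa|].
  by rewrite -deriveD//; apply: diff_derivable; [exact: df|exact: dg].
exact: IH (Df d) (Dg d).
Qed.

Lemma Ck_on_sum V W k (A : set V) q (f : 'I_q -> V -> W) : open A ->
  (forall i, Ck_on k A (f i)) -> Ck_on k A (fun a => \sum_i f i a).
Proof.
move=> oA fk; elim: q f fk => [|q IH] f fk.
  apply: (@Ck_on_eq _ _ _ _ (cst 0)) => // [a Aa|]; last exact: Ck_on_cst.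
  by rewrite big_ord0.
apply: (@Ck_on_eq _ _ _ _
  (fun a => f ord0 a + \sum_i f (lift ord0 i) a)) => // [a Aa|].
  by rewrite big_ord_recl.
by apply: Ck_onD => //; apply: IH => i; exact: fk.
Qed.

(** The product rule multiplies a derivative, smooth to order [k], by an undifferentiated factor,
    smooth to order [k.+1]; [Ck_onW] lowers the latter so that the induction closes. *)
Lemma Ck_onM V k (A : set V) (f g : V -> R) : open A ->
  Ck_on k A f -> Ck_on k A g -> Ck_on k A (fun a => f a * g a).
Proof.
move=> oA; elim: k f g => [|k IH] f g.
  by move=> cf cg a Aa; apply: cvgM; [exact: cf|exact: cg].
move=> fk gk; have [df Df] := fk; have [dg Dg] := gk; split=> [a Aa|d].
  by apply: (@differentiableM _ _ f g); [exact: df|exact: dg].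
apply: (@Ck_on_eq _ _ _ _ (fun a => f a * 'D_d g a + g a * 'D_d f a)) => //.
  move=> a Aa; rewrite (@deriveM _ _ f g)//; apply: diff_derivable.
    exact: df.
  exact: dg.
apply: Ck_onD => //.
  exact: IH (Ck_onW fk) (Dg d).
exact: IH (Ck_onW gk) (Df d).
Qed.

(** The derivative of the composite in direction [d] is again a composite with [L], now of the
    derivative in direction [L d], so the induction hypothesis applies as it is. *)
Lemma Ck_on_compr U V W k (A : set V) (L : {linear U -> V}) (f : V -> W) :
  continuous L -> Ck_on k A f -> Ck_on k (L @^-1` A) (fun a => f (L a)).
Proof.
move=> cL; elim: k f => [|k IH] f.
  by move=> cf a Aa; apply: continuous_comp; [exact: cL|exact: cf].
move=> [df Df]; split=> [a Aa|d].
  apply: (@differentiable_comp _ _ _ _ L f); last exact: df.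
  exact: linear_differentiable.
suff -> : 'D_d (fun a => f (L a)) = fun a => 'D_(L d) f (L a).
  exact: IH (Df (L d)).
by apply/funext => a; apply: derive_affine => h; rewrite linearP.
Qed.

Lemma derive_compl V W W' (L : {linear W -> W'}) (f : V -> W) a d :
  continuous L -> derivable f a d ->
  'D_d (fun x => L (f x)) a = L ('D_d f a).
Proof.
move=> cL df; apply/cvg_lim; first exact: norm_hausdorff.
rewrite (_ : (fun h => _) = L \o (fun h : R =>
  h^-1 *: ((f \o shift a) (h *: d) - f a))).
  by apply: continuous_cvg; [exact: cL|exact: df].
by apply/funext => h /=; rewrite linearZZ (linearB L).
Qed.

Lemma Ck_on_compl V W W' k (A : set V) (L : {linear W -> W'}) (f : V -> W) :
  open A -> continuous L -> Ck_on k A f -> Ck_on k A (fun a => L (f a)).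
Proof.
move=> oA cL; elim: k f => [|k IH] f.
  by move=> cf a Aa; apply: continuous_comp; [exact: cf|exact: cL].
move=> [df Df]; split=> [a Aa|d].
  apply: (@differentiable_comp _ _ _ _ f L); first exact: df.
  exact: linear_differentiable.
apply: (@Ck_on_eq _ _ _ _ (fun a => L ('D_d f a))) => // [a Aa|].
  by rewrite -derive_compl//; apply: diff_derivable; exact: df.
exact: IH (Df d).
Qed.

Lemma coord_is_linear p (i : 'I_p) :
  linear_for *%R (fun M : 'cV[R]_p => M i 0).
Proof. by move=> c M N; rewrite !mxE. Qed.

(** Bundled as a linear map so that coordinates fall under the lemmas on composition with a
    continuous linear map. *)
Definition coord_lin p (i : 'I_p) : {linear 'cV[R]_p -> R | *%R} :=
  HB.pack (fun M : 'cV[R]_p => M i 0)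
    (GRing.isLinear.Build _ _ _ _ _ (coord_is_linear i)).

Lemma Ck_on_coord V k (A : set V) p (f : V -> 'cV[R]_p) i : open A ->
  Ck_on k A f -> Ck_on k A (fun a => f a i 0 : R).
Proof.
move=> oA fk; apply: (@Ck_on_compl _ _ _ _ _ (coord_lin i : {linear 'cV[R]_p -> R})) => //.
exact: coord_continuous.
Qed.

End CkOn.
(* Comparing iterated derivatives by unfolding them to limits does not end. *)
Opaque derive.

(** * Mean value theorem and symmetry of second derivatives *)

Section MeanValue.
Context {R : realType}.
Implicit Types V W : normedModType R.

Lemma derive_scale V W (f : V -> W) a (c : R) u : differentiable f a ->
  'D_(c *: u) f a = c *: 'D_u f a.
Proof. by move=> df; rewrite !deriveE// linearZ. Qed.

Lemma continuous_near_dist V W (g : V -> W) a (e : R) :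
  {for a, continuous g} -> 0 < e -> \forall x \near a, `|g a - g x| < e.
Proof. by move=> /cvgrPdist_lt cg e0; exact: cg. Qed.

Lemma mean_value V (f : V -> R) a d :
  (forall s : R, 0 <= s <= 1 -> differentiable f (s *: d + a)) ->
  exists2 s : R, 0 <= s <= 1 & f (d + a) - f a = 'D_d f (s *: d + a).
Proof.
move=> df; pose phi (s : R) := f (s *: d + a).
have dphi (s : R) : 0 <= s <= 1 -> is_derive s (1 : R) phi ('D_d f (s *: d + a)).
  move=> s01; apply: DeriveDef.
    apply: diff_derivable.
    by apply: (@differentiable_comp _ _ _ _ (fun s : R => s *: d + a) f) => //; exact: df.
  rewrite /phi; apply: (@derive_affine _ _ _ _ f (fun s : R => s *: d + a)) => h.
  by rewrite scalerDl [h *: 1]mulr1 addrA.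
have [s /[!in_itv]/= /andP[s0 s1] E] : exists2 c, c \in `]0, 1[%R &
    phi 1 - phi 0 = 'D_d f (c *: d + a) * (1 - 0).
  apply: MVT => // [s /[!in_itv]/= /andP[s0 s1]|].
    by apply: dphi; rewrite (ltW s0) (ltW s1).
  apply: derivable_within_continuous => s /[!in_itv]/= s01.
  by have := dphi s s01; case.
exists s; first by rewrite (ltW s0) (ltW s1).
by move: E; rewrite /phi scale1r scale0r add0r subr0 mulr1.
Qed.

(** The increment in direction [v] is treated as a function [g] of the base point; the mean value
    theorem applies to [g] along [u], then to ['D_u f] along [v]. *)
Lemma second_difference V (A : set V) (f : V -> R) a u v : open A ->
  Ck_on 2 A f ->
  (forall s s' : R, 0 <= s <= 1 -> 0 <= s' <= 1 -> A (s' *: v + (s *: u + a))) ->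
  exists s s' : R, [/\ 0 <= s <= 1, 0 <= s' <= 1 &
    f (v + (u + a)) - f (u + a) - (f (v + a) - f a) =
    'D_v ('D_u f) (s' *: v + (s *: u + a))].
Proof.
move=> oA [df Df] Auv.
have A1 s : 0 <= s <= 1 -> A (s *: u + a).
  by move=> s01; have := Auv s 0 s01; rewrite scale0r add0r lexx ler01; apply.
have A2 s : 0 <= s <= 1 -> A (v + (s *: u + a)).
  by move=> s01; have := Auv s 1 s01; rewrite scale1r lexx ler01; apply.
pose g x := f (v + x) - f x.
have dfv x : A (v + x) -> differentiable (fun x => f (v + x)) x.
  by move=> Ax; apply: (@differentiable_comp _ _ _ _ (fun x => v + x) f) => //; exact: df.
have [s s01 E] : exists2 s : R, 0 <= s <= 1 & g (u + a) - g a = 'D_u g (s *: u + a).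
  apply: mean_value => s s01.
  apply: (@differentiableB _ _ _ (fun x => f (v + x)) f).
    by apply: dfv; exact: A2.
  by apply: df; exact: A1.
have [s' s'01 E'] : exists2 s' : R, 0 <= s' <= 1 &
    'D_u f (v + (s *: u + a)) - 'D_u f (s *: u + a) =
    'D_v ('D_u f) (s' *: v + (s *: u + a)).
  apply: (@mean_value V ('D_u f) (s *: u + a) v) => s' s'01; have [Duf _] := Df u.
  by apply: Duf; exact: Auv.
exists s, s'; split => //; rewrite -E'.
rewrite (_ : f _ - _ - _ = g (u + a) - g a)// E /g.
rewrite (@deriveB _ _ _ (fun x => f (v + x)) f).
- congr (_ - _); apply: derive_affine => h.
  by rewrite addrCA.
- by apply: diff_derivable; apply: dfv; exact: A2.
- by apply: diff_derivable; apply: df; exact: A1.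
Qed.

(** Schwarz's theorem. The second difference is symmetric in the two directions; evaluating it in
    both orders gives the two iterated derivatives at points close to [a], and their continuity at
    [a] concludes. *)
Lemma derive_comm V (A : set V) (f : V -> R) a u v : open A -> A a ->
  Ck_on 2 A f -> 'D_v ('D_u f) a = 'D_u ('D_v f) a.
Proof.
move=> oA Aa fk; have [df Df] := fk.
have dD w x : A x -> differentiable ('D_w f) x by have [] := Df w; auto.
have D2c w w' : {for a, continuous ('D_w' ('D_w f))}.
  by have [_ /(_ w')] := Df w; apply.
have D2s (h : R) w w' x : A x ->
    'D_(h *: w') ('D_(h *: w) f) x = h * (h * 'D_w' ('D_w f) x).
  move=> Ax; rewrite derive_scale; last exact: dD.
  congr (_ * _).
  rewrite (@near_eq_derive _ _ _ _ (h *: ('D_w f : V -> R))).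
    by rewrite deriveZ//; apply: diff_derivable; exact: dD.
  apply: filterS (open_nbhs_nbhs (conj oA Ax)) => y Ay.
  by rewrite derive_scale//; exact: df.
apply/eqP; rewrite -subr_eq0 -normr_le0; apply/ler_addgt0Pl => e e0.
rewrite addr0.
have e20 : 0 < e / 2 by rewrite divr_gt0.
have nearP (g1 g2 : V -> R) :
    {for a, continuous g1} -> {for a, continuous g2} -> \forall x \near a,
    [/\ A x, `|g1 a - g1 x| < e / 2 & `|g2 a - g2 x| < e / 2].
  move=> c1 c2; apply: filterS3 (open_nbhs_nbhs (conj oA Aa))
    (continuous_near_dist c1 e20) (continuous_near_dist c2 e20).
  by move=> x ? ? ?; split.
have := nearP _ _ (D2c u v) (D2c v u).
move=> /nbhs_normP[r /= r0 rP].
(* The parallelogram spanned by [h *: u] and [h *: v] must lie in the ball of radius [r]; the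
   summand 1 keeps the denominator positive and the inequality strict. *)
have [h h0 hr] : exists2 h : R, 0 < h & h * `|u| + h * `|v| < r.
  exists (r / (`|u| + `|v| + 1)).
    by rewrite divr_gt0// addr_ge0_gt0// addr_ge0.
  have p0 : 0 < `|u| + `|v| + 1 by rewrite ltr_wpDl// addr_ge0.
  rewrite -mulrDr -mulrA gtr_pMr// mulrC ltr_pdivrMr// mul1r ltrDl ltr01//.
have inr (s s' : R) : 0 <= s <= 1 -> 0 <= s' <= 1 ->
    `|a - (s' *: (h *: v) + (s *: (h *: u) + a))| < r.
  move=> /andP[s0 s1] /andP[s'0 s'1].
  rewrite addrA opprD addrCA subrr addr0 normrN.
  apply: le_lt_trans hr; rewrite addrC (le_trans (ler_normD _ _))//.
  rewrite !normrZ (ger0_norm s0) (ger0_norm s'0) (gtr0_norm h0).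
  by apply: lerD; rewrite ler_piMl// mulr_ge0// ltW.
have [s [s' [s01 s'01 E1]]] : exists s s' : R, [/\ 0 <= s <= 1, 0 <= s' <= 1 &
    f (h *: v + (h *: u + a)) - f (h *: u + a) - (f (h *: v + a) - f a) =
    'D_(h *: v) ('D_(h *: u) f) (s' *: (h *: v) + (s *: (h *: u) + a))].
  apply: (second_difference oA fk) => s s' s01 s'01.
  by have [] := rP _ (inr _ _ s01 s'01).
have [q [q' [q01 q'01 E2]]] : exists s s' : R, [/\ 0 <= s <= 1, 0 <= s' <= 1 &
    f (h *: u + (h *: v + a)) - f (h *: v + a) - (f (h *: u + a) - f a) =
    'D_(h *: u) ('D_(h *: v) f) (s' *: (h *: u) + (s *: (h *: v) + a))].
  apply: (second_difference oA fk) => q q' q01 q'01.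
  rewrite addrCA; by have [] := rP _ (inr _ _ q'01 q01).
have inr2 := inr _ _ q'01 q01; rewrite addrCA in inr2.
have [A1 B1 _] := rP _ (inr _ _ s01 s'01).
have [A2 _ B2] := rP _ inr2.
(* The two second differences are the same number, and each carries a factor [h * h], which
   cancels. *)
have EE : 'D_v ('D_u f) (s' *: (h *: v) + (s *: (h *: u) + a)) =
          'D_u ('D_v f) (q' *: (h *: u) + (q *: (h *: v) + a)).
  rewrite (D2s _ _ _ _ A1) in E1; rewrite (D2s _ _ _ _ A2) in E2.
  have hn : h != 0 by rewrite gt_eqF.
  refine (mulfI hn (mulfI hn (etrans (etrans (esym E1) _) E2))).
  by rewrite [h *: v + (h *: u + a)]addrCA; ring.
move: B1 B2; rewrite EE; clear.
move: ('D_v _ a) ('D_u _ a) ('D_u _ _) => x y z /ltW B1 /ltW B2.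
rewrite (le_trans (ler_distD z x y))// [e]splitr lerD// distrC.
exact: B2.
Qed.

End MeanValue.
(** * Limits of matrices *)

Section MatrixLimits.
Context {R : realType} {I : Type} {F : set_system I} {FF : Filter F}.

Lemma norm_entry_le p q (M : 'M[R]_(p, q)) i j : `|M i j| <= `|M|.
Proof.
rewrite [leRHS]/Num.Def.normr/= mx_normrE.
exact: (le_bigmax _ (fun ij : 'I_p * 'I_q => `|M ij.1 ij.2|) (i, j)).
Qed.

Lemma norm_mx_le p q (M : 'M[R]_(p, q)) (e : R) : 0 <= e ->
  (forall i j, `|M i j| <= e) -> `|M| <= e.
Proof.
by move=> e0 Me; rewrite /Num.Def.normr/= mx_normrE bigmax_le// => -[].
Qed.

Lemma cvg_mxP p q (X : I -> 'M[R]_(p, q)) (M : 'M[R]_(p, q)) :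
  X @ F --> M <-> forall i j, X x i j @[x --> F] --> M i j.
Proof.
split=> [XM i j|XM].
  by apply: (cvg_comp X (fun N : 'M[R]_(p, q) => N i j) XM); exact: coord_continuous.
apply/cvgrPdist_le => e e0.
have H : \forall x \near F, forall ij : 'I_p * 'I_q, `|M ij.1 ij.2 - X x ij.1 ij.2| <= e.
  by apply: filter_forall => ij; move/cvgrPdist_le: (XM ij.1 ij.2); apply.
apply: filterS H => x H; apply: norm_mx_le; first exact: ltW.
by move=> i j; rewrite !mxE; exact: (H (i, j)).
Qed.

Lemma cvg_bigsum (J : finType) (P : pred J) (X : J -> I -> R) (m : J -> R) :
  (forall j, X j x @[x --> F] --> m j) ->
  \sum_(j | P j) X j x @[x --> F] --> \sum_(j | P j) m j.
Proof. by move=> Xm; apply: cvg_big => // -[a b]; exact: add_continuous. Qed.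

Lemma cvg_bigprod (J : finType) (P : pred J) (X : J -> I -> R) (m : J -> R) :
  (forall j, X j x @[x --> F] --> m j) ->
  \prod_(j | P j) X j x @[x --> F] --> \prod_(j | P j) m j.
Proof. by move=> Xm; apply: cvg_big => // -[a b]; exact: mul_continuous. Qed.

Lemma cvg_mulmx p q r (X : I -> 'M[R]_(p, q)) (Y : I -> 'M[R]_(q, r))
    (M : 'M[R]_(p, q)) (N : 'M[R]_(q, r)) :
  X @ F --> M -> Y @ F --> N -> X x *m Y x @[x --> F] --> M *m N.
Proof.
move=> /cvg_mxP XM /cvg_mxP YN; apply/cvg_mxP => i j; rewrite mxE.
under eq_fun do rewrite mxE.
by apply: cvg_bigsum => k; exact: cvgM.
Qed.

Lemma cvg_trmx p q (X : I -> 'M[R]_(p, q)) (M : 'M[R]_(p, q)) :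
  X @ F --> M -> (X x)^T @[x --> F] --> M^T.
Proof.
move=> /cvg_mxP XM; apply/cvg_mxP => i j; rewrite mxE.
under eq_fun do rewrite mxE.
exact: XM.
Qed.

Lemma cvg_det p (X : I -> 'M[R]_p) (M : 'M[R]_p) :
  X @ F --> M -> \det (X x) @[x --> F] --> \det M.
Proof.
move=> /cvg_mxP XM; apply: cvg_bigsum => s; apply: cvgM; first exact: cvg_cst.
by apply: cvg_bigprod => i; exact: XM.
Qed.

Lemma cvg_mxsub p q p' q' (f : 'I_p' -> 'I_p) (g : 'I_q' -> 'I_q)
    (X : I -> 'M[R]_(p, q)) (M : 'M[R]_(p, q)) :
  X @ F --> M -> mxsub f g (X x) @[x --> F] --> mxsub f g M.
Proof.
move=> /cvg_mxP XM; apply/cvg_mxP => i j; rewrite mxE.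
under eq_fun do rewrite mxE.
exact: XM.
Qed.

Lemma near_unitmx p (X : I -> 'M[R]_p) (M : 'M[R]_p) : X @ F --> M -> M \in unitmx ->
  \forall x \near F, X x \in unitmx.
Proof.
move=> XM; rewrite unitmxE unitfE => M0.
have H : \forall x \near F, \det (X x) != 0.
  exact: cvgr_neq0 (cvg_det XM) M0.
by apply: filterS H => x; rewrite unitmxE unitfE.
Qed.

(** The adjugate formula makes the inverse a quotient of polynomials in the entries. It is available
    only near the limit, since [invmx] returns its argument on singular matrices. *)
Lemma cvg_invmx p (X : I -> 'M[R]_p) (M : 'M[R]_p) : M \in unitmx ->
  X @ F --> M -> invmx (X x) @[x --> F] --> invmx M.
Proof.
move=> uM XM.
have H : \forall x \near F, (\det (X x))^-1 *: \adj (X x) = invmx (X x).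
  by apply: filterS (near_unitmx XM uM) => x uX; rewrite /invmx uX.
apply: (cvg_trans (near_eq_cvg H)); rewrite /invmx uM.
apply/cvg_mxP => i j; rewrite !mxE.
under eq_fun do rewrite !mxE.
have d0 : \det M != 0 by move: uM; rewrite unitmxE unitfE.
apply: cvgM; first by apply: cvgV => //; exact: cvg_det.
apply: cvgM; first exact: cvg_cst.
apply: cvg_det; apply/cvg_mxP => k k'; rewrite !mxE.
under eq_fun do rewrite !mxE.
by move/cvg_mxP: XM; exact.
Qed.

End MatrixLimits.

(** [kermx] is a left kernel, hence the passage to the transpose. *)
Lemma unitmx_inj (K : fieldType) p (M : 'M[K]_p) :
  (forall d : 'cV_p, M *m d = 0 -> d = 0) -> M \in unitmx.
Proof.
move=> Mi; rewrite -unitmx_tr -row_free_unit -kermx_eq0; apply/eqP/row_matrixP => i.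
rewrite row0; apply: trmx_inj; rewrite trmx0; apply: Mi.
by apply: trmx_inj; rewrite trmx_mul trmxK -row_mul mulmx_ker row0 trmx0.
Qed.
(** * The implicit function theorem *)

Lemma cvg_pair_nbhs {I : Type} {F : set_system I} {FF : Filter F}
    (U V : topologicalType) (f : I -> U) (g : I -> V) (a : U) (b : V) :
  f @ F --> a -> g @ F --> b -> (f x, g x) @[x --> F] --> (a, b).
Proof. by move=> fa gb; exact: (@cvg_pair _ _ _ F (nbhs a) (nbhs b)). Qed.

Section ImplicitFunction.
Context {R : realType}.

Lemma norm_pair_le (U V : normedModType R) (p : U * V) (c : R) :
  (`|p| <= c) = (`|p.1| <= c) && (`|p.2| <= c).
Proof. by rewrite prod_normE ge_max. Qed.

Lemma norm_mulmx_le p q (M : 'M[R]_(p, q)) :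
  exists2 c : R, 0 < c & forall d : 'cV[R]_q, `|M *m d| <= c * `|d|.
Proof.
exists (q%:R * `|M| + 1) => [|d]; first by rewrite ltr_wpDl// mulr_ge0.
apply: norm_mx_le => [|i j]; first by rewrite mulr_ge0// addr_ge0// mulr_ge0.
rewrite mxE (le_trans (ler_norm_sum _ _ _))//.
apply: (@le_trans _ _ (\sum_(k < q) `|M| * `|d|)).
  apply: ler_sum => k _; rewrite normrM.
  by apply: ler_pM => //; exact: norm_entry_le.
rewrite sumr_const card_ord -[leLHS]mulr_natl mulrA mulrDl mul1r.
by rewrite lerDl.
Qed.

(** With [p.+1] instead of [p] the threshold stays positive when [p = 0]. *)
Lemma small_mulmx_le p (M : 'M[R]_p) :
  `|M| <= (2 * p.+1%:R)^-1 -> forall d : 'cV[R]_p, `|M *m d| <= 2^-1 * `|d|.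
Proof.
move=> Mp d; apply: norm_mx_le => [|i j]; first by rewrite mulr_ge0// invr_ge0.
rewrite mxE (le_trans (ler_norm_sum _ _ _))//.
apply: (@le_trans _ _ (\sum_(k < p) (2 * p.+1%:R)^-1 * `|d|)).
  apply: ler_sum => k _; rewrite normrM.
  apply: ler_pM => //; last exact: norm_entry_le.
  exact: le_trans (norm_entry_le _ _ _) Mp.
rewrite sumr_const card_ord -[leLHS]mulr_natl mulrA ler_wpM2r//.
rewrite invfM mulrCA ler_piMr ?invr_ge0//.
by rewrite ler_pdivrMr ?ltr0n// mul1r ler_nat.
Qed.

(** The displacement [r / 2] of the centre and the contraction ratio 1/2 add up to [r], so the
    closed ball is stable and Banach's theorem applies in it. *)
Lemma contraction_ball_fixed (X : completeNormedModType R) (g : X -> X)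
    (x0 : X) (r : R) : 0 <= r ->
  (forall x y, `|x - x0| <= r -> `|y - x0| <= r ->
    `|g x - g y| <= 2^-1 * `|x - y|) ->
  `|g x0 - x0| <= r / 2 -> exists2 x, `|x - x0| <= r & g x = x.
Proof.
move=> r0 gL gx0.
pose U := [set x : X | `|x - x0| <= r].
have gU : {homo g : x / U x >-> U x}.
  move=> x Ux; rewrite /U /= -(subrKA (g x0)) (le_trans (ler_normD _ _))//.
  rewrite [r]splitr; apply: lerD => //.
  apply: (le_trans (gL _ _ Ux _)); first by rewrite subrr normr0.
  by rewrite mulrC ler_wpM2r// invr_ge0.
have half_ge0 : 0 <= (2^-1 : R) by rewrite invr_ge0.
have ctr : is_contraction (mkfun_fun gU).
  exists (NngNum half_ge0); split; first by rewrite /= invf_lt1// ltr1n.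
  by move=> [x y] [/= Ux Uy]; exact: gL.
have clU : closed U.
  rewrite (_ : U = (fun x => `|x - x0|) @^-1` [set y | y <= r])//.
  apply: closed_comp; last exact: closed_le.
  move=> x _; apply: cvg_norm; apply: cvgB; [exact: cvg_id|exact: cvg_cst].
have [|x Ux xE] := banach_fixed_point ctr clU.
  by exists x0; rewrite /U /= subrr normr0.
by exists x.
Qed.

Context {T : normedModType R} {N : nat}.
Implicit Types (F : 'cV[R]_N * T -> 'cV[R]_N) (B : 'M[R]_N).

(** The mean value theorem concerns real functions, so it is applied to each coordinate of the
    Newton map [G]. The sup norm lets every coordinate have its own intermediate point. *)
Lemma newton_lipschitz F B (e0 : 'cV[R]_N) (t : T) (r : R) :
  (forall e, `|e - e0| <= r -> differentiable F (e, t)) ->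
  (forall e d, `|e - e0| <= r ->
    `|d - B *m 'D_((d, 0) : 'cV[R]_N * T) F (e, t)| <= 2^-1 * `|d|) ->
  forall e e', `|e - e0| <= r -> `|e' - e0| <= r ->
  `|(e - B *m F (e, t)) - (e' - B *m F (e', t))| <= 2^-1 * `|e - e'|.
Proof.
move=> dF FB e e' er e'r.
pose d := e - e'; pose dd : 'cV[R]_N * T := (d, 0).
have seg (s : R) : 0 <= s <= 1 -> `|s *: d + e' - e0| <= r.
  move=> /andP[s0 s1].
  have -> : s *: d + e' - e0 = s *: (e - e0) + (1 - s) *: (e' - e0).
    rewrite /d !scalerBr !scalerBl !scale1r; apply/matrixP => i j.
    by rewrite !mxE; ring.
  rewrite (le_trans (ler_normD _ _))// !normrZ ger0_norm// ger0_norm ?subr_ge0//.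
  rewrite (_ : r = s * r + (1 - s) * r); last by ring.
  by apply: lerD; apply: ler_wpM2l; rewrite ?subr_ge0.
have segE (s : R) : s *: dd + (e', t) = (s *: d + e', t).
  by rewrite /dd; congr pair; rewrite /= scaler0 add0r.
apply: norm_mx_le => [|i j]; first by rewrite mulr_ge0// invr_ge0.
rewrite (ord1 j) {j}.
have cB : continuous (mulmx B : 'cV[R]_N -> 'cV[R]_N).
  move=> M; apply: (@cvg_mulmx _ _ (nbhs M) _ _ _ _ (cst B) id B M).
    exact: cvg_cst.
  exact: cvg_id.
pose G (p : 'cV[R]_N * T) := p.1 - B *m F p.
have dG p : differentiable F p -> differentiable G p.
  move=> dFp.
  apply: (@differentiableB _ _ _ (fst : _ -> 'cV[R]_N) (fun p => B *m F p)).
    by apply: linear_differentiable => q; exact: cvg_fst.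
  apply: (@differentiable_comp _ _ _ _ F (mulmx B)) => //.
  exact: linear_differentiable.
have DG p : differentiable F p -> 'D_dd G p = d - B *m 'D_dd F p.
  move=> dFp; rewrite (@deriveB _ _ _ (fst : _ -> 'cV[R]_N) (fun p => B *m F p)).
  - congr (_ - _); first exact: derive_affine_along.
    by rewrite (@derive_compl _ _ _ _ (mulmx B))//; exact: diff_derivable.
  - by apply: diff_derivable; apply: linear_differentiable => q; exact: cvg_fst.
  - apply: diff_derivable.
    apply: (@differentiable_comp _ _ _ _ F (mulmx B)) => //.
    exact: linear_differentiable.
have cc : continuous (coord_lin i : 'cV[R]_N -> R) by exact: coord_continuous.
have [s s01 E] : exists2 s : R, 0 <= s <= 1 &
    G (dd + (e', t)) i 0 - G (e', t) i 0 =
    'D_dd (fun p => G p i 0) (s *: dd + (e', t)).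
  apply: (@mean_value _ _ (fun p => G p i 0) (e', t) dd) => s s01.
  apply: (@differentiable_comp _ _ _ _ G (coord_lin i)).
    by apply: dG; rewrite segE; apply: dF; exact: seg.
  exact: linear_differentiable.
move: E; rewrite -[dd]scale1r segE scale1r scale1r subrK.
have dFs : differentiable F (s *: d + e', t) by apply: dF; exact: seg.
rewrite segE (@derive_compl _ _ _ _ (coord_lin i : {linear 'cV[R]_N -> R}))//; last first.
  by apply: diff_derivable; exact: dG.
rewrite DG//= /G /= => E.
rewrite !mxE in E *; rewrite E.
apply: le_trans (FB _ d (seg s s01)).
by have := norm_entry_le (d - B *m 'D_dd F (s *: d + e', t)) i 0; rewrite !mxE.
Qed.

(** Linearising [F] along its zeros gives [J *m (e t - e s)] plus the parameter term, up to an error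
    small relative to the pair of increments. The last hypothesis bounds the increment of [e] by
    that of the parameter, so the error is small relative to the latter alone; applying [invmx J]
    isolates the increment of [e]. *)
Lemma implicit_is_diff F (e : T -> 'cV[R]_N) (s : T) (J : 'M[R]_N) (c : R) :
  differentiable F (e s, s) -> J \in unitmx ->
  (forall d, 'd F (e s, s) ((d, 0) : 'cV[R]_N * T) = J *m d) ->
  F (e s, s) = 0 -> (\forall t \near s, F (e t, t) = 0) ->
  (\forall t \near s, `|e t - e s| <= c * `|F (e s, t) - F (e s, s)|) ->
  is_diff s e (fun h => - (invmx J *m 'd F (e s, s) ((0, h) : 'cV[R]_N * T))).
Proof.
move=> dF uJ JE F0 nF nL.
set dFs := 'd F (e s, s).
pose df h := - (invmx J *m dFs ((0, h) : 'cV[R]_N * T)).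
have dfl : linear df.
  move=> a u v; rewrite /df.
  have -> : ((0, a *: u + v) : 'cV[R]_N * T) = a *: (0, u) + (0, v).
    by congr pair; rewrite /= scaler0 addr0.
  by rewrite linearP mulmxDr -scalemxAr opprD scalerN.
pose dfL : {linear T -> 'cV[R]_N} :=
  HB.pack df (GRing.isLinear.Build _ _ _ _ _ dfl).
have cd : continuous dFs by exact: diff_continuous.
have [k k0 kP] := linear_lipschitz cd.
have [j j0 jP] := norm_mulmx_le (invmx J).
have cdf : continuous dfL.
  move=> h; apply: cvgN.
  apply: (@cvg_mulmx _ _ (nbhs h) _ _ _ _ (cst (invmx J))
    (fun h => dFs (0, h)) (invmx J) (dFs (0, h))); first exact: cvg_cst.
  apply: (cvg_comp (fun h => ((0, h) : 'cV[R]_N * T)) dFs); last exact: cd.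
  apply: (@cvg_pair_nbhs _ (nbhs h)); [exact: cvg_cst|exact: cvg_id].
suff : is_diff s e dfL by [].
apply: approx_is_diff => // eps eps0.
(* [k + 1] bounds the growth of [F] in the parameter: [k] comes from the differential, 1 from the
   error term. The maximum covers a negative [c]. The last summand gives [1 <= C], so that [C] times
   the norm of [h] also dominates the second component of the pair of increments. *)
pose C := Num.max 0 c * (k + 1) + 1.
have C0 : 0 < C.
  by rewrite ltr_wpDl// mulr_ge0 ?le_max ?lexx// addr_ge0// ltW.
have C1 : 1 <= C.
  by rewrite lerDr mulr_ge0 ?le_max ?lexx// addr_ge0// ltW.
have approx := differentiable_approx dF.
have n1 : \forall h \near (0 : T), `|F (e s, h + s) - F (e s, s) - dFs (0, h)| <= 1 * `|h|.
  have := approx 1 ltr01 => /nbhs_normP[rho /= rho0 H].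
  apply/nbhs_normP; exists rho => //= h; rewrite /ball_/= sub0r normrN => hr.
  have hE : `|((0, h) : 'cV[R]_N * T)| = `|h|.
    by rewrite prod_normE /= normr0; apply/max_idPr.
  have := H (0, h); rewrite /ball_/= sub0r normrN hE => /(_ hr).
  by rewrite (_ : ((0, h) : 'cV[R]_N * T) + (e s, s) = (e s, h + s))//; congr pair; rewrite /= add0r.
have nL0 : \forall h \near (0 : T), `|e (h + s) - e s| <= c * `|F (e s, h + s) - F (e s, s)|.
  by move/nbhs0P: nL; apply: filterS => h; rewrite [s + h]addrC.
have nF0 : \forall h \near (0 : T), F (e (h + s), h + s) = 0.
  by move/nbhs0P: nF; apply: filterS => h; rewrite [s + h]addrC.
have n2 : \forall h \near (0 : T), `|e (h + s) - e s| <= C * `|h|.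
  apply: filterS2 n1 nL0 => h H1 H2; apply: (le_trans H2).
  have H3 : `|F (e s, h + s) - F (e s, s)| <= (k + 1) * `|h|.
    rewrite -[X in `|X|](subrK (dFs (0, h))) (le_trans (ler_normD _ _))//.
    rewrite addrC mulrDl; apply: lerD => //.
    apply: (le_trans (kP _)); by rewrite (ler_wpM2l (ltW k0))// norm_pair_le /= normr0 normr_ge0 lexx.
  apply: (@le_trans _ _ (Num.max 0 c * `|F (e s, h + s) - F (e s, s)|)).
    by rewrite ler_wpM2r// le_max lexx orbT.
  apply: (@le_trans _ _ (Num.max 0 c * ((k + 1) * `|h|))).
    by rewrite ler_wpM2l// le_max lexx.
  by rewrite mulrA ler_wpM2r// /C lerDl.
(* The tolerance [eps / (j * C)] anticipates the factor [C] from the size of the pair of increments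
   and the factor [j] from [invmx J]. *)
have n3 : \forall h \near (0 : T),
   `|F (e (h + s), h + s) - F (e s, s) - dFs (e (h + s) - e s, h)| <=
   eps / (j * C) * (C * `|h|).
  have ep : 0 < eps / (j * C) by rewrite divr_gt0// mulr_gt0.
  have := approx _ ep => /nbhs_normP[rho /= rho0 H].
  have n4 : \forall h \near (0 : T), `|h| < rho / C by apply: nbhs0_lt; rewrite divr_gt0.
  apply: filterS2 n2 n4 => h H1 H2.
  pose kh : 'cV[R]_N * T := (e (h + s) - e s, h).
  have khC : `|kh| <= C * `|h|.
    by rewrite norm_pair_le H1 /= ler_peMl.
  have := H kh; rewrite /ball_/= sub0r normrN.
  rewrite (_ : kh + (e s, s) = (e (h + s), h + s)); last by congr pair; rewrite /= subrK.
  have khr : `|kh| < rho.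
    by apply: (le_lt_trans khC); rewrite mulrC -ltr_pdivlMr.
  move=> /(_ khr) H3; apply: (le_trans H3); by rewrite (ler_wpM2l (ltW ep)).
apply: filterS2 nF0 n3 => h F1; rewrite F1 F0 subrr sub0r normrN => H.
have khE : dFs (e (h + s) - e s, h) = J *m (e (h + s) - e s) + dFs (0, h).
  rewrite -JE -/dFs -linearD; congr (dFs _).
  by congr pair; rewrite /= ?addr0 ?add0r.
have -> : e (h + s) - e s - dfL h = invmx J *m dFs (e (h + s) - e s, h).
  by rewrite khE mulmxDr mulKmx// /dfL /= /df opprK.
apply: (le_trans (jP _)).
apply: (@le_trans _ _ (j * (eps / (j * C) * (C * `|h|)))).
  by rewrite (ler_wpM2l (ltW j0)).
rewrite le_eqVlt; apply/orP; left; apply/eqP; field.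
by rewrite !gt_eqF.
Qed.

End ImplicitFunction.
(** Completeness allows [contraction_ball_fixed] to be applied in ['cV[R]_N]. *)
HB.instance Definition _ (R : realType) (p q : nat) :=
  Uniform_isComplete.Build 'M[R]_(p, q) cauchy_cvg.

Lemma linear_cV_sum (R : realType) p (W : lmodType R) (g : {linear 'cV[R]_p -> W}) d :
  g d = \sum_i d i 0 *: g (delta_mx i 0).
Proof.
have dE : d = \sum_j d j 0 *: delta_mx j 0.
  apply/matrixP => i j; rewrite summxE (bigD1 i)//= big1 => [|k ki].
    by rewrite !mxE (ord1 j) !eqxx mulr1 addr0.
  by rewrite !mxE eq_sym (negbTE ki) mulr0.
by rewrite {1}dE linear_sum; apply: eq_bigr => k _; rewrite linearZ.
Qed.

Lemma linear_cV_mulmx (R : realType) p q (g : {linear 'cV[R]_p -> 'cV[R]_q}) d :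
  g d = (\matrix_(i, j) g (delta_mx j 0) i 0) *m d.
Proof.
apply/matrixP => i j; rewrite linear_cV_sum summxE (ord1 j) mxE.
by apply: eq_bigr => k _; rewrite !mxE mulrC.
Qed.

(** * Existence and continuous differentiability of the implicit function *)

Section ImplicitFunctionTheorem.
Context {R : realType} {T : normedModType R} {N : nat}.
Variables (A : set ('cV[R]_N * T)) (F : 'cV[R]_N * T -> 'cV[R]_N).
Hypotheses (oA : open A) (F1 : Ck_on 1 A F).

Let J (p : 'cV[R]_N * T) : 'M[R]_N := \matrix_(i, j) 'D_((delta_mx j 0, 0) : 'cV[R]_N * T) F p i 0.

Let dF p : A p -> differentiable F p.
Proof. by have [+ _] := F1; apply. Qed.

Let JdE p d : A p -> 'd F p ((d, 0) : 'cV[R]_N * T) = J p *m d.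
Proof.
move=> Ap; pose g d := 'd F p ((d, 0) : 'cV[R]_N * T).
have gl : linear g.
  move=> a u v; rewrite /g.
  have -> : ((a *: u + v, 0) : 'cV[R]_N * T) = a *: (u, 0) + (v, 0).
    by congr pair; rewrite /= scaler0 addr0.
  by rewrite linearP.
pose gL : {linear 'cV[R]_N -> 'cV[R]_N} :=
  HB.pack g (GRing.isLinear.Build _ _ _ _ _ gl).
have := linear_cV_mulmx gL d; rewrite [gL d]/(g d) /g => ->.
by congr (_ *m _); apply/matrixP => i j; rewrite !mxE deriveE//; exact: dF.
Qed.

Let JE p d : A p -> 'D_((d, 0) : 'cV[R]_N * T) F p = J p *m d.
Proof. by move=> Ap; rewrite deriveE ?JdE//; exact: dF. Qed.

Let DFc p v : A p -> {for p, continuous ('D_v F)}.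
Proof. by move=> Ap; have [_ /(_ v)] := F1; apply. Qed.

Let Jc p : A p -> {for p, continuous J}.
Proof.
move=> Ap; apply/(@cvg_mxP _ _ (nbhs p)) => i j; rewrite /J mxE.
under eq_fun do rewrite mxE.
apply: (cvg_comp _ (fun M : 'cV[R]_N => M i 0) (DFc (v := (delta_mx j 0, 0)) Ap)).
exact: coord_continuous.
Qed.

(** Simplified Newton method: the inverse [B] of the partial Jacobian is frozen at the base point.
    For each nearby [t] the zeros of [F (_, t)] are the fixed points of [e - B *m F (e, t)], a
    contraction on a ball that does not depend on [t]. *)
Lemma implicit_function (e0 : 'cV[R]_N) (t0 : T) : A (e0, t0) ->
  F (e0, t0) = 0 ->
  (forall d, 'D_((d, 0) : 'cV[R]_N * T) F (e0, t0) = 0 -> d = 0) ->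
  exists2 e : T -> 'cV[R]_N, e t0 = e0 &
    \forall t \near t0, [/\ A (e t, t), F (e t, t) = 0 & C1_at e t].
Proof.
move=> A0 F0 inj.
have uJ0 : J (e0, t0) \in unitmx.
  by apply: unitmx_inj => d; rewrite -JE//; exact: inj.
pose B : 'M[R]_N := invmx (J (e0, t0)).
have [b b0 bP] := norm_mulmx_le B.
pose p0 : 'cV[R]_N * T := (e0, t0).
have cBJ : 1%:M - B *m J p @[p --> nbhs p0] --> (0 : 'M[R]_N).
  have E : 1%:M - B *m J p0 = 0 by rewrite mulVmx// subrr.
  rewrite -E.
  have H2 := @cvg_mulmx _ _ _ (nbhs_filter p0) _ _ _ _ _ _ _
       (@cvg_cst 'M[R]_N B _ _ (nbhs_filter p0)) (Jc A0).
  have H1 := @cvg_cst 'M[R]_N 1%:M _ _ (nbhs_filter p0).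
  exact: (@cvgB _ 'M[R]_N _ _ (nbhs_filter p0) _ _ _ _ H1 H2).
(* The threshold of [small_mulmx_le], which yields the ratio 1/2. *)
have pos : 0 < (2 * N.+1%:R)^-1 :> R by rewrite invr_gt0 mulr_gt0// ltr0n.
have /nbhs_normP[r /= r0 rP] : \forall p \near p0,
    A p /\ `|1%:M - B *m J p| <= (2 * N.+1%:R)^-1.
  have n1 : \forall p \near p0, A p by exact: open_nbhs_nbhs.
  have n2 := cvgr0_norm_le (FF := nbhs_filter p0) _ cBJ _ pos.
  by apply: (filterS2 _ _ n1 n2) => p ? ?; split.
(* Closed balls of radius [q] fit into the open ball of radius [r]. *)
pose q := r / 2.
have q0 : 0 < q by rewrite divr_gt0.
have qr : q < r by rewrite /q ltr_pdivrMr// ltr_pMr// ltr1n.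
have box (e : 'cV[R]_N) (t : T) : `|e - e0| <= q -> `|t - t0| <= q ->
    A (e, t) /\ `|1%:M - B *m J (e, t)| <= (2 * N.+1%:R)^-1.
  move=> eq tq; apply: rP; rewrite /ball_/= (le_lt_trans _ qr)// norm_pair_le /=.
  by rewrite distrC eq distrC tq.
have contr (e : 'cV[R]_N) (t : T) (d : 'cV[R]_N) : `|e - e0| <= q -> `|t - t0| <= q ->
    `|d - B *m (J (e, t) *m d)| <= 2^-1 * `|d|.
  move=> eq tq; have [_ /small_mulmx_le/(_ d)] := box _ _ eq tq.
  by rewrite mulmxBl mul1mx mulmxA.
have Lip (t : T) : `|t - t0| <= q -> forall e e' : 'cV[R]_N, `|e - e0| <= q -> `|e' - e0| <= q ->
    `|(e - B *m F (e, t)) - (e' - B *m F (e', t))| <= 2^-1 * `|e - e'|.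
  move=> tq; apply: newton_lipschitz => [e eq|e d eq].
    by apply: dF; have [] := box _ _ eq tq.
  by rewrite JE ?contr//; have [] := box _ _ eq tq.
(* By [contr], the norm of a kernel vector is at most half of itself. *)
have uJ (e : 'cV[R]_N) (t : T) : `|e - e0| <= q -> `|t - t0| <= q -> J (e, t) \in unitmx.
  move=> eq tq; apply: unitmx_inj => d Jd; have := contr e t d eq tq.
  rewrite Jd mulmx0 subr0 => dd; apply/eqP; rewrite -normr_le0.
  by have := normr_ge0 d; lra.
have BF (e : 'cV[R]_N) (t : T) : B *m F (e, t) = 0 -> F (e, t) = 0.
  by move=> H; rewrite -[F _](mulKVmx uJ0) -/B H mulmx0.
(* [q / 2] is the displacement of the centre that [contraction_ball_fixed] allows. *)
have /nbhs_normP[del /= del0 delP] : \forall t \near t0,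
    `|B *m F (e0, t)| <= q / 2 /\ `|t - t0| <= q.
  have c1 : B *m F (e0, t) @[t --> t0] --> (0 : 'cV[R]_N).
    rewrite -(mulmx0 _ B) -F0.
    apply: (@cvg_mulmx _ _ (nbhs t0) (nbhs_filter t0) _ _ _ (cst B) (fun t => F (e0, t))); first exact: cvg_cst.
    apply: (cvg_comp (fun t => (e0, t) : 'cV[R]_N * T) F).
      by apply: (@cvg_pair_nbhs _ (nbhs t0) (nbhs_filter t0)); [exact: cvg_cst|exact: cvg_id].
    exact: differentiable_continuous (dF A0).
  have q20 : 0 < q / 2 by rewrite divr_gt0.
  have c2 : \forall t \near t0, `|t - t0| <= q.
    by apply/nbhs_normP; exists q => //= t; rewrite /ball_/= distrC => /ltW.
  have n1 := cvgr0_norm_le (FF := nbhs_filter t0) _ c1 _ q20.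
  by apply: (filterS2 _ _ n1 c2) => t ? ?; split.
(* [choice] asks for a total function; 0 is a dummy value at far parameters. *)
have ex (t : T) : exists e : 'cV[R]_N, `|t0 - t| < del -> `|e - e0| <= q /\ F (e, t) = 0.
  have [td|] := boolP (`|t0 - t| < del); last by exists 0.
  have [H1 tq] := delP t td.
  have [||e eq eE] := @contraction_ball_fixed R 'cV[R]_N
    (fun e => e - B *m F (e, t)) e0 q (ltW q0).
  - by move=> x y; exact: Lip.
  - by rewrite addrAC subrr sub0r normrN.
  exists e => _; split => //; apply: BF.
  by move/eqP: eE; rewrite -subr_eq0 addrAC subrr sub0r oppr_eq0 => /eqP.
have {ex} [e eP] := choice ex.
(* Both [e t0] and [e0] are fixed points of the contraction at [t0], hence equal. *)
have et0 : e t0 = e0.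
  have [|e1 F1'] := eP t0; first by rewrite subrr normr0.
  have := Lip t0 _ (e t0) e0 e1; rewrite !subrr !normr0 (ltW q0) F1' F0 mulmx0.
  rewrite !subr0 => /(_ isT isT) H; apply/eqP; rewrite -subr_eq0 -normr_le0.
  by have := normr_ge0 (e t0 - e0); lra.
(* [e t] is fixed by the Newton map at [t], and [e s] is moved by the increment of [F] only. The
   contraction absorbs half of the distance, whence the factor 2. *)
have eL s t : `|t0 - s| < del -> `|t0 - t| < del ->
    `|e t - e s| <= (2 * b) * `|F (e s, t) - F (e s, s)|.
  move=> sd td; have [es Fs] := eP s sd; have [ett Ft] := eP t td.
  have [_ tq] := delP t td.
  have H1 := Lip t tq (e t) (e s) ett es; rewrite Ft mulmx0 subr0 in H1.
  have H2 : `|B *m (F (e s, t) - F (e s, s))| <= b * `|F (e s, t) - F (e s, s)| by exact: bP.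
  have H3 : `|e t - e s| <= `|e t - (e s - B *m F (e s, t))| +
                            `|B *m (F (e s, t) - F (e s, s))|.
    apply: le_trans (ler_normB _ _); rewrite Fs subr0.
    by rewrite opprB addrA addrAC addrK.
  lra.
have nd s : `|t0 - s| < del -> \forall t \near s, `|t0 - t| < del.
  move=> sd; apply/nbhs_normP; exists (del - `|t0 - s|); first by rewrite /= subr_gt0.
  move=> t; rewrite /ball_/= => H.
  by rewrite (le_lt_trans (ler_distD s _ _))// addrC -ltrBrDr.
have ed s : `|t0 - s| < del -> is_diff s e
    (fun h => - (invmx (J (e s, s)) *m 'd F (e s, s) ((0, h) : 'cV[R]_N * T))).
  move=> sd; have [es Fs] := eP s sd; have [_ sq] := delP s sd.
  have [As _] := box _ _ es sq.
  apply: (@implicit_is_diff _ _ _ _ _ _ _ (2 * b)) => //.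
  - exact: dF.
  - exact: uJ.
  - by move=> d; exact: JdE.
  - by apply: filterS (nd s sd) => t td; have [] := eP t td.
  - by apply: filterS (nd s sd) => t td; exact: eL.
exists e => //.
have n0 : \forall t \near t0, `|t0 - t| < del by apply: nd; rewrite subrr normr0.
apply: filterS n0 => s sd; have [es Fs] := eP s sd; have [_ sq] := delP s sd.
have [As _] := box _ _ es sq; split => //; split.
  by apply: filterS (nd s sd) => t td; have [] := ed t td.
move=> d.
(* An expression in [(e t, t)] alone, continuous because matrix inversion is. *)
have DE t : `|t0 - t| < del -> 'D_d e t =
    - (invmx (J (e t, t)) *m 'D_((0, d) : 'cV[R]_N * T) F (e t, t)).
  move=> td; have [et Ft] := eP t td; have [_ tq] := delP t td.
  have [At _] := box _ _ et tq; have [dt dtE] := ed t td.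
  by rewrite deriveE// dtE deriveE//; exact: dF.
rewrite /prop_for /continuous_at (DE s sd).
have nE : \forall t \near s, - (invmx (J (e t, t)) *m 'D_((0, d) : 'cV[R]_N * T) F (e t, t)) = 'D_d e t.
  by apply: filterS (nd s sd) => t td; rewrite (DE t td).
apply: (cvg_trans (near_eq_cvg nE)).
have pc : (e t, t) @[t --> s] --> (e s, s).
  apply: (@cvg_pair_nbhs _ (nbhs s) (nbhs_filter s)); last exact: cvg_id.
  by apply: differentiable_continuous; have [] := ed s sd.
apply: (@cvgN _ _ _ (nbhs s) (nbhs_filter s)).
apply: (@cvg_mulmx _ _ (nbhs s) (nbhs_filter s) _ _ _ (fun t => invmx (J (e t, t)))
  (fun t => 'D_((0, d) : 'cV[R]_N * T) F (e t, t))).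
  apply: (@cvg_invmx _ _ (nbhs s) (nbhs_filter s)); first exact: uJ.
  exact: (cvg_comp _ J pc (Jc As)).
exact: (cvg_comp _ ('D_((0, d) : 'cV[R]_N * T) F) pc (DFc As)).
Qed.

End ImplicitFunctionTheorem.
(** * Open conditions on quadratic forms and ranks *)

Section Dot.
Context {R : realType}.

Lemma dotE p (a b : 'cV[R]_p) : dot a b = (a^T *m b) 0 0.
Proof. by rewrite mxE; apply: eq_bigr => i _; rewrite mxE. Qed.

Lemma dotC p (a b : 'cV[R]_p) : dot a b = dot b a.
Proof. by apply: eq_bigr => i _; rewrite mulrC. Qed.

Lemma dotDl p (a b c : 'cV[R]_p) : dot (a + b) c = dot a c + dot b c.
Proof. by rewrite !dotE linearD mulmxDl mxE. Qed.

Lemma dotNl p (a c : 'cV[R]_p) : dot (- a) c = - dot a c.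
Proof. by rewrite !dotE linearN mulNmx mxE. Qed.

Lemma dotZl p (k : R) (a c : 'cV[R]_p) : dot (k *: a) c = k * dot a c.
Proof. by rewrite mulr_sumr; apply: eq_bigr => i _; rewrite mxE mulrA. Qed.

Lemma dot0l p (c : 'cV[R]_p) : dot 0 c = 0.
Proof. by rewrite dotE trmx0 mul0mx mxE. Qed.

Lemma dot0r p (c : 'cV[R]_p) : dot c 0 = 0.
Proof. by rewrite dotC dot0l. Qed.

Lemma dot_trmul p q (M : 'M[R]_(p, q)) (u : 'cV[R]_p) (d : 'cV[R]_q) :
  dot (M^T *m u) d = dot u (M *m d).
Proof. by rewrite !dotE trmx_mul trmxK mulmxA. Qed.

Lemma rows_in_mul p q r (A : {set 'I_q}) (M : 'M[R]_(q, p)) (X : 'M[R]_(p, r)) :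
  rows_in A M *m X = rows_in A (M *m X).
Proof.
by apply/matrixP => i j; rewrite !mxE; apply: eq_bigr => k _; rewrite mxE.
Qed.

Lemma rows_in_eq0 q (A : {set 'I_q}) (v : 'cV[R]_q) :
  rows_in A v = 0 <-> forall i, i \in A -> v i 0 = 0.
Proof.
split=> [E i iA|E].
  move/matrixP/(_ (enum_rank_in iA i) 0): E; rewrite !mxE.
  by rewrite enum_rankK_in.
by apply/matrixP => k j; rewrite !mxE (ord1 j) E//; exact: enum_valP.
Qed.

Lemma trmx_rows_in p q (A : {set 'I_q}) (M : 'M[R]_(q, p)) (v : 'cV[R]_q) :
  (forall i, i \notin A -> v i 0 = 0) ->
  M^T *m v = (rows_in A M)^T *m rows_in A v.
Proof.
move=> v0; apply/matrixP => i j; rewrite !mxE (ord1 j).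
rewrite (bigID (mem A))/= [X in _ + X]big1 => [|k kA]; last by rewrite v0// mulr0.
rewrite addr0 big_enum_val/=.
by apply: eq_bigr => k _; rewrite !mxE.
Qed.

Lemma row_free_trmul p q (M : 'M[R]_(p, q)) (u : 'cV[R]_p) :
  row_free M -> M^T *m u = 0 -> u = 0.
Proof.
move=> /row_freeP[C MC] Mu.
by rewrite -[u]mul1mx -trmx1 -MC trmx_mul -mulmxA Mu mulmx0.
Qed.

End Dot.

Section OpenConditions.
Context {R : realType} {I : Type} {F : set_system I} {FF : Filter F}.

(** A right inverse of the limit is almost one for [X x]: the product is close to the identity,
    hence invertible, and its inverse corrects the defect. *)
Lemma near_row_free p q (X : I -> 'M[R]_(p, q)) (M : 'M[R]_(p, q)) :
  X @ F --> M -> row_free M -> \forall x \near F, row_free (X x).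
Proof.
move=> XM /row_freeP[C MC].
have XC : X x *m C @[x --> F] --> (1%:M : 'M[R]_p).
  rewrite -MC; exact: cvg_mulmx XM (@cvg_cst 'M[R]_(q, p) C _ F FF).
have u1 : (1%:M : 'M[R]_p) \in unitmx by rewrite unitmx1.
apply: filterS (near_unitmx XC u1) => x uX.
by apply/row_freeP; exists (C *m invmx (X x *m C)); rewrite mulmxA mulmxV.
Qed.

Lemma cvg_entry p q (X : I -> 'M[R]_(p, q)) (M : 'M[R]_(p, q)) i j :
  X @ F --> M -> X x i j @[x --> F] --> M i j.
Proof. by move=> /cvg_mxP; exact. Qed.

Lemma cvg_dot p (X Y : I -> 'cV[R]_p) (a b : 'cV[R]_p) :
  X @ F --> a -> Y @ F --> b -> dot (X x) (Y x) @[x --> F] --> dot a b.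
Proof.
by move=> Xa Yb; apply: cvg_bigsum => i; apply: cvgM; exact: cvg_entry.
Qed.

Lemma cvg_col_mx p1 p2 q (X : I -> 'M[R]_(p1, q)) (Y : I -> 'M[R]_(p2, q))
    (M : 'M[R]_(p1, q)) (N : 'M[R]_(p2, q)) :
  X @ F --> M -> Y @ F --> N -> col_mx (X x) (Y x) @[x --> F] --> col_mx M N.
Proof.
move=> XM YN; apply/cvg_mxP => i j; case: (split_ordP i) => k ->.
  under eq_fun do rewrite col_mxEu.
  by rewrite col_mxEu; exact: cvg_entry.
under eq_fun do rewrite col_mxEd.
by rewrite col_mxEd; exact: cvg_entry.
Qed.

Lemma cvg_row_mx p q1 q2 (X : I -> 'M[R]_(p, q1)) (Y : I -> 'M[R]_(p, q2))
    (M : 'M[R]_(p, q1)) (N : 'M[R]_(p, q2)) :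
  X @ F --> M -> Y @ F --> N -> row_mx (X x) (Y x) @[x --> F] --> row_mx M N.
Proof.
move=> XM YN; apply/cvg_mxP => i j; case: (split_ordP j) => k ->.
  under eq_fun do rewrite row_mxEl.
  by rewrite row_mxEl; exact: cvg_entry.
under eq_fun do rewrite row_mxEr.
by rewrite row_mxEr; exact: cvg_entry.
Qed.

End OpenConditions.

Section KernelPositivity.
Context {R : realType} {I : Type} {F : set_system I} {FF : Filter F}.

(** Taken in row vectors to match [bounded_closed_compact]; the next lemma transposes. *)
Lemma sphere_compact p : compact [set r : 'rV[R]_p | `|r| = 1].
Proof.
apply: bounded_closed_compact.
  by exists 1; split => // M M1 r /= ->; exact: ltW.
rewrite (_ : [set _ | _] = Num.norm @^-1` [set x : R | x = 1])//.
apply: closed_comp; last exact: closed_eq.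
by move=> r _; exact: norm_continuous.
Qed.

(* On a limit direction of norm 1, either [B0 d <> 0] or the form is positive;
   both are open in the direction and the parameter, and the sphere is compact. *)
Lemma near_pos_on_kernel p k (Q : I -> 'M[R]_p) (B : I -> 'M[R]_(k, p))
    (Q0 : 'M[R]_p) (B0 : 'M[R]_(k, p)) :
  Q @ F --> Q0 -> B @ F --> B0 ->
  (forall d, B0 *m d = 0 -> d != 0 -> 0 < dot (Q0 *m d) d) ->
  \forall x \near F, forall d, B x *m d = 0 -> d != 0 -> 0 < dot (Q x *m d) d.
Proof.
move=> QQ BB pos.
pose P x (r : 'rV[R]_p) := B x *m r^T != 0 \/ 0 < dot (Q x *m r^T) r^T.
have [+ _] := compact_near_coveringP [set r : 'rV[R]_p | `|r| = 1].
move=> /(_ (sphere_compact (p := p)))/(_ I F P FF).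
have H : forall r, [set r : 'rV[R]_p | `|r| = 1] r ->
    \forall r' \near r & x \near F, P x r'.
  move=> r /= r1.
  have rT0 : r^T != 0.
    by rewrite trmx_eq0 -normr_eq0 r1 oner_eq0.
  pose FP := filter_prod (nbhs r) F.
  have FFP : Filter FP by exact: filter_prod_filter.
  have cr : (z.1)^T @[z --> FP] --> r^T.
    by apply: cvg_trmx; exact: cvg_fst.
  have cB : B z.2 @[z --> FP] --> B0 by apply: cvg_comp BB; exact: cvg_snd.
  have cQ : Q z.2 @[z --> FP] --> Q0 by apply: cvg_comp QQ; exact: cvg_snd.
  suff G : FP [set z | P z.2 z.1] by exact: G.
  have [B0r|B0r] := eqVneq (B0 *m r^T) 0.
    have c := @cvgr_gt _ _ _ FFP _ _
      (cvg_dot (FF := FFP) (cvg_mulmx (FF := FFP) cQ cr) cr) _ (pos _ B0r rT0).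
    by apply: (@filterS _ _ FFP _ _ _ c) => -[r' x] /=; right.
  have c := @cvgr_neq0 _ _ _ _ FFP _ _ (cvg_mulmx (FF := FFP) cB cr) B0r.
  by apply: (@filterS _ _ FFP _ _ _ c) => -[r' x] /=; left.
move=> /(_ H); apply: filterS => x Px d Bd d0.
have nd0 : 0 < `|d| by rewrite normr_gt0.
have := Px (`|d|^-1 *: d^T); rewrite /= /P linearZ /= trmxK -!scalemxAr Bd scaler0 eqxx.
have nT : `|d^T| = `|d|.
  apply/eqP; rewrite eq_le; apply/andP; split; apply: norm_mx_le => // i j.
    by rewrite mxE; exact: norm_entry_le.
  by have := norm_entry_le d^T j i; rewrite mxE.
rewrite normrZ nT gtr0_norm ?invr_gt0// mulVf ?gt_eqF// => /(_ erefl)[//|].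
rewrite dotZl dotC dotZl dotC.
by rewrite !pmulr_rgt0 ?invr_gt0.
Qed.

End KernelPositivity.
Lemma cvg_oppmx {R : realType} {I : Type} {F : set_system I} {FF : Filter F} p q
    (X : I -> 'M[R]_(p, q)) (M : 'M[R]_(p, q)) :
  X @ F --> M -> - X x @[x --> F] --> - M.
Proof. by move=> XM; exact: cvgN. Qed.

Lemma cvg_rows_in {R : realType} {I : Type} {F : set_system I} {FF : Filter F}
    p q (A : {set 'I_q}) (X : I -> 'M[R]_(q, p)) (M : 'M[R]_(q, p)) :
  X @ F --> M -> rows_in A (X x) @[x --> F] --> rows_in A M.
Proof. by move=> XM; exact: cvg_mxsub. Qed.

(** * Nonsingularity of K and the linearised KKT system *)

Section RegularMatrices.
Context {R : realType} {n m m1 m2 n1 n2 : nat}.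

(** [Kmx] with the active set as a parameter: the size of [Kmx] depends on the point through
    [lower_active], whereas limits along the path require a fixed size. *)
Definition Kblock (al : {set 'I_m2}) (Wyy : 'M[R]_m) (Jyh : 'M[R]_(m1, m))
    (Jyg : 'M[R]_(m2, m)) : 'M[R]_(m + (m1 + #|al|)) :=
  block_mx Wyy (row_mx Jyh^T (- (rows_in al Jyg)^T))
           (col_mx Jyh (- rows_in al Jyg)) 0.

Definition Nblock (al : {set 'I_m2}) (Wyx : 'M[R]_(m, n)) (Jxh : 'M[R]_(m1, n))
    (Jxg : 'M[R]_(m2, n)) : 'M[R]_(m + (m1 + #|al|), n) :=
  col_mx Wyx (col_mx Jxh (- rows_in al Jxg)).

(* Constraint qualifications and second-order conditions of both levels for
   given active sets [Iu], [al]; [Wxx], [Wyx], [Wyy] are the blocks of the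
   Hessian of the full Lagrangian. *)
Definition regular (Iu : {set 'I_n2}) (al : {set 'I_m2})
    (JH : 'M[R]_(n1, n)) (JG : 'M[R]_(n2, n))
    (Jxh : 'M[R]_(m1, n)) (Jyh : 'M[R]_(m1, m))
    (Jxg : 'M[R]_(m2, n)) (Jyg : 'M[R]_(m2, m))
    (Wxx : 'M[R]_n) (Wyx : 'M[R]_(m, n)) (Wyy : 'M[R]_m) : Prop :=
  [/\ row_free (col_mx JH (rows_in Iu JG)),
      row_free (col_mx Jyh (rows_in al Jyg)),
      forall d, col_mx Jyh (rows_in al Jyg) *m d = 0 -> d != 0 ->
        dot (Wyy *m d) d < 0
    & forall d, col_mx JH (rows_in Iu JG) *m d = 0 -> d != 0 ->
        0 < dot ((Wxx - (Nblock al Wyx Jxh Jxg)^T *m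
                  invmx (Kblock al Wyy Jyh Jyg) *m Nblock al Wyx Jxh Jxg) *m d) d].

Lemma col_mx_eq0P p q r (M : 'M[R]_(p, r)) (N : 'M[R]_(q, r)) :
  col_mx M N = 0 -> M = 0 /\ N = 0.
Proof. by move/eqP; rewrite col_mx_eq0 => /andP[/eqP-> /eqP->]. Qed.

(** For a kernel vector, pairing the first block row with [dy] removes the constraint terms, so the
    form vanishes at [dy] and negativity gives [dy = 0]. What is left is a relation between
    independent rows with coefficients [dmu] and [- dlam]. *)
Lemma Kblock_unit (al : {set 'I_m2}) (Wyy : 'M[R]_m) (Jyh : 'M[R]_(m1, m))
    (Jyg : 'M[R]_(m2, m)) :
  row_free (col_mx Jyh (rows_in al Jyg)) ->
  (forall d, col_mx Jyh (rows_in al Jyg) *m d = 0 -> d != 0 ->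
    dot (Wyy *m d) d < 0) ->
  Kblock al Wyy Jyh Jyg \in unitmx.
Proof.
move=> free neg; apply: unitmx_inj => w.
rewrite -[w]vsubmxK -[dsubmx w]vsubmxK.
move: (usubmx w) (usubmx (dsubmx w)) (dsubmx (dsubmx w)) => dy dmu dlam.
rewrite /Kblock mul_block_col mul_row_col mul0mx addr0 mul_col_mx.
move=> /col_mx_eq0P[E1 /col_mx_eq0P[E2 E3]].
have E3' : rows_in al Jyg *m dy = 0.
  by move: E3; rewrite mulNmx => /eqP; rewrite oppr_eq0 => /eqP.
have dy0 : dy = 0.
  apply/eqP; apply: contraT => dyn0.
  have := neg dy; rewrite mul_col_mx E2 E3' col_mx0 => /(_ erefl dyn0).
  have : dot (Wyy *m dy + (Jyh^T *m dmu + - (rows_in al Jyg)^T *m dlam)) dy = 0.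
    by rewrite E1 dot0l.
  rewrite mulNmx !dotDl dotNl !dot_trmul E2 E3' !dot0r oppr0 !addr0 => ->.
  by rewrite ltxx.
move: E1; rewrite dy0 mulmx0 add0r => E1.
have E4 : (col_mx Jyh (rows_in al Jyg))^T *m col_mx dmu (- dlam) = 0.
  by rewrite tr_col_mx mul_row_col mulmxN -mulNmx.
have /col_mx_eq0P[-> dl0] := row_free_trmul free E4.
by rewrite -[dlam]opprK dl0 oppr0 !col_mx0.
Qed.

(** The equations on the increments are the linearised KKT system of both levels with frozen active
    sets. The term subtracted from [Wxx] in [regular] is the Schur complement correction produced by
    eliminating the lower-level unknowns. *)
Lemma regular_kernel Iu al JH JG Jxh Jyh Jxg Jyg Wxx Wyx Wyy
    (dx : 'cV[R]_n) (dy : 'cV[R]_m) (du : 'cV[R]_n1) (dv : 'cV[R]_n2)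
    (dmu : 'cV[R]_m1) (dlam : 'cV[R]_m2) :
  regular Iu al JH JG Jxh Jyh Jxg Jyg Wxx Wyx Wyy ->
  Wxx *m dx + Wyx^T *m dy + JH^T *m du + JG^T *m dv + Jxh^T *m dmu
    - Jxg^T *m dlam = 0 ->
  Wyx *m dx + Wyy *m dy + Jyh^T *m dmu - Jyg^T *m dlam = 0 ->
  JH *m dx = 0 -> (forall i, i \in Iu -> (JG *m dx) i 0 = 0) ->
  (forall i, i \notin Iu -> dv i 0 = 0) ->
  Jxh *m dx + Jyh *m dy = 0 ->
  (forall i, i \in al -> (Jxg *m dx + Jyg *m dy) i 0 = 0) ->
  (forall i, i \notin al -> dlam i 0 = 0) ->
  [/\ dx = 0, dy = 0, du = 0 & dv = 0] /\ dmu = 0 /\ dlam = 0.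
Proof.
move=> [free1 free2 neg pos] Ex Ey EH /rows_in_eq0 EG dv0 Eh /rows_in_eq0 Eg dl0.
have uK := Kblock_unit free2 neg.
set K := Kblock al Wyy Jyh Jyg in pos uK *.
set Nn := Nblock al Wyx Jxh Jxg in pos *.
rewrite (trmx_rows_in _ dv0) in Ex; rewrite !(trmx_rows_in _ dl0) in Ex Ey.
set la := rows_in al dlam in Ex Ey *; set va := rows_in Iu dv in Ex *.
(* The lower-level unknowns, with only the active part [la] of [dlam]. *)
pose w := col_mx dy (col_mx dmu la).
have Kw : K *m w = - (Nn *m dx).
  rewrite /K /w /Kblock mul_block_col mul_row_col mul0mx addr0 mul_col_mx.
  rewrite /Nn /Nblock !mul_col_mx !opp_col_mx; congr col_mx.
    apply/eqP; rewrite -subr_eq0 opprK; apply/eqP.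
    by rewrite -[RHS]Ey mulNmx addrC !addrA.
  congr col_mx.
    by apply/eqP; rewrite -addr_eq0 addrC; apply/eqP.
  rewrite !mulNmx opprK !rows_in_mul; apply/eqP.
  rewrite eq_sym -addr_eq0; apply/eqP.
  by rewrite -[RHS]Eg; apply/matrixP => i j; rewrite !mxE.
have wE : w = - (invmx K *m (Nn *m dx)).
  by rewrite -mulmxN -Kw mulKmx.
have Nw : Nn^T *m w = Wyx^T *m dy + Jxh^T *m dmu - (rows_in al Jxg)^T *m la.
  rewrite /Nn /Nblock /w !tr_col_mx !mul_row_col linearN /= mulNmx.
  by rewrite addrA.
have Ex' : Wxx *m dx + Nn^T *m w + JH^T *m du + (rows_in Iu JG)^T *m va = 0.
  rewrite Nw -[RHS]Ex; apply/matrixP => i j.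
  rewrite !mxE; ring.
have dx0 : dx = 0.
  apply/eqP; apply: contraT => dxn0.
  have := pos dx; rewrite mul_col_mx EH rows_in_mul EG col_mx0 => /(_ erefl dxn0).
  (* Pairing with [dx] kills the terms in [du] and [va], since [dx] is in the kernel of the active
     Jacobian. After substituting [wE], the rest is the form that [pos] makes positive. *)
  have : dot (Wxx *m dx + Nn^T *m w + JH^T *m du + (rows_in Iu JG)^T *m va) dx = 0.
    by rewrite Ex' dot0l.
  rewrite 3!dotDl !(dot_trmul _ _ dx) EH rows_in_mul EG !dot0r !addr0.
  rewrite mulmxBl dotDl dotNl -!mulmxA dot_trmul wE.
  by rewrite dotNl => ->; rewrite ltxx.
have w0 : w = 0 by rewrite wE dx0 !mulmx0 oppr0.
have /col_mx_eq0P[dy0 /col_mx_eq0P[dmu0 la0]] := w0.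
have dlam0 : dlam = 0.
  apply/matrixP => i j; rewrite (ord1 j) [RHS]mxE.
  have [ial|] := boolP (i \in al); last exact: dl0.
  by move/rows_in_eq0: la0; exact.
move: Ex'; rewrite dx0 w0 !mulmx0 !add0r => Ev.
have E4 : (col_mx JH (rows_in Iu JG))^T *m col_mx du va = 0.
  by rewrite tr_col_mx mul_row_col.
have /col_mx_eq0P[du0 va0] := row_free_trmul free1 E4.
split => //; split => //.
apply/matrixP => i j; rewrite (ord1 j) [RHS]mxE.
have [iI|] := boolP (i \in Iu); last exact: dv0.
by move/rows_in_eq0: va0; exact.
Qed.

End RegularMatrices.

Section RegularOpen.
Context {R : realType} {n m m1 m2 n1 n2 : nat}.
Context {I : Type} {F : set_system I} {FF : Filter F}.
Variables (Iu : {set 'I_n2}) (al : {set 'I_m2}).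
Variables (JH : I -> 'M[R]_(n1, n)) (JG : I -> 'M[R]_(n2, n))
  (Jxh : I -> 'M[R]_(m1, n)) (Jyh : I -> 'M[R]_(m1, m))
  (Jxg : I -> 'M[R]_(m2, n)) (Jyg : I -> 'M[R]_(m2, m))
  (Wxx : I -> 'M[R]_n) (Wyx : I -> 'M[R]_(m, n)) (Wyy : I -> 'M[R]_m).
Variables (JH0 : 'M[R]_(n1, n)) (JG0 : 'M[R]_(n2, n))
  (Jxh0 : 'M[R]_(m1, n)) (Jyh0 : 'M[R]_(m1, m))
  (Jxg0 : 'M[R]_(m2, n)) (Jyg0 : 'M[R]_(m2, m))
  (Wxx0 : 'M[R]_n) (Wyx0 : 'M[R]_(m, n)) (Wyy0 : 'M[R]_m).

Lemma regular_near :
  JH @ F --> JH0 -> JG @ F --> JG0 -> Jxh @ F --> Jxh0 -> Jyh @ F --> Jyh0 ->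
  Jxg @ F --> Jxg0 -> Jyg @ F --> Jyg0 ->
  Wxx @ F --> Wxx0 -> Wyx @ F --> Wyx0 -> Wyy @ F --> Wyy0 ->
  regular Iu al JH0 JG0 Jxh0 Jyh0 Jxg0 Jyg0 Wxx0 Wyx0 Wyy0 ->
  \forall t \near F, regular Iu al (JH t) (JG t) (Jxh t) (Jyh t) (Jxg t) (Jyg t)
    (Wxx t) (Wyx t) (Wyy t).
Proof.
move=> cJH cJG cJxh cJyh cJxg cJyg cWxx cWyx cWyy [free1 free2 neg pos].
have uK := Kblock_unit free2 neg.
have cB1 : col_mx (JH t) (rows_in Iu (JG t)) @[t --> F] -->
    col_mx JH0 (rows_in Iu JG0) by exact: cvg_col_mx cJH (cvg_rows_in cJG).
have cB2 : col_mx (Jyh t) (rows_in al (Jyg t)) @[t --> F] -->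
    col_mx Jyh0 (rows_in al Jyg0) by exact: cvg_col_mx cJyh (cvg_rows_in cJyg).
have cJgx : rows_in al (Jxg t) @[t --> F] --> rows_in al Jxg0.
  exact: cvg_rows_in.
have cJgy : rows_in al (Jyg t) @[t --> F] --> rows_in al Jyg0.
  exact: cvg_rows_in.
have cN : Nblock al (Wyx t) (Jxh t) (Jxg t) @[t --> F] --> Nblock al Wyx0 Jxh0 Jxg0.
  exact: cvg_col_mx cWyx (cvg_col_mx cJxh (cvg_oppmx cJgx)).
have cK : Kblock al (Wyy t) (Jyh t) (Jyg t) @[t --> F] --> Kblock al Wyy0 Jyh0 Jyg0.
  rewrite /Kblock /block_mx; apply: cvg_col_mx; apply: cvg_row_mx => //.
  - exact: cvg_row_mx (cvg_trmx cJyh) (cvg_oppmx (cvg_trmx cJgy)).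
  - exact: cvg_col_mx cJyh (cvg_oppmx cJgy).
  - exact: cvg_cst.
have cQ : Wxx t - (Nblock al (Wyx t) (Jxh t) (Jxg t))^T *m
    invmx (Kblock al (Wyy t) (Jyh t) (Jyg t)) *m
    Nblock al (Wyx t) (Jxh t) (Jxg t) @[t --> F] -->
    Wxx0 - (Nblock al Wyx0 Jxh0 Jxg0)^T *m invmx (Kblock al Wyy0 Jyh0 Jyg0) *m
    Nblock al Wyx0 Jxh0 Jxg0.
  apply: cvgB => //.
  exact: cvg_mulmx (cvg_mulmx (cvg_trmx cN) (cvg_invmx uK cK)) cN.
(* [near_pos_on_kernel] deals with positive forms, so the lower level is handled through the
   opposite of [Wyy0]. *)
have neg' d : col_mx Jyh0 (rows_in al Jyg0) *m d = 0 -> d != 0 -> 0 < dot (- Wyy0 *m d) d.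
  by move=> H1 H2; rewrite mulNmx dotNl oppr_gt0; exact: neg.
have cWyyN : - Wyy t @[t --> F] --> - Wyy0 by exact: cvg_oppmx.
near=> t; split.
- by near: t; exact: near_row_free cB1 free1.
- by near: t; exact: near_row_free cB2 free2.
- move=> d H1 H2; rewrite -oppr_gt0 -dotNl -mulNmx.
  by move: d H1 H2; near: t; exact: near_pos_on_kernel cWyyN cB2 neg'.
- by near: t; exact: near_pos_on_kernel cQ cB1 pos.
Unshelve. all: by end_near. Qed.

End RegularOpen.
(** * Matrix form of the Jacobian uniqueness condition *)

Section StrictComplementarity.
Context {R : realType}.

(** Each index carries one equation and one strict inequality: along the path the equations come
    from the KKT system, the inequalities from continuity. *)
Definition strict_compl p (a b : 'cV[R]_p) : Prop :=
  forall i, (b i 0 = 0 /\ 0 < a i 0) \/ (b i 0 < 0 /\ a i 0 = 0).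

Lemma complementary_off p (a b : 'cV[R]_p) i :
  complementary a b -> b i 0 != 0 -> a i 0 = 0.
Proof.
move=> [a0 b0 ab] bi.
have ab0 j : 0 <= - (a j 0 * b j 0).
  by rewrite oppr_ge0 mulr_ge0_le0.
have /psumr_eq0P H : \sum_j - (a j 0 * b j 0) = 0 by rewrite sumrN -/(dot a b) ab oppr0.
have /eqP := H (fun j _ => ab0 j) i isT.
by rewrite oppr_eq0 mulf_eq0 (negbTE bi) orbF => /eqP.
Qed.

Lemma strict_complP p (a b : 'cV[R]_p) :
  complementary a b -> (forall i, b i 0 = 0 -> 0 < a i 0) -> strict_compl a b.
Proof.
move=> ab pos i; have [bi|bi] := eqVneq (b i 0) 0; [left|right].
  by split => //; exact: pos.
split; last exact: complementary_off ab bi.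
by have [_ b0 _] := ab; rewrite lt_neqAle bi b0.
Qed.

Lemma strict_compl_complementary p (a b : 'cV[R]_p) :
  strict_compl a b -> complementary a b.
Proof.
move=> ab; split=> [i|i|].
- by case: (ab i) => -[_]; [exact: ltW|move->].
- by case: (ab i) => -[]; [move->|move/ltW].
- by apply: big1 => i _; case: (ab i) => -[E1 E2]; rewrite ?E1 ?E2 ?mulr0 ?mul0r.
Qed.

(** Every product of entries of [a] and [M *m d] is nonpositive while their sum is nonnegative, so
    each is zero, and [a] is positive on the active indices. At both levels stationarity converts
    the inequality on a gradient in the critical cone into the last hypothesis. *)
Lemma critical_kernel p q (a b : 'cV[R]_q) (M : 'M[R]_(q, p)) (d : 'cV[R]_p) :
  strict_compl a b ->
  (forall i, b i 0 = 0 -> (M *m d) i 0 <= 0) -> 0 <= dot a (M *m d) ->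
  rows_in [set i | b i 0 == 0] M *m d = 0.
Proof.
move=> ab neg ge0; rewrite rows_in_mul; apply/rows_in_eq0 => i; rewrite inE => /eqP bi.
have t0 j : 0 <= - (a j 0 * (M *m d) j 0).
  case: (ab j) => -[bj aj]; last by rewrite aj mul0r oppr0.
  by rewrite oppr_ge0 mulr_ge0_le0 ?(ltW aj)// neg.
have S0 : \sum_j - (a j 0 * (M *m d) j 0) = 0.
  apply/eqP; rewrite eq_le sumr_ge0 ?andbT//.
  by rewrite sumrN oppr_le0.
have /eqP := psumr_eq0P (fun j _ => t0 j) S0 (i := i) isT.
rewrite oppr_eq0 mulf_eq0 => /orP[/eqP ai|/eqP//].
by case: (ab i) => -[]; rewrite ?bi ?ai ltxx.
Qed.

Lemma dot_grad_jac p q (G : 'cV[R]_p -> 'cV[R]_q) a i d :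
  dot (grad (fun z => G z i 0) a) d = (jac G a *m d) i 0.
Proof. by rewrite mxE; apply: eq_bigr => j _; rewrite !mxE. Qed.

End StrictComplementarity.

Section JacobianUniqueness.
Context {R : realType} {n m m1 m2 n1 n2 : nat}.
Variable P : minimax R n m m1 m2 n1 n2.
Variables (x : 'cV[R]_n) (u : 'cV[R]_n1) (v : 'cV[R]_n2) (y : 'cV[R]_m)
  (mu : 'cV[R]_m1) (lam : 'cV[R]_m2).

Definition strict_KKT : Prop :=
  [/\ gradxL P x y mu lam + (jac (mm_H P) x)^T *m u + (jac (mm_G P) x)^T *m v = 0,
      gradyL P x y mu lam = 0, mm_H P x = 0, mm_h P x y = 0 &
      strict_compl v (mm_G P x) /\ strict_compl lam (mm_g P x y)].

Definition regular_at (Iu : {set 'I_n2}) (al : {set 'I_m2}) : Prop :=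
  regular Iu al (jac (mm_H P) x) (jac (mm_G P) x) (Jxh P x y) (Jyh P x y)
    (jac (fun x' => mm_g P x' y) x) (jac (mm_g P x) y)
    (hessxxL P x y mu lam + upper_constraint_hess P x u v)
    (hessyxL P x y mu lam) (hessyyL P x y mu lam).

Hypothesis gradyLE : gradyL P x y mu lam =
  grad (mm_f P x) y + (Jyh P x y)^T *m mu - (jac (mm_g P x) y)^T *m lam.

Let quadE (d : 'cV[R]_n) (U W S : 'M[R]_n) :
  dot ((W + U - S) *m d) d = dot (U *m d) d + dot ((W - S) *m d) d.
Proof. by rewrite -dotDl -mulmxDl addrA [U + W]addrC. Qed.

(** Complementarity confines [v] and [v'] to the active indices, so the difference of the two
    stationarity equations is a relation between linearly independent rows. *)
Lemma multipliers_unique u' v' :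
  strict_KKT ->
  row_free (col_mx (jac (mm_H P) x) (rows_in (upper_active P x) (jac (mm_G P) x))) ->
  upper_KKT P x u' v' y mu lam -> u' = u /\ v' = v.
Proof.
move=> [Ex _ H0 _ [sv _]] free [Ex' _ cv'].
have off i : i \notin upper_active P x -> (v' - v) i 0 = 0.
  rewrite inE => Gi; rewrite !mxE (complementary_off cv' Gi).
  by rewrite (complementary_off (strict_compl_complementary sv) Gi) subrr.
have E : (col_mx (jac (mm_H P) x) (rows_in (upper_active P x) (jac (mm_G P) x)))^T
    *m col_mx (u' - u) (rows_in (upper_active P x) (v' - v)) = 0.
  rewrite tr_col_mx mul_row_col -trmx_rows_in// !mulmxBr.
  move: Ex Ex'; move: (gradxL _ _ _ _ _) (_ *m u) (_ *m v) (_ *m u') (_ *m v').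
  move=> g0 a b a' b' Ex Ex'; rewrite -[RHS](subrr 0) -{1}Ex' -Ex.
  by apply/matrixP => i j; rewrite !mxE; ring.
have /col_mx_eq0P[E1 /rows_in_eq0 E2] := row_free_trmul free E.
split; first by apply/eqP; rewrite -subr_eq0 E1.
apply/eqP; rewrite -subr_eq0; apply/eqP/matrixP => i j; rewrite (ord1 j) [RHS]mxE.
by have [/E2//|/off] := boolP (i \in upper_active P x).
Qed.

(** Strict complementarity collapses both critical cones to kernels. The lower cone involves the
    gradient of [f], not of the Lagrangian, and [gradyLE] relates the two; the upper cone involves
    [gradxL], which stationarity contains directly. *)
Lemma jacobian_uniquenessP : jacobian_uniqueness P x u v y mu lam <->
  strict_KKT /\ regular_at (upper_active P x) (lower_active P x y).
Proof.
have lower_cone d : gradyL P x y mu lam = 0 -> strict_compl lam (mm_g P x y) ->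
    lower_critical_cone P x y d <->
    col_mx (Jyh P x y) (rows_in (lower_active P x y) (jac (mm_g P x) y)) *m d = 0.
  move=> Ey sl.
  have fE : Jyh P x y *m d = 0 ->
      dot (grad (mm_f P x) y) d = dot lam (jac (mm_g P x) y *m d).
    move=> hd; have := congr1 (fun z => dot z d) Ey; rewrite gradyLE !dotDl dotNl !dot_trmul hd.
    by rewrite dot0r dot0l addr0 => /eqP; rewrite subr_eq0 => /eqP.
  rewrite mul_col_mx; split=> [[hd gd fd]|/col_mx_eq0P[hd gd]].
    rewrite hd (critical_kernel sl) ?col_mx0//.
      by move=> i gi; rewrite -dot_grad_jac; apply: gd; rewrite inE gi.
    by rewrite -fE.
  move: gd; rewrite rows_in_mul => /rows_in_eq0 gd; split=> // [i ia|].
    by rewrite dot_grad_jac gd.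
  rewrite fE// /dot big1// => i _; case: (sl i) => -[gi li]; last by rewrite li mul0r.
  by rewrite gd ?mulr0// inE gi.
have upper_cone d : strict_KKT -> upper_critical_cone P x y mu lam d <->
    col_mx (jac (mm_H P) x) (rows_in (upper_active P x) (jac (mm_G P) x)) *m d = 0.
  move=> [Ex _ _ _ [sv _]].
  have LE : jac (mm_H P) x *m d = 0 ->
      dot (gradxL P x y mu lam) d = - dot v (jac (mm_G P) x *m d).
    move=> hd; have := congr1 (fun z => dot z d) Ex; rewrite !dotDl !dot_trmul hd.
    by rewrite dot0r dot0l addr0 => /eqP; rewrite addr_eq0 => /eqP.
  rewrite mul_col_mx; split=> [[hd gd fd]|/col_mx_eq0P[hd gd]].
    rewrite hd (critical_kernel sv) ?col_mx0//.
      by move=> i gi; rewrite -dot_grad_jac; apply: gd; rewrite inE gi.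
    by rewrite -oppr_le0 -LE.
  move: gd; rewrite rows_in_mul => /rows_in_eq0 gd; split=> // [i ia|].
    by rewrite dot_grad_jac gd.
  rewrite LE// /dot big1 ?oppr0// => i _; case: (sv i) => -[gi li]; last by rewrite li mul0r.
  by rewrite gd ?mulr0// inE gi.
split.
- move=> [[_ [Ex EH cv]] free1 pos1 [_ [[Ey Eh cl] free2 pos2 neg]] so].
  have sv : strict_compl v (mm_G P x).
    apply: strict_complP => // i gi; have := pos1 i; rewrite inE gi eqxx subr0.
    exact.
  have sl : strict_compl lam (mm_g P x y).
    by apply: strict_complP => // i gi; have := pos2 i; rewrite gi subr0.
  have K : strict_KKT by [].
  split=> //; split=> // [d dk d0|d dk d0].
    by apply: neg => //; apply/lower_cone.
  have := so d ((upper_cone d K).2 dk) d0; rewrite quadE.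
  (* By [multipliers_unique] the supremum runs over a single value. *)
  rewrite (_ : [set _ | _ in _] = [set (dot (upper_constraint_hess P x u v *m d) d)%:E]).
    by rewrite ereal_sup1 -EFinD lte_fin.
  apply/seteqP; split=> [_ /= [[u' v'] uv' <-]|_ /= ->].
    by have [/= -> ->] := multipliers_unique K free1 uv'.
  by exists (u, v).
- move=> [K [free1 free2 neg pos]]; have [Ex Ey EH Eh [sv sl]] := K.
  have cv := strict_compl_complementary sv.
  have cl := strict_compl_complementary sl.
  have gap p (a b : 'cV[R]_p) : strict_compl a b -> forall i, 0 < a i 0 - b i 0.
    move=> ab i; case: (ab i) => -[bi ai]; first by rewrite bi subr0.
    by rewrite ai sub0r oppr_gt0.
  split=> //.
  + by split=> //; split=> //; have [] := cv.
  + by move=> i _; exact: gap.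
  + split; first by split=> //; have [] := cl.
    split=> //; first exact: gap.
    by move=> d /(lower_cone d Ey sl); exact: neg.
  + move=> d /(upper_cone d K) dk d0.
    (* In this direction a lower bound of the supremum is enough, and [(u, v)] provides it. *)
    have := pos d dk d0; rewrite quadE -lte_fin EFinD => /lt_le_trans; apply.
    apply: leeD => //; apply: ereal_sup_ubound.
    by exists (u, v).
Qed.

End JacobianUniqueness.
(** * The Lagrangian of both levels *)

Section DerivableAlong.
Context {R : realType}.
Implicit Types U V W : normedModType R.

Lemma derivable_affine U V W (f : V -> W) (phi : U -> V) a d d' :
  (forall h : R, phi (h *: d + a) = h *: d' + phi a) ->
  derivable f (phi a) d' -> derivable (fun x => f (phi x)) a d.
Proof.
move=> phiE; rewrite /derivable.
suff -> : (fun h : R => h^-1 *: (((fun x => f (phi x)) \o shift a) (h *: d) - f (phi a)))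
  = (fun h : R => h^-1 *: ((f \o shift (phi a)) (h *: d') - f (phi a))) by [].
by apply/funext => h; rewrite /= phiE.
Qed.

Lemma is_derive_lincomb V q (c : 'I_q -> R) (f : 'I_q -> V -> R) a d :
  (forall k, derivable (f k) a d) ->
  is_derive a d (fun z => \sum_k c k * f k z) (\sum_k c k * 'D_d (f k) a).
Proof.
move=> df.
have -> : (fun z => \sum_k c k * f k z) = \sum_k (c k \*: f k).
  by apply/funext => z; rewrite fct_sumE.
by apply: is_derive_sum => k; apply: is_deriveZ; exact: derivableP.
Qed.

Lemma linear_cV_continuous p q (g : {linear 'cV[R]_p -> 'cV[R]_q}) : continuous g.
Proof.
move=> d; have -> : (g : 'cV[R]_p -> 'cV[R]_q) =
    mulmx (\matrix_(i, j) g (delta_mx j 0) i 0).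
  by apply/funext => e; exact: linear_cV_mulmx.
apply: (@cvg_mulmx _ _ (nbhs d) (nbhs_filter d) _ _ _ (fun=> _) id).
  exact: cvg_cst.
exact: cvg_id.
Qed.

Lemma dot_delta p (k : 'I_p) (b : 'cV[R]_p) : dot (delta_mx k 0) b = b k 0.
Proof.
rewrite /dot (bigD1 k)//= big1 => [|i ik].
  by rewrite mxE !eqxx mul1r addr0.
by rewrite mxE (negbTE ik) mul0r.
Qed.

End DerivableAlong.

(** * Coordinates on the space of all unknowns *)

Section Embedding.
Context {R : realType} {n m m1 m2 n1 n2 : nat}.

(** All unknowns are stacked in one column, so that the Hessian and the implicit function theorem
    concern a single space. *)
Definition edim := (n + (m + (n1 + (n2 + (m1 + m2)))))%N.

Definition emb (x : 'cV[R]_n) (y : 'cV[R]_m) (u : 'cV[R]_n1) (v : 'cV[R]_n2)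
    (mu : 'cV[R]_m1) (lam : 'cV[R]_m2) : 'cV[R]_edim :=
  col_mx x (col_mx y (col_mx u (col_mx v (col_mx mu lam)))).

Definition px (e : 'cV[R]_edim) : 'cV[R]_n := usubmx e.
Definition py (e : 'cV[R]_edim) : 'cV[R]_m := usubmx (dsubmx e).
Definition pu (e : 'cV[R]_edim) : 'cV[R]_n1 := usubmx (dsubmx (dsubmx e)).
Definition pv (e : 'cV[R]_edim) : 'cV[R]_n2 := usubmx (dsubmx (dsubmx (dsubmx e))).
Definition pmu (e : 'cV[R]_edim) : 'cV[R]_m1 :=
  usubmx (dsubmx (dsubmx (dsubmx (dsubmx e)))).
Definition plam (e : 'cV[R]_edim) : 'cV[R]_m2 :=
  dsubmx (dsubmx (dsubmx (dsubmx (dsubmx e)))).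

Definition ix (i : 'I_n) : 'I_edim := lshift _ i.
Definition iy (i : 'I_m) : 'I_edim := rshift n (lshift _ i).
Definition iu (i : 'I_n1) : 'I_edim := rshift n (rshift m (lshift _ i)).
Definition iv (i : 'I_n2) : 'I_edim := rshift n (rshift m (rshift n1 (lshift _ i))).
Definition imu (i : 'I_m1) : 'I_edim :=
  rshift n (rshift m (rshift n1 (rshift n2 (lshift _ i)))).
Definition ilam (i : 'I_m2) : 'I_edim :=
  rshift n (rshift m (rshift n1 (rshift n2 (rshift m1 i)))).

Lemma embK (e : 'cV[R]_edim) :
  emb (px e) (py e) (pu e) (pv e) (pmu e) (plam e) = e.
Proof. by rewrite /emb !vsubmxK. Qed.

Lemma px_emb x y u v mu lam : px (emb x y u v mu lam) = x.
Proof. by rewrite /px /emb col_mxKu. Qed.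
Lemma py_emb x y u v mu lam : py (emb x y u v mu lam) = y.
Proof. by rewrite /py /emb col_mxKd col_mxKu. Qed.
Lemma pu_emb x y u v mu lam : pu (emb x y u v mu lam) = u.
Proof. by rewrite /pu /emb !col_mxKd col_mxKu. Qed.
Lemma pv_emb x y u v mu lam : pv (emb x y u v mu lam) = v.
Proof. by rewrite /pv /emb !col_mxKd col_mxKu. Qed.
Lemma pmu_emb x y u v mu lam : pmu (emb x y u v mu lam) = mu.
Proof. by rewrite /pmu /emb !col_mxKd col_mxKu. Qed.
Lemma plam_emb x y u v mu lam : plam (emb x y u v mu lam) = lam.
Proof. by rewrite /plam /emb !col_mxKd. Qed.
Definition p_emb := (px_emb, py_emb, pu_emb, pv_emb, pmu_emb, plam_emb).

Lemma delta_lshift p q (i : 'I_p) :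
  delta_mx (lshift q i) 0 = col_mx (delta_mx i 0) 0 :> 'cV[R]_(p + q).
Proof.
apply/matrixP => k j; case: (split_ordP k) => k' ->; rewrite ?col_mxEu ?col_mxEd !mxE.
  by rewrite eq_lshift.
by rewrite eq_rlshift.
Qed.

Lemma delta_rshift p q (i : 'I_q) :
  delta_mx (rshift p i) 0 = col_mx 0 (delta_mx i 0) :> 'cV[R]_(p + q).
Proof.
apply/matrixP => k j; case: (split_ordP k) => k' ->; rewrite ?col_mxEu ?col_mxEd !mxE.
  by rewrite eq_lrshift.
by rewrite eq_rshift.
Qed.

Lemma delta_ix i : delta_mx (ix i) 0 = emb (delta_mx i 0) 0 0 0 0 0.
Proof. by rewrite /ix delta_lshift /emb ?col_mx0. Qed.
Lemma delta_iy i : delta_mx (iy i) 0 = emb 0 (delta_mx i 0) 0 0 0 0.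
Proof. by rewrite /iy delta_rshift delta_lshift /emb ?col_mx0. Qed.
Lemma delta_iu i : delta_mx (iu i) 0 = emb 0 0 (delta_mx i 0) 0 0 0.
Proof. by rewrite /iu !delta_rshift delta_lshift /emb ?col_mx0. Qed.
Lemma delta_iv i : delta_mx (iv i) 0 = emb 0 0 0 (delta_mx i 0) 0 0.
Proof. by rewrite /iv !delta_rshift delta_lshift /emb ?col_mx0. Qed.
Lemma delta_imu i : delta_mx (imu i) 0 = emb 0 0 0 0 (delta_mx i 0) 0.
Proof. by rewrite /imu !delta_rshift delta_lshift /emb ?col_mx0. Qed.
Lemma delta_ilam i : delta_mx (ilam i) 0 = emb 0 0 0 0 0 (delta_mx i 0).
Proof. by rewrite /ilam !delta_rshift /emb. Qed.

Lemma emb_line (T : normedModType R) (h : R) x y u v mu lam a b c d e f (t : T) :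
  h *: ((emb a b c d e f, 0) : 'cV[R]_edim * T) + (emb x y u v mu lam, t) =
  (emb (h *: a + x) (h *: b + y) (h *: c + u) (h *: d + v) (h *: e + mu) (h *: f + lam), t).
Proof.
congr pair; rewrite /= ?scaler0 ?add0r//.
by rewrite /emb !scale_col_mx !add_col_mx.
Qed.

Lemma emb0 x y u v mu lam : emb x y u v mu lam = 0 <->
  [/\ x = 0, y = 0, u = 0 & v = 0] /\ mu = 0 /\ lam = 0.
Proof.
split=> [|[[-> -> -> ->] [-> ->]]]; last by rewrite /emb !col_mx0.
by do 5 move=> /col_mx_eq0P[?]; move=> ?.
Qed.

Lemma sum_edim (f : 'I_edim -> R) : \sum_i f i =
  \sum_i f (ix i) + (\sum_i f (iy i) + (\sum_i f (iu i) + (\sum_i f (iv i) +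
  (\sum_i f (imu i) + \sum_i f (ilam i))))).
Proof. by rewrite 5!big_split_ord. Qed.

Lemma edim_case (Q : 'I_edim -> Prop) :
  (forall i, Q (ix i)) -> (forall i, Q (iy i)) -> (forall i, Q (iu i)) ->
  (forall i, Q (iv i)) -> (forall i, Q (imu i)) -> (forall i, Q (ilam i)) ->
  forall i, Q i.
Proof.
move=> Qx Qy Qu Qv Qm Ql i; case: (split_ordP i) => j ->; first exact: Qx.
case: (split_ordP j) => {}j ->; first exact: Qy.
case: (split_ordP j) => {}j ->; first exact: Qu.
case: (split_ordP j) => {}j ->; first exact: Qv.
by case: (split_ordP j) => {}j ->; [exact: Qm|exact: Ql].
Qed.

Lemma emb_entry x y u v mu lam :
  (forall i, emb x y u v mu lam (ix i) 0 = x i 0) /\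
  (forall i, emb x y u v mu lam (iy i) 0 = y i 0) /\
  (forall i, emb x y u v mu lam (iu i) 0 = u i 0) /\
  (forall i, emb x y u v mu lam (iv i) 0 = v i 0) /\
  (forall i, emb x y u v mu lam (imu i) 0 = mu i 0) /\
  (forall i, emb x y u v mu lam (ilam i) 0 = lam i 0).
Proof.
by do !split; move=> i; rewrite /emb ?col_mxEd ?col_mxEu.
Qed.

End Embedding.

(** * The function [Phi] and its derivatives computed along lines *)

Section FullLagrangian.
Context {R : realType} {n m m1 m2 n1 n2 l : nat}.
Variables (fb : 'cV[R]_n -> 'cV[R]_m -> 'cV[R]_l -> R)
  (hb : 'cV[R]_n -> 'cV[R]_m -> 'cV[R]_l -> 'cV[R]_m1)
  (gb : 'cV[R]_n -> 'cV[R]_m -> 'cV[R]_l -> 'cV[R]_m2)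
  (Hb : 'cV[R]_n -> 'cV[R]_l -> 'cV[R]_n1)
  (Gb : 'cV[R]_n -> 'cV[R]_l -> 'cV[R]_n2).
Local Notation N := (@edim n m m1 m2 n1 n2).
Local Notation E := ('cV[R]_N).
Local Notation P t := (perturbed fb hb gb Hb Gb t).
Local Notation dir k := ((delta_mx k 0, 0) : E * 'cV[R]_l).

(** The two halves of [Phi] are kept apart because [hessxxL] differentiates only the first and
    [upper_constraint_hess] only the second. *)
Definition PhiL (p : E * 'cV[R]_l) : R :=
  lagrangian (P p.2) (px p.1) (py p.1) (pmu p.1) (plam p.1).
Definition PhiU (p : E * 'cV[R]_l) : R :=
  dot (pu p.1) (Hb (px p.1) p.2) + dot (pv p.1) (Gb (px p.1) p.2).

Definition Phi (p : E * 'cV[R]_l) : R := PhiL p + PhiU p.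

Section Slices.
Variables (W : normedModType R) (g : E * 'cV[R]_l -> W).
Variables (x : 'cV[R]_n) (y : 'cV[R]_m) (u : 'cV[R]_n1) (v : 'cV[R]_n2)
  (mu : 'cV[R]_m1) (lam : 'cV[R]_m2) (t : 'cV[R]_l).

Lemma slice_x i : 'D_(dir (ix i)) g (emb x y u v mu lam, t) =
  'D_(delta_mx i 0) (fun x' => g (emb x' y u v mu lam, t)) x.
Proof.
apply/esym; apply: (@derive_affine R _ _ _ g (fun x' => (emb x' y u v mu lam, t))) => h.
by rewrite delta_ix emb_line !scaler0 !add0r.
Qed.

Lemma slice_y i : 'D_(dir (iy i)) g (emb x y u v mu lam, t) =
  'D_(delta_mx i 0) (fun y' => g (emb x y' u v mu lam, t)) y.
Proof.
apply/esym; apply: (@derive_affine R _ _ _ g (fun y' => (emb x y' u v mu lam, t))) => h.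
by rewrite delta_iy emb_line !scaler0 !add0r.
Qed.

Lemma derivable_slice_x i : derivable g (emb x y u v mu lam, t) (dir (ix i)) ->
  derivable (fun x' => g (emb x' y u v mu lam, t)) x (delta_mx i 0).
Proof.
move=> dg; apply: (@derivable_affine R _ _ _ g (fun x' => (emb x' y u v mu lam, t)) _ _ _ _ dg) => h.
by rewrite delta_ix emb_line !scaler0 !add0r.
Qed.

End Slices.

Lemma PhiL_emb x y u v mu lam t :
  PhiL (emb x y u v mu lam, t) = lagrangian (P t) x y mu lam.
Proof. by rewrite /PhiL /= !p_emb. Qed.

Lemma PhiU_emb x y u v mu lam t :
  PhiU (emb x y u v mu lam, t) = dot u (Hb x t) + dot v (Gb x t).
Proof. by rewrite /PhiU /= !p_emb. Qed.

Lemma Phi_emb x y u v mu lam t : Phi (emb x y u v mu lam, t) =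
  lagrangian (P t) x y mu lam + (dot u (Hb x t) + dot v (Gb x t)).
Proof. by rewrite /Phi PhiL_emb PhiU_emb. Qed.

(** [Phi] is affine in the multipliers, so the formula holds at every point; as an equality of
    functions it can be differentiated a second time. *)
Lemma derive_Phi_u k : 'D_(dir (iu k)) Phi = fun p => Hb (px p.1) p.2 k 0.
Proof.
apply/funext => -[e t] /=; rewrite -{1}(embK e).
move: (px e) (py e) (pu e) (pv e) (pmu e) (plam e) => x y u v mu lam.
apply: derive_affine_along => h.
rewrite delta_iu emb_line !scaler0 !add0r !Phi_emb dotDl dotZl dot_delta.
rewrite -[h *: _]/(h * _); ring.
Qed.

Lemma derive_Phi_v k : 'D_(dir (iv k)) Phi = fun p => Gb (px p.1) p.2 k 0.
Proof.
apply/funext => -[e t] /=; rewrite -{1}(embK e).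
move: (px e) (py e) (pu e) (pv e) (pmu e) (plam e) => x y u v mu lam.
apply: derive_affine_along => h.
rewrite delta_iv emb_line !scaler0 !add0r !Phi_emb dotDl dotZl dot_delta.
rewrite -[h *: _]/(h * _); ring.
Qed.

Lemma derive_Phi_mu k : 'D_(dir (imu k)) Phi = fun p => hb (px p.1) (py p.1) p.2 k 0.
Proof.
apply/funext => -[e t] /=; rewrite -{1}(embK e).
move: (px e) (py e) (pu e) (pv e) (pmu e) (plam e) => x y u v mu lam.
apply: derive_affine_along => h.
rewrite delta_imu emb_line !scaler0 !add0r !Phi_emb /lagrangian /=.
rewrite dotDl dotZl dot_delta -[h *: _]/(h * _); ring.
Qed.

Lemma derive_Phi_lam k :
  'D_(dir (ilam k)) Phi = fun p => - gb (px p.1) (py p.1) p.2 k 0.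
Proof.
apply/funext => -[e t] /=; rewrite -{1}(embK e).
move: (px e) (py e) (pu e) (pv e) (pmu e) (plam e) => x y u v mu lam.
apply: derive_affine_along => h.
rewrite delta_ilam emb_line !scaler0 !add0r !Phi_emb /lagrangian /=.
rewrite dotDl dotZl dot_delta -[h *: _]/(h * _); ring.
Qed.

Section Blocks.
Variables (x : 'cV[R]_n) (y : 'cV[R]_m) (u : 'cV[R]_n1) (v : 'cV[R]_n2)
  (mu : 'cV[R]_m1) (lam : 'cV[R]_m2) (t : 'cV[R]_l).
Local Notation p := (emb x y u v mu lam, t).
Local Notation D2 i j := ('D_(dir i) ('D_(dir j) Phi) p).

Lemma D2_xu i k : D2 (ix i) (iu k) = jac (mm_H (P t)) x k i.
Proof.
rewrite derive_Phi_u slice_x mxE /partial.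
apply: (congr1 (fun F => 'D_(delta_mx i 0) F x)).
by apply/funext => x'; rewrite /= p_emb.
Qed.

Lemma D2_xv i k : D2 (ix i) (iv k) = jac (mm_G (P t)) x k i.
Proof.
rewrite derive_Phi_v slice_x mxE /partial.
apply: (congr1 (fun F => 'D_(delta_mx i 0) F x)).
by apply/funext => x'; rewrite /= p_emb.
Qed.

Lemma D2_xmu i k : D2 (ix i) (imu k) = Jxh (P t) x y k i.
Proof.
rewrite derive_Phi_mu slice_x mxE /partial.
apply: (congr1 (fun F => 'D_(delta_mx i 0) F x)).
by apply/funext => x'; rewrite /= !p_emb.
Qed.

Lemma D2_ymu i k : D2 (iy i) (imu k) = Jyh (P t) x y k i.
Proof.
rewrite derive_Phi_mu slice_y mxE /partial.
apply: (congr1 (fun F => 'D_(delta_mx i 0) F y)).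
by apply/funext => x'; rewrite /= !p_emb.
Qed.

(** [PhiU] is constant in [y] and shifts the slice by a constant, which the inner derivative
    discards. *)
Lemma D2_yy i j : D2 (iy i) (iy j) = hessyyL (P t) x y mu lam i j.
Proof.
rewrite slice_y mxE /partial.
apply: (congr1 (fun F => 'D_(delta_mx i 0) F y)); apply/funext => y'.
rewrite slice_y; apply: (derive_eq_along (c := dot u (Hb x t) + dot v (Gb x t))) => h.
by rewrite Phi_emb.
Qed.

Lemma derive_Phi_y i : 'D_(dir (iy i)) Phi p = gradyL (P t) x y mu lam i 0.
Proof.
rewrite slice_y mxE /partial.
apply: (derive_eq_along (c := dot u (Hb x t) + dot v (Gb x t))) => h.
by rewrite Phi_emb.
Qed.

End Blocks.

End FullLagrangian.
Lemma open_setX (U V : topologicalType) (A : set U) (B : set V) :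
  open A -> open B -> open (A `*` B).
Proof.
move=> oA oB; apply: openI; apply: open_comp => // p _.
  exact: cvg_fst.
exact: cvg_snd.
Qed.

(** * Smoothness of [Phi] and the blocks that depend on it *)

Section SmoothLagrangian.
Context {R : realType} {n m m1 m2 n1 n2 l : nat}.
Variables (fb : 'cV[R]_n -> 'cV[R]_m -> 'cV[R]_l -> R)
  (hb : 'cV[R]_n -> 'cV[R]_m -> 'cV[R]_l -> 'cV[R]_m1)
  (gb : 'cV[R]_n -> 'cV[R]_m -> 'cV[R]_l -> 'cV[R]_m2)
  (Hb : 'cV[R]_n -> 'cV[R]_l -> 'cV[R]_n1)
  (Gb : 'cV[R]_n -> 'cV[R]_l -> 'cV[R]_n2).
Variables (O1 : set 'cV[R]_n) (O2 : set 'cV[R]_m) (Theta : set 'cV[R]_l).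
Local Notation N := (@edim n m m1 m2 n1 n2).
Local Notation E := ('cV[R]_N).
Local Notation P t := (perturbed fb hb gb Hb Gb t).
Local Notation dir k := ((delta_mx k 0, 0) : E * 'cV[R]_l).
Local Notation Phi := (Phi fb hb gb Hb Gb).
Local Notation PhiL := (PhiL fb hb gb Hb Gb).
Local Notation PhiU := (@PhiU R n m m1 m2 n1 n2 l Hb Gb).
Hypotheses (oO1 : open O1) (oO2 : open O2) (oTh : open Theta).
Hypotheses
  (fC : Ck_on 2 (O1 `*` O2 `*` Theta) (fun p => fb p.1.1 p.1.2 p.2))
  (hC : Ck_on 2 (O1 `*` O2 `*` Theta) (fun p => hb p.1.1 p.1.2 p.2))
  (gC : Ck_on 2 (O1 `*` O2 `*` Theta) (fun p => gb p.1.1 p.1.2 p.2))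
  (HC : Ck_on 2 (O1 `*` Theta) (fun p => Hb p.1 p.2))
  (GC : Ck_on 2 (O1 `*` Theta) (fun p => Gb p.1 p.2)).

(** The multipliers range over their whole spaces, as [Phi] is affine in them. *)
Definition dom : set (E * 'cV[R]_l) :=
  [set p | [/\ O1 (px p.1), O2 (py p.1) & Theta p.2]].

Lemma px_linear : linear (px : E -> 'cV[R]_n).
Proof. by move=> a e e'; rewrite /px !linearP. Qed.
Lemma py_linear : linear (py : E -> 'cV[R]_m).
Proof. by move=> a e e'; rewrite /py !linearP. Qed.

Definition px_lin : {linear E -> 'cV[R]_n} :=
  HB.pack (px : E -> 'cV[R]_n) (GRing.isLinear.Build _ _ _ _ _ px_linear).
Definition py_lin : {linear E -> 'cV[R]_m} :=
  HB.pack (py : E -> 'cV[R]_m) (GRing.isLinear.Build _ _ _ _ _ py_linear).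

Definition pxt (p : E * 'cV[R]_l) : 'cV[R]_n * 'cV[R]_l := (px p.1, p.2).
Definition pxyt (p : E * 'cV[R]_l) : 'cV[R]_n * 'cV[R]_m * 'cV[R]_l :=
  (px p.1, py p.1, p.2).

Lemma pxt_linear : linear pxt.
Proof. by move=> a e e'; rewrite /pxt; congr pair; rewrite /= px_linear. Qed.
Lemma pxyt_linear : linear pxyt.
Proof.
move=> a e e'; rewrite /pxyt; congr pair => /=; congr pair => /=.
  by rewrite px_linear.
by rewrite py_linear.
Qed.

Definition pxt_lin : {linear (E * 'cV[R]_l)%type -> ('cV[R]_n * 'cV[R]_l)%type} :=
  HB.pack pxt (GRing.isLinear.Build _ _ _ _ _ pxt_linear).
Definition pxyt_lin : {linear (E * 'cV[R]_l)%type -> ('cV[R]_n * 'cV[R]_m * 'cV[R]_l)%type} :=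
  HB.pack pxyt (GRing.isLinear.Build _ _ _ _ _ pxyt_linear).

Lemma fst_px_continuous : continuous (fun p : E * 'cV[R]_l => px p.1).
Proof.
have c : continuous (px_lin : E -> _) by exact: linear_cV_continuous.
move=> p; apply: (@continuous_comp _ _ _ fst (px : E -> _) p); first exact: cvg_fst.
exact: (c p.1).
Qed.

Lemma fst_py_continuous : continuous (fun p : E * 'cV[R]_l => py p.1).
Proof.
have c : continuous (py_lin : E -> _) by exact: linear_cV_continuous.
move=> p; apply: (@continuous_comp _ _ _ fst (py : E -> _) p); first exact: cvg_fst.
exact: (c p.1).
Qed.

Lemma pxt_continuous : continuous pxt.
Proof.
move=> p; apply: (@cvg_pair_nbhs _ (nbhs p) (nbhs_filter p)).
  exact: fst_px_continuous.
exact: cvg_snd.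
Qed.

Lemma pxyt_continuous : continuous pxyt.
Proof.
move=> p; apply: (@cvg_pair_nbhs _ (nbhs p) (nbhs_filter p)); last exact: cvg_snd.
apply: (@cvg_pair_nbhs _ (nbhs p) (nbhs_filter p)).
  exact: fst_px_continuous.
exact: fst_py_continuous.
Qed.

Lemma dom_open : open dom.
Proof.
rewrite (_ : dom = (fun p : E * 'cV[R]_l => px p.1) @^-1` O1 `&`
  ((fun p : E * 'cV[R]_l => py p.1) @^-1` O2 `&` snd @^-1` Theta)).
  apply: openI; first by apply: open_comp => // p _; exact: fst_px_continuous.
  apply: openI; first by apply: open_comp => // p _; exact: fst_py_continuous.
  by apply: open_comp => // p _; exact: cvg_snd.
by apply/seteqP; split=> [p [? ? ?]|p [? [? ?]]].
Qed.

Lemma Ck_xyt (W : normedModType R) (F : _ -> W) :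
  Ck_on 2 (O1 `*` O2 `*` Theta) F -> Ck_on 2 dom (fun p => F (pxyt p)).
Proof.
move=> FC; apply: (Ck_on_sub _ (Ck_on_compr (L := pxyt_lin) pxyt_continuous FC)).
by move=> p [].
Qed.

Lemma Ck_xt (W : normedModType R) (F : _ -> W) :
  Ck_on 2 (O1 `*` Theta) F -> Ck_on 2 dom (fun p => F (pxt p)).
Proof.
move=> FC; apply: (Ck_on_sub _ (Ck_on_compr (L := pxt_lin) pxt_continuous FC)).
by move=> p [].
Qed.

Lemma Ck_fst k (i : 'I_N) : Ck_on k dom (fun p => p.1 i 0 : R).
Proof.
apply: (Ck_on_coord i dom_open (f := fst)).
by apply: Ck_on_linear => p; exact: cvg_fst.
Qed.

Lemma Ck_dot q (idx : 'I_q -> 'I_N) (F : E * 'cV[R]_l -> 'cV[R]_q) :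
  Ck_on 2 dom F ->
  Ck_on 2 dom (fun p => \sum_i p.1 (idx i) 0 * F p i 0).
Proof.
move=> FC; apply: (@Ck_on_sum _ _ R 2 dom q
  (fun i p => p.1 (idx i) 0 * F p i 0) dom_open) => i.
apply: (@Ck_onM _ _ 2 dom (fun p => p.1 (idx i) 0) (fun p => F p i 0) dom_open).
  exact: Ck_fst.
exact: (Ck_on_coord i dom_open FC).
Qed.

Lemma PhiL_C2 : Ck_on 2 dom PhiL.
Proof.
(* The minus sign becomes a constant factor, so that the lemmas on sums and products suffice. *)
apply: (Ck_on_eq (f := fun p => fb (px p.1) (py p.1) p.2 +
   \sum_i p.1 (imu i) 0 * hb (px p.1) (py p.1) p.2 i 0 +
   (-1) * \sum_i p.1 (ilam i) 0 * gb (px p.1) (py p.1) p.2 i 0) dom_open).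
  move=> p _; rewrite /PhiL /lagrangian /= mulN1r; congr (_ + _ - _).
    by apply: eq_bigr => i _; rewrite /pmu !mxE.
  by apply: eq_bigr => i _; rewrite /plam !mxE.
apply: (Ck_onD dom_open).
  apply: (Ck_onD dom_open); first exact: (Ck_xyt fC).
  exact: Ck_dot (Ck_xyt hC).
apply: (Ck_onM dom_open (f := fun=> -1)); first exact: Ck_on_cst.
exact: Ck_dot (Ck_xyt gC).
Qed.

Lemma PhiU_C2 : Ck_on 2 dom PhiU.
Proof.
apply: (@Ck_on_eq _ _ R 2 dom (fun p =>
   \sum_i p.1 (iu i) 0 * Hb (px p.1) p.2 i 0 +
   \sum_i p.1 (iv i) 0 * Gb (px p.1) p.2 i 0) PhiU dom_open).
  move=> p _; rewrite /PhiU /=; congr (_ + _).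
    by apply: eq_bigr => i _; rewrite /pu !mxE.
  by apply: eq_bigr => i _; rewrite /pv !mxE.
exact: Ck_onD dom_open (Ck_dot iu (Ck_xt HC)) (Ck_dot iv (Ck_xt GC)).
Qed.

Lemma Phi_C2 : Ck_on 2 dom Phi.
Proof. exact: Ck_onD dom_open PhiL_C2 PhiU_C2. Qed.

Let dPhiL p : dom p -> differentiable PhiL p.
Proof. by have [+ _] := PhiL_C2; apply. Qed.
Let dPhiU p : dom p -> differentiable PhiU p.
Proof. by have [+ _] := PhiU_C2; apply. Qed.

Lemma derive_PhiD d p : dom p -> 'D_d Phi p = 'D_d PhiL p + 'D_d PhiU p.
Proof.
move=> Dp; apply: (@deriveD _ _ _ PhiL PhiU); apply: diff_derivable.
  exact: dPhiL.
exact: dPhiU.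
Qed.


Lemma still_x d (F : 'cV[R]_n -> 'cV[R]_l -> R) (p : E * 'cV[R]_l) :
  px d = 0 -> 'D_((d, 0) : E * 'cV[R]_l) (fun p => F (px p.1) p.2) p = 0.
Proof.
move=> d0; apply: derive_affine_along => h.
by rewrite /= px_linear d0 !scaler0 !add0r.
Qed.

Lemma still_xy d (F : 'cV[R]_n -> 'cV[R]_m -> 'cV[R]_l -> R) (p : E * 'cV[R]_l) :
  px d = 0 -> py d = 0 ->
  'D_((d, 0) : E * 'cV[R]_l) (fun p => F (px p.1) (py p.1) p.2) p = 0.
Proof.
move=> d0 d0'; apply: derive_affine_along => h.
by rewrite /= px_linear py_linear d0 d0' !scaler0 !add0r.
Qed.

Lemma partial_slice (F : 'cV[R]_n * 'cV[R]_l -> R) d t :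
  'D_d (fun x' => F (x', t)) = fun x' => 'D_((d, 0) : 'cV[R]_n * 'cV[R]_l) F (x', t).
Proof.
apply/funext => x; apply: (@derive_affine R _ _ _ F (fun x' => (x', t))) => h.
by congr pair; rewrite /= scaler0 add0r.
Qed.

Lemma derivable_slice (F : 'cV[R]_n * 'cV[R]_l -> R) d x t :
  differentiable F (x, t) -> derivable (fun x' => F (x', t)) x d.
Proof.
move=> /(@diff_derivable _ _ _ _ _ ((d, 0) : 'cV[R]_n * 'cV[R]_l)) dF.
apply: (@derivable_affine R _ _ _ F (fun x' => (x', t)) _ _ _ _ dF) => h.
by congr pair; rewrite /= scaler0 add0r.
Qed.

Lemma derivable_slice2 (F : 'cV[R]_n * 'cV[R]_l -> R) d d' x t :
  Ck_on 2 (O1 `*` Theta) F -> O1 x -> Theta t ->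
  derivable (fun x' => F (x', t)) x d /\
  derivable ('D_d' (fun x' => F (x', t))) x d.
Proof.
move=> [dF D2F] Ox Tt; split; first by apply: derivable_slice; exact: dF.
rewrite partial_slice.
apply: (@derivable_slice ('D_((d', 0) : 'cV[R]_n * 'cV[R]_l) F)).
by have [+ _] := D2F ((d', 0) : 'cV[R]_n * 'cV[R]_l); apply.
Qed.

Lemma Hcoord k : Ck_on 2 (O1 `*` Theta) (fun p => Hb p.1 p.2 k 0).
Proof. by apply: (Ck_on_coord k) HC; exact: open_setX. Qed.

Lemma Gcoord k : Ck_on 2 (O1 `*` Theta) (fun p => Gb p.1 p.2 k 0).
Proof. by apply: (Ck_on_coord k) GC; exact: open_setX. Qed.

Lemma is_derive_upper u v d x t : O1 x -> Theta t ->
  is_derive x d (fun x' => dot u (Hb x' t) + dot v (Gb x' t))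
    (\sum_k u k 0 * 'D_d (fun x' => Hb x' t k 0) x +
     \sum_k v k 0 * 'D_d (fun x' => Gb x' t k 0) x).
Proof.
move=> Ox Tt; apply: (@is_deriveD _ _ _ (fun x' => dot u (Hb x' t))).
  apply: (@is_derive_lincomb R _ _ (fun k => u k 0) (fun k x' => Hb x' t k 0)) => k.
  by have [] := derivable_slice2 d d (Hcoord k) Ox Tt.
apply: (@is_derive_lincomb R _ _ (fun k => v k 0) (fun k x' => Gb x' t k 0)) => k.
by have [] := derivable_slice2 d d (Gcoord k) Ox Tt.
Qed.

(** The formula for the first derivatives is known over [O1] only, whence the passage through
    [near_eq_derive] before differentiating again. *)
Lemma hess_upper u v d d' x t : O1 x -> Theta t ->
  'D_d ('D_d' (fun x' => dot u (Hb x' t) + dot v (Gb x' t))) x =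
    \sum_k u k 0 * 'D_d ('D_d' (fun x' => Hb x' t k 0)) x +
    \sum_k v k 0 * 'D_d ('D_d' (fun x' => Gb x' t k 0)) x.
Proof.
move=> Ox Tt.
have nE : \forall x' \near x,
    'D_d' (fun x' => dot u (Hb x' t) + dot v (Gb x' t)) x' =
    \sum_k u k 0 * 'D_d' (fun x' => Hb x' t k 0) x' +
    \sum_k v k 0 * 'D_d' (fun x' => Gb x' t k 0) x'.
  apply: filterS (open_nbhs_nbhs (conj oO1 Ox)) => x' Ox'.
  by have [_] := is_derive_upper u v d' Ox' Tt.
apply: etrans (near_eq_derive d nE) _.
have H1 : is_derive x d (fun x' => \sum_k u k 0 * 'D_d' (fun x' => Hb x' t k 0) x')
    (\sum_k u k 0 * 'D_d ('D_d' (fun x' => Hb x' t k 0)) x).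
  apply: (@is_derive_lincomb R _ _ (fun k => u k 0)
    (fun k => 'D_d' (fun x' => Hb x' t k 0))) => k.
  by have [] := derivable_slice2 d d' (Hcoord k) Ox Tt.
have H2 : is_derive x d (fun x' => \sum_k v k 0 * 'D_d' (fun x' => Gb x' t k 0) x')
    (\sum_k v k 0 * 'D_d ('D_d' (fun x' => Gb x' t k 0)) x).
  apply: (@is_derive_lincomb R _ _ (fun k => v k 0)
    (fun k => 'D_d' (fun x' => Gb x' t k 0))) => k.
  by have [] := derivable_slice2 d d' (Gcoord k) Ox Tt.
by have [_ HE] := is_deriveD H1 H2; exact: HE.
Qed.

Section SmoothBlocks.
Variables (x : 'cV[R]_n) (y : 'cV[R]_m) (u : 'cV[R]_n1) (v : 'cV[R]_n2)
  (mu : 'cV[R]_m1) (lam : 'cV[R]_m2) (t : 'cV[R]_l).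
Hypotheses (Ox : O1 x) (Oy : O2 y) (Tt : Theta t).
Local Notation p := ((emb x y u v mu lam, t) : E * 'cV[R]_l).
Local Notation D2 i j := ('D_(dir i) ('D_(dir j) Phi) p).

Let domp : dom p. Proof. by split; rewrite /= ?p_emb. Qed.

Let derivable_g k d : derivable (fun p : E * 'cV[R]_l => gb (px p.1) (py p.1) p.2 k 0) p d.
Proof.
apply: diff_derivable.
by have [+ _] := Ck_on_coord k dom_open (Ck_xyt gC); apply.
Qed.

Lemma D2_xlam i k :
  D2 (ix i) (ilam k) = - jac (fun x' => mm_g (P t) x' y) x k i.
Proof.
rewrite derive_Phi_lam.
rewrite (@deriveN _ _ _ (fun p : E * 'cV[R]_l => gb (px p.1) (py p.1) p.2 k 0) _ _ (@derivable_g k _)).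
congr (- _); rewrite slice_x mxE /partial.
apply: (congr1 (fun F => 'D_(delta_mx i 0) F x)).
by apply/funext => x'; rewrite /= !p_emb.
Qed.

Lemma D2_ylam i k : D2 (iy i) (ilam k) = - jac (mm_g (P t) x) y k i.
Proof.
rewrite derive_Phi_lam.
rewrite (@deriveN _ _ _ (fun p : E * 'cV[R]_l => gb (px p.1) (py p.1) p.2 k 0) _ _ (@derivable_g k _)).
congr (- _); rewrite slice_y mxE /partial.
apply: (congr1 (fun F => 'D_(delta_mx i 0) F y)).
by apply/funext => x'; rewrite /= !p_emb.
Qed.

Lemma slice_PhiL j : 'D_(dir (ix j)) PhiL p =
  'D_(delta_mx j 0) (fun x' => lagrangian (P t) x' y mu lam) x.
Proof.
rewrite slice_x; apply: (congr1 (fun F => 'D_(delta_mx j 0) F x)).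
by apply/funext => x'; rewrite PhiL_emb.
Qed.

Lemma slice_PhiU j : 'D_(dir (ix j)) PhiU p =
  'D_(delta_mx j 0) (fun x' => dot u (Hb x' t) + dot v (Gb x' t)) x.
Proof.
rewrite slice_x; apply: (congr1 (fun F => 'D_(delta_mx j 0) F x)).
by apply/funext => x'; rewrite PhiU_emb.
Qed.

End SmoothBlocks.

Lemma derive_Phi_x x y u v mu lam t i : O1 x -> O2 y -> Theta t ->
  'D_(dir (ix i)) Phi (emb x y u v mu lam, t) =
  (gradxL (P t) x y mu lam + (jac (mm_H (P t)) x)^T *m u +
   (jac (mm_G (P t)) x)^T *m v) i 0.
Proof.
move=> Ox Oy Tt.
rewrite derive_PhiD; last by split; rewrite /= ?p_emb.
rewrite slice_PhiL slice_PhiU.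
have [_ ->] := is_derive_upper u v (delta_mx i 0) Ox Tt.
rewrite !mxE -addrA; congr (_ + (_ + _)).
  by apply: eq_bigr => k _; rewrite !mxE mulrC.
by apply: eq_bigr => k _; rewrite !mxE mulrC.
Qed.

(** Splitting [Phi] under the outer derivative requires both inner slices to be derivable; each is
    recognised as a slice of a first derivative of [PhiL] or [PhiU], which are C^2. *)
Lemma D2_xx x y u v mu lam t i j : O1 x -> O2 y -> Theta t ->
  'D_(dir (ix i)) ('D_(dir (ix j)) Phi) (emb x y u v mu lam, t) =
  (hessxxL (P t) x y mu lam + upper_constraint_hess (P t) x u v) i j.
Proof.
move=> Ox Oy Tt; rewrite slice_x.
have nE : \forall x' \near x, 'D_(dir (ix j)) Phi (emb x' y u v mu lam, t) =
   'D_(delta_mx j 0) (fun x' => lagrangian (P t) x' y mu lam) x' +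
   'D_(delta_mx j 0) (fun x' => dot u (Hb x' t) + dot v (Gb x' t)) x'.
  apply: filterS (open_nbhs_nbhs (conj oO1 Ox)) => x' Ox'.
  rewrite derive_PhiD; last by split; rewrite /= ?p_emb.
  by rewrite slice_PhiL slice_PhiU.
apply: etrans (near_eq_derive _ nE) _.
have dom0 : dom (emb x y u v mu lam, t) by split; rewrite /= ?p_emb.
rewrite (@deriveD _ _ _ ('D_(delta_mx j 0) (fun x' => lagrangian (P t) x' y mu lam))
   ('D_(delta_mx j 0) (fun x' => dot u (Hb x' t) + dot v (Gb x' t)))).
- rewrite (hess_upper _ _ _ _ Ox Tt) !mxE !summxE; congr (_ + (_ + _)).
    by apply: eq_bigr => k _; rewrite !mxE.
  by apply: eq_bigr => k _; rewrite !mxE.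
- have -> : 'D_(delta_mx j 0) (fun x' => lagrangian (P t) x' y mu lam) =
      fun x' => 'D_(dir (ix j)) PhiL (emb x' y u v mu lam, t).
    by apply/funext => x'; rewrite slice_PhiL.
  apply: (derivable_slice_x (g := 'D_(dir (ix j)) PhiL)); apply: diff_derivable.
  by have [_ /(_ (dir (ix j)))[+ _]] := PhiL_C2; apply.
- have -> : 'D_(delta_mx j 0) (fun x' => dot u (Hb x' t) + dot v (Gb x' t)) =
      fun x' => 'D_(dir (ix j)) PhiU (emb x' y u v mu lam, t).
    by apply/funext => x'; rewrite slice_PhiU.
  apply: (derivable_slice_x (g := 'D_(dir (ix j)) PhiU)); apply: diff_derivable.
  by have [_ /(_ (dir (ix j)))[+ _]] := PhiU_C2; apply.
Qed.

Lemma D2_yx x y u v mu lam t i j : O1 x -> O2 y -> Theta t ->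
  'D_(dir (iy i)) ('D_(dir (ix j)) Phi) (emb x y u v mu lam, t) =
  hessyxL (P t) x y mu lam i j.
Proof.
move=> Ox Oy Tt; rewrite slice_y.
(* The contribution of [PhiU], which does not vary with [y]. *)
pose c : R := 'D_(delta_mx j 0) (fun x' => dot u (Hb x' t) + dot v (Gb x' t)) x.
pose g y' : R := 'D_(delta_mx j 0) (fun x' => lagrangian (P t) x' y' mu lam) x.
have nE : \forall y' \near y, 'D_(dir (ix j)) Phi (emb x y' u v mu lam, t) = g y' + c.
  apply: filterS (open_nbhs_nbhs (conj oO2 Oy)) => y' Oy'.
  rewrite derive_PhiD; last by split; rewrite /= ?p_emb.
  by rewrite slice_PhiL slice_PhiU.
apply: etrans (near_eq_derive _ nE) _.
rewrite mxE /partial -/g.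
by apply: (derive_eq_along (c := c)).
Qed.

End SmoothLagrangian.

(** * The Hessian of [Phi] applied to a direction *)

Section LagrangianHessian.
Context {R : realType} {n m m1 m2 n1 n2 l : nat}.
Variables (fb : 'cV[R]_n -> 'cV[R]_m -> 'cV[R]_l -> R)
  (hb : 'cV[R]_n -> 'cV[R]_m -> 'cV[R]_l -> 'cV[R]_m1)
  (gb : 'cV[R]_n -> 'cV[R]_m -> 'cV[R]_l -> 'cV[R]_m2)
  (Hb : 'cV[R]_n -> 'cV[R]_l -> 'cV[R]_n1)
  (Gb : 'cV[R]_n -> 'cV[R]_l -> 'cV[R]_n2).
Variables (O1 : set 'cV[R]_n) (O2 : set 'cV[R]_m) (Theta : set 'cV[R]_l).
Local Notation N := (@edim n m m1 m2 n1 n2).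
Local Notation E := ('cV[R]_N).
Local Notation P t := (perturbed fb hb gb Hb Gb t).
Local Notation dir k := ((delta_mx k 0, 0) : E * 'cV[R]_l).
Local Notation Phi := (Phi fb hb gb Hb Gb).
Local Notation PhiL := (PhiL fb hb gb Hb Gb).
Local Notation PhiU := (@PhiU R n m m1 m2 n1 n2 l Hb Gb).
Local Notation dom := (@dom R n m m1 m2 n1 n2 l O1 O2 Theta).
Hypotheses (oO1 : open O1) (oO2 : open O2) (oTh : open Theta).
Hypotheses
  (fC : Ck_on 2 (O1 `*` O2 `*` Theta) (fun p => fb p.1.1 p.1.2 p.2))
  (hC : Ck_on 2 (O1 `*` O2 `*` Theta) (fun p => hb p.1.1 p.1.2 p.2))
  (gC : Ck_on 2 (O1 `*` O2 `*` Theta) (fun p => gb p.1.1 p.1.2 p.2))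
  (HC : Ck_on 2 (O1 `*` Theta) (fun p => Hb p.1 p.2))
  (GC : Ck_on 2 (O1 `*` Theta) (fun p => Gb p.1 p.2)).


Let Phi_C2' : Ck_on 2 dom Phi.
Proof. exact: Phi_C2. Qed.

Let dom_open' : open dom.
Proof. exact: dom_open. Qed.

Lemma derivable_slice_xyt (W : normedModType R)
    (F : 'cV[R]_n * 'cV[R]_m * 'cV[R]_l -> W) d x y t :
  differentiable F (x, y, t) -> derivable (fun y' => F (x, y', t)) y d.
Proof.
move=> /(@diff_derivable _ _ _ _ _ ((0, d, 0) : 'cV[R]_n * 'cV[R]_m * 'cV[R]_l)) dF.
apply: (@derivable_affine R _ _ _ F (fun y' => (x, y', t)) _ _ _ _ dF) => h.
by congr pair; rewrite /= ?scaler0 ?add0r//; congr pair; rewrite /= ?scaler0 ?add0r.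
Qed.

(** Discharges the assumption [gradyLE] of [jacobian_uniquenessP]. *)
Lemma gradyL_expand x y mu lam t : O1 x -> O2 y -> Theta t ->
  gradyL (P t) x y mu lam = grad (mm_f (P t) x) y + (Jyh (P t) x y)^T *m mu
    - (jac (mm_g (P t) x) y)^T *m lam.
Proof.
move=> Ox Oy Tt; apply/matrixP => i j; rewrite (ord1 j) {j} !mxE /partial.
set d := delta_mx i 0.
have Df : is_derive y d (fun y' => fb x y' t) ('D_d (fun y' => fb x y' t) y).
  apply: derivableP.
  apply: (@derivable_slice_xyt _ (fun p => fb p.1.1 p.1.2 p.2)).
  by have [+ _] := fC; apply.
have Dh : is_derive y d (fun y' => dot mu (hb x y' t))
    (\sum_k mu k 0 * 'D_d (fun y' => hb x y' t k 0) y).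
  apply: (@is_derive_lincomb R _ _ (fun k => mu k 0) (fun k y' => hb x y' t k 0)) => k.
  apply: (@derivable_slice_xyt _ (fun p => hb p.1.1 p.1.2 p.2 k 0)).
  by have [+ _] := Ck_on_coord k (open_setX (open_setX oO1 oO2) oTh) hC; apply.
have Dg : is_derive y d (fun y' => dot lam (gb x y' t))
    (\sum_k lam k 0 * 'D_d (fun y' => gb x y' t k 0) y).
  apply: (@is_derive_lincomb R _ _ (fun k => lam k 0) (fun k y' => gb x y' t k 0)) => k.
  apply: (@derivable_slice_xyt _ (fun p => gb p.1.1 p.1.2 p.2 k 0)).
  by have [+ _] := Ck_on_coord k (open_setX (open_setX oO1 oO2) oTh) gC; apply.
have [_ HE] := is_deriveB (is_deriveD Df Dh) Dg.
apply: etrans HE _; congr (_ + _ - _).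
  by apply: eq_bigr => k _; rewrite !mxE mulrC.
by apply: eq_bigr => k _; rewrite !mxE mulrC.
Qed.

(** Linearity of the differential in [d] gives the sum. Symmetry then moves the coordinate [i] of
    [d] inside, so that a multiplier coordinate of [d] meets the explicit first derivative of
    [Phi]. *)
Lemma hess_row j d p : dom p ->
  'D_((d, 0) : E * 'cV[R]_l) ('D_(dir j) Phi) p =
  \sum_i d i 0 * 'D_(dir j) ('D_(dir i) Phi) p.
Proof.
move=> Dp; have [_ DPhi] := Phi_C2'.
have dF : differentiable ('D_(dir j) Phi) p.
  by have [+ _] := DPhi (dir j); apply.
pose g d : R := 'd ('D_(dir j) Phi) p ((d, 0) : E * 'cV[R]_l).
have gl : linear g.
  move=> a u v; rewrite /g.
  have -> : ((a *: u + v, 0) : E * 'cV[R]_l) = a *: (u, 0) + (v, 0).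
    by congr pair; rewrite /= scaler0 addr0.
  by rewrite linearP.
pose gL : {linear E -> R} := HB.pack g (GRing.isLinear.Build _ _ _ _ _ gl).
have E1 : 'D_((d, 0) : E * 'cV[R]_l) ('D_(dir j) Phi) p = gL d.
  exact: (deriveE _ dF).
refine (etrans E1 (etrans (linear_cV_sum gL d) _)); apply: eq_bigr => i _.
refine (congr1 (fun z => d i 0 * z) (etrans (esym (deriveE _ dF)) _)).
exact: (derive_comm (dir j) (dir i) dom_open' Dp Phi_C2').
Qed.

Section HessianKernel.
Variables (x : 'cV[R]_n) (y : 'cV[R]_m) (u : 'cV[R]_n1) (v : 'cV[R]_n2)
  (mu : 'cV[R]_m1) (lam : 'cV[R]_m2) (t : 'cV[R]_l).
Hypotheses (Ox : O1 x) (Oy : O2 y) (Tt : Theta t).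
Local Notation p := ((emb x y u v mu lam, t) : E * 'cV[R]_l).
Local Notation D2 i j := ('D_(dir i) ('D_(dir j) Phi) p).

Let domp : dom p. Proof. by split; rewrite /= ?p_emb. Qed.

Let D2C i j : D2 i j = D2 j i.
Proof. exact: (derive_comm (dir j) (dir i) dom_open' domp Phi_C2'). Qed.

(** This and the next three lemmas give the zero blocks: multipliers interact neither with one
    another nor, at the upper level, with [y]. *)
Let D2_u_still k j : px (delta_mx j 0 : E) = 0 -> D2 (iu k) j = 0.
Proof.
by move=> j0; rewrite D2C derive_Phi_u; exact: (still_x (fun a b => Hb a b k 0)).
Qed.

Let D2_v_still k j : px (delta_mx j 0 : E) = 0 -> D2 (iv k) j = 0.
Proof.
by move=> j0; rewrite D2C derive_Phi_v; exact: (still_x (fun a b => Gb a b k 0)).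
Qed.

Let D2_mu_still k j : px (delta_mx j 0 : E) = 0 -> py (delta_mx j 0 : E) = 0 ->
  D2 (imu k) j = 0.
Proof.
by move=> j0 j1; rewrite D2C derive_Phi_mu; exact: (still_xy (fun a b c => hb a b c k 0)).
Qed.

Let D2_lam_still k j : px (delta_mx j 0 : E) = 0 -> py (delta_mx j 0 : E) = 0 ->
  D2 (ilam k) j = 0.
Proof.
by move=> j0 j1; rewrite D2C derive_Phi_lam; exact: (still_xy (fun a b c => - gb a b c k 0)).
Qed.

Let sum_block q r (c f : 'I_q -> R) (M : 'M[R]_(r, q)) (w : 'cV[R]_q) k :
  (forall i, c i = w i 0) -> (forall i, f i = M k i) ->
  \sum_i c i * f i = (M *m w) k 0.
Proof. by move=> cE fE; rewrite mxE; apply: eq_bigr => i _; rewrite cE fE mulrC. Qed.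

Variables (dx : 'cV[R]_n) (dy : 'cV[R]_m) (du : 'cV[R]_n1) (dv : 'cV[R]_n2)
  (dmu : 'cV[R]_m1) (dlam : 'cV[R]_m2).
Let d : E := emb dx dy du dv dmu dlam.
Local Notation Dd j := ('D_((d, 0) : E * 'cV[R]_l) ('D_(dir j) Phi) p).

Let dxE i : d (ix i) 0 = dx i 0. Proof. by have [] := emb_entry dx dy du dv dmu dlam. Qed.
Let dyE i : d (iy i) 0 = dy i 0. Proof. by have [_ []] := emb_entry dx dy du dv dmu dlam. Qed.
Let duE i : d (iu i) 0 = du i 0. Proof. by have [_ [_ []]] := emb_entry dx dy du dv dmu dlam. Qed.
Let dvE i : d (iv i) 0 = dv i 0. Proof. by have [_ [_ [_ []]]] := emb_entry dx dy du dv dmu dlam. Qed.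
Let dmuE i : d (imu i) 0 = dmu i 0.
Proof. by have [_ [_ [_ [_ []]]]] := emb_entry dx dy du dv dmu dlam. Qed.
Let dlamE i : d (ilam i) 0 = dlam i 0.
Proof. by have [_ [_ [_ [_ []]]]] := emb_entry dx dy du dv dmu dlam. Qed.

Local Notation JH := (jac (mm_H (P t)) x).
Local Notation JG := (jac (mm_G (P t)) x).
Local Notation Jxg := (jac (fun x' => mm_g (P t) x' y) x).
Local Notation Jyg := (jac (mm_g (P t) x) y).
Local Notation Wxx := (hessxxL (P t) x y mu lam + upper_constraint_hess (P t) x u v).
Local Notation Wyx := (hessyxL (P t) x y mu lam).
Local Notation Wyy := (hessyyL (P t) x y mu lam).

Let B_xx k i : D2 (ix k) (ix i) = Wxx k i.
Proof. by apply: D2_xx; eassumption. Qed.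
Let B_yx k i : D2 (iy k) (ix i) = Wyx k i.
Proof. by apply: D2_yx; eassumption. Qed.
Let B_xlam i k : D2 (ix i) (ilam k) = - Jxg k i.
Proof. by apply: D2_xlam; eassumption. Qed.
Let B_ylam i k : D2 (iy i) (ilam k) = - Jyg k i.
Proof. by apply: D2_ylam; eassumption. Qed.

Let Dd_x k : Dd (ix k) = (Wxx *m dx + Wyx^T *m dy + JH^T *m du + JG^T *m dv
  + (Jxh (P t) x y)^T *m dmu - Jxg^T *m dlam) k 0.
Proof.
apply: etrans (hess_row _ _ domp) _; rewrite sum_edim.
have S1 := sum_block dxE (B_xx k).
have F2 i : D2 (ix k) (iy i) = Wyx^T k i.
  by rewrite D2C B_yx [RHS]mxE.
have F3 i : D2 (ix k) (iu i) = JH^T k i by rewrite D2_xu [RHS]mxE.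
have F4 i : D2 (ix k) (iv i) = JG^T k i by rewrite D2_xv [RHS]mxE.
have F5 i : D2 (ix k) (imu i) = (Jxh (P t) x y)^T k i by rewrite D2_xmu [RHS]mxE.
have F6 i : D2 (ix k) (ilam i) = (- Jxg^T) k i.
  by rewrite B_xlam [RHS]mxE [in RHS]mxE.
rewrite S1 (sum_block dyE F2) (sum_block duE F3) (sum_block dvE F4).
rewrite (sum_block dmuE F5) (sum_block dlamE F6) mulNmx.
move: (_ *m dx) (_ *m dy) (_ *m du) (_ *m dv) (_ *m dmu) (_ *m dlam) => *.
by rewrite !mxE !addrA.
Qed.

Let Dd_y k : Dd (iy k) =
  (Wyx *m dx + Wyy *m dy + (Jyh (P t) x y)^T *m dmu - Jyg^T *m dlam) k 0.
Proof.
apply: etrans (hess_row _ _ domp) _; rewrite sum_edim.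
have S1 := sum_block dxE (B_yx k).
have F2 i : D2 (iy k) (iy i) = Wyy k i by exact: D2_yy.
have F3 i : D2 (iy k) (iu i) = (0 : 'M[R]_(m, n1)) k i.
  by rewrite D2C D2_u_still ?mxE// delta_iy p_emb.
have F4 i : D2 (iy k) (iv i) = (0 : 'M[R]_(m, n2)) k i.
  by rewrite D2C D2_v_still ?mxE// delta_iy p_emb.
have F5 i : D2 (iy k) (imu i) = (Jyh (P t) x y)^T k i by rewrite D2_ymu [RHS]mxE.
have F6 i : D2 (iy k) (ilam i) = (- Jyg^T) k i.
  by rewrite B_ylam [RHS]mxE [in RHS]mxE.
rewrite S1 (sum_block dyE F2) (sum_block duE F3) (sum_block dvE F4).
rewrite (sum_block dmuE F5) (sum_block dlamE F6) mulNmx !mul0mx.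
move: (_ *m dx) (_ *m dy) (_ *m dmu) (_ *m dlam) => *.
by rewrite !mxE !add0r !addrA.
Qed.

Let sum_zero q (c f : 'I_q -> R) : (forall i, f i = 0) -> \sum_i c i * f i = 0.
Proof. by move=> f0; apply: big1 => i _; rewrite f0 mulr0. Qed.

Let Dd_u k : Dd (iu k) = (JH *m dx) k 0.
Proof.
apply: etrans (hess_row _ _ domp) _; rewrite sum_edim.
have F1 i : D2 (iu k) (ix i) = JH k i by rewrite D2C D2_xu.
rewrite (sum_block dxE F1) !sum_zero ?addr0// => i; apply: D2_u_still.
- by rewrite delta_ilam p_emb.
- by rewrite delta_imu p_emb.
- by rewrite delta_iv p_emb.
- by rewrite delta_iu p_emb.
- by rewrite delta_iy p_emb.
Qed.

Let Dd_v k : Dd (iv k) = (JG *m dx) k 0.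
Proof.
apply: etrans (hess_row _ _ domp) _; rewrite sum_edim.
have F1 i : D2 (iv k) (ix i) = JG k i by rewrite D2C D2_xv.
rewrite (sum_block dxE F1) !sum_zero ?addr0// => i; apply: D2_v_still.
- by rewrite delta_ilam p_emb.
- by rewrite delta_imu p_emb.
- by rewrite delta_iv p_emb.
- by rewrite delta_iu p_emb.
- by rewrite delta_iy p_emb.
Qed.

Let Dd_mu k : Dd (imu k) = (Jxh (P t) x y *m dx + Jyh (P t) x y *m dy) k 0.
Proof.
apply: etrans (hess_row _ _ domp) _; rewrite sum_edim.
have F1 i : D2 (imu k) (ix i) = Jxh (P t) x y k i by rewrite D2C D2_xmu.
have F2 i : D2 (imu k) (iy i) = Jyh (P t) x y k i by rewrite D2C D2_ymu.
rewrite (sum_block dxE F1) (sum_block dyE F2) [RHS]mxE.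
rewrite !sum_zero ?addr0// => i; apply: D2_mu_still;
  by rewrite ?delta_ilam ?delta_imu ?delta_iv ?delta_iu p_emb.
Qed.

Let Dd_lam k : Dd (ilam k) = - (Jxg *m dx + Jyg *m dy) k 0.
Proof.
apply: etrans (hess_row _ _ domp) _; rewrite sum_edim.
have F1 i : D2 (ilam k) (ix i) = (- Jxg) k i.
  by rewrite D2C B_xlam [RHS]mxE.
have F2 i : D2 (ilam k) (iy i) = (- Jyg) k i.
  by rewrite D2C B_ylam [RHS]mxE.
rewrite (sum_block dxE F1) (sum_block dyE F2) !mulNmx [in RHS]mxE opprD.
rewrite [X in X + _]mxE [X in _ + (X + _)]mxE.
rewrite !sum_zero ?addr0// => i; apply: D2_lam_still;
  by rewrite ?delta_ilam ?delta_imu ?delta_iv ?delta_iu p_emb.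
Qed.

(** On inactive indices the row of the square system is the multiplier itself, hence the two
    alternatives in the hypotheses. *)
Lemma hess_kernel Iu al : regular_at (P t) x u v y mu lam Iu al ->
  (forall i, Dd (ix i) = 0) -> (forall i, Dd (iy i) = 0) ->
  (forall i, Dd (iu i) = 0) -> (forall i, Dd (imu i) = 0) ->
  (forall i, if i \in Iu then Dd (iv i) = 0 else dv i 0 = 0) ->
  (forall i, if i \in al then Dd (ilam i) = 0 else dlam i 0 = 0) -> d = 0.
Proof.
move=> reg Ex Ey Eu Em Ev El; apply/emb0; apply: (regular_kernel reg).
- by apply/matrixP => i j; rewrite (ord1 j) -Dd_x Ex mxE.
- by apply/matrixP => i j; rewrite (ord1 j) -Dd_y Ey mxE.
- by apply/matrixP => i j; rewrite (ord1 j) -Dd_u Eu mxE.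
- by move=> i iI; have := Ev i; rewrite iI Dd_v.
- by move=> i /negbTE iI; have := Ev i; rewrite iI.
- by apply/matrixP => i j; rewrite (ord1 j) -Dd_mu Em mxE.
- by move=> i ial; have := El i; rewrite ial Dd_lam => /eqP; rewrite oppr_eq0 => /eqP.
- by move=> i /negbTE ial; have := El i; rewrite ial.
Qed.

End HessianKernel.

End LagrangianHessian.
(** * The path of KKT points *)

Lemma Ck_on_cV (R : realType) (V : normedModType R) k (A : set V) p
    (f : V -> 'cV[R]_p) : open A ->
  (forall i, Ck_on k A (fun a => f a i 0 : R)) -> Ck_on k A f.
Proof.
move=> oA fk.
apply: (@Ck_on_eq _ _ _ k A (fun a => \sum_i f a i 0 *: delta_mx i 0)) => //.
  by move=> a _; exact: esym (linear_cV_sum idfun (f a)).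
apply: Ck_on_sum => // i.
have sl : linear (fun c : R => c *: delta_mx i 0 : 'cV[R]_p).
  by move=> a c c'; rewrite scalerDl scalerA.
pose L : {linear R -> 'cV[R]_p} := HB.pack (fun c : R => c *: delta_mx i 0 : 'cV[R]_p)
  (GRing.isLinear.Build _ _ _ _ _ sl).
apply: (@Ck_on_compl _ _ _ _ k A L (fun a => f a i 0)) => //.
by move=> c; exact: scalel_continuous.
Qed.

Section KKTPath.
Context {R : realType} {n m m1 m2 n1 n2 l : nat}.
Variables (fb : 'cV[R]_n -> 'cV[R]_m -> 'cV[R]_l -> R)
  (hb : 'cV[R]_n -> 'cV[R]_m -> 'cV[R]_l -> 'cV[R]_m1)
  (gb : 'cV[R]_n -> 'cV[R]_m -> 'cV[R]_l -> 'cV[R]_m2)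
  (Hb : 'cV[R]_n -> 'cV[R]_l -> 'cV[R]_n1)
  (Gb : 'cV[R]_n -> 'cV[R]_l -> 'cV[R]_n2).
Variables (O1 : set 'cV[R]_n) (O2 : set 'cV[R]_m) (Theta : set 'cV[R]_l).
Local Notation N := (@edim n m m1 m2 n1 n2).
Local Notation E := ('cV[R]_N).
Local Notation P t := (perturbed fb hb gb Hb Gb t).
Local Notation dir k := ((delta_mx k 0, 0) : E * 'cV[R]_l).
Local Notation Phi := (Phi fb hb gb Hb Gb).
Local Notation PhiL := (PhiL fb hb gb Hb Gb).
Local Notation PhiU := (@PhiU R n m m1 m2 n1 n2 l Hb Gb).
Local Notation dom := (@dom R n m m1 m2 n1 n2 l O1 O2 Theta).
Hypotheses (oO1 : open O1) (oO2 : open O2) (oTh : open Theta).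
Hypotheses
  (fC : Ck_on 2 (O1 `*` O2 `*` Theta) (fun p => fb p.1.1 p.1.2 p.2))
  (hC : Ck_on 2 (O1 `*` O2 `*` Theta) (fun p => hb p.1.1 p.1.2 p.2))
  (gC : Ck_on 2 (O1 `*` O2 `*` Theta) (fun p => gb p.1.1 p.1.2 p.2))
  (HC : Ck_on 2 (O1 `*` Theta) (fun p => Hb p.1 p.2))
  (GC : Ck_on 2 (O1 `*` Theta) (fun p => Gb p.1 p.2)).


Let Phi_C2' : Ck_on 2 dom Phi.
Proof. exact: Phi_C2. Qed.

Let dom_open' : open dom.
Proof. exact: dom_open. Qed.

Variables (x0 : 'cV[R]_n) (y0 : 'cV[R]_m) (u0 : 'cV[R]_n1) (v0 : 'cV[R]_n2)
  (mu0 : 'cV[R]_m1) (lam0 : 'cV[R]_m2) (t0 : 'cV[R]_l).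
Hypotheses (Ox : O1 x0) (Oy : O2 y0) (Tt : Theta t0).
Local Notation e0 := (emb x0 y0 u0 v0 mu0 lam0 : E).
Local Notation Iu := (upper_active (P t0) x0).
Local Notation al := (lower_active (P t0) x0 y0).
Hypothesis K0 : strict_KKT (P t0) x0 u0 v0 y0 mu0 lam0.
Hypothesis reg0 : regular_at (P t0) x0 u0 v0 y0 mu0 lam0 Iu al.

(** An indicator vector marking the rows where a derivative of [Phi] is equated to 0. It is built
    with [emb] so that [emb_entry] evaluates it block by block. *)
Let mask : E := emb (const_mx 1) (const_mx 1) (const_mx 1)
  (\col_i (i \in Iu)%:R) (const_mx 1) (\col_i (i \in al)%:R).
Let b j := mask j 0 != 0.
Let maskE := emb_entry (const_mx 1 : 'cV[R]_n) (const_mx 1 : 'cV[R]_m)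
  (const_mx 1 : 'cV[R]_n1) (\col_i (i \in Iu)%:R : 'cV[R]_n2) (const_mx 1 : 'cV[R]_m1)
  (\col_i (i \in al)%:R : 'cV[R]_m2).

Let bx i : b (ix i) = true.
Proof.
rewrite /b /mask; have [-> _] := maskE.
by rewrite mxE oner_eq0.
Qed.
Let by_ i : b (iy i) = true.
Proof.
rewrite /b /mask; have [_ [-> _]] := maskE.
by rewrite mxE oner_eq0.
Qed.
Let bu i : b (iu i) = true.
Proof.
rewrite /b /mask; have [_ [_ [-> _]]] := maskE.
by rewrite mxE oner_eq0.
Qed.
Let bv i : b (iv i) = (i \in Iu).
Proof.
rewrite /b /mask; have [_ [_ [_ [-> _]]]] := maskE.
by rewrite mxE; case: (i \in Iu); rewrite ?oner_eq0 ?eqxx.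
Qed.
Let bmu i : b (imu i) = true.
Proof.
rewrite /b /mask; have [_ [_ [_ [_ [-> _]]]]] := maskE.
by rewrite mxE oner_eq0.
Qed.
Let blam i : b (ilam i) = (i \in al).
Proof.
rewrite /b /mask; have [_ [_ [_ [_ [_ ->]]]]] := maskE.
by rewrite mxE; case: (i \in al); rewrite ?oner_eq0 ?eqxx.
Qed.

Let F (p : E * 'cV[R]_l) : E :=
  \col_j (if b j then 'D_(dir j) Phi p else p.1 j 0).

Let FC1 : Ck_on 1 dom F.
Proof.
apply: (Ck_on_cV dom_open') => j.
have [bj|bj] := boolP (b j).
  apply: (@Ck_on_eq _ _ _ 1 dom ('D_(dir j) Phi) _ dom_open').
    by move=> p _; rewrite mxE bj.
  by have [_ +] := Phi_C2'; apply.
apply: (@Ck_on_eq _ _ _ 1 dom (fun p => p.1 j 0) _ dom_open').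
  by move=> p _; rewrite mxE (negbTE bj).
exact: Ck_fst.
Qed.

Let dom0 : dom (e0, t0).
Proof. by split; rewrite /= ?p_emb. Qed.

Let DF d j : 'D_((d, 0) : E * 'cV[R]_l) F (e0, t0) j 0 =
  if b j then 'D_((d, 0) : E * 'cV[R]_l) ('D_(dir j) Phi) (e0, t0) else d j 0.
Proof.
have dF : derivable F (e0, t0) ((d, 0) : E * 'cV[R]_l).
  by apply: diff_derivable; have [+ _] := FC1; apply.
have := derive_compl (L := coord_lin j : {linear E -> R}) (@coord_continuous _ _ _ j 0) dF.
move=> /esym HE; apply: etrans HE _.
have [bj|bj] := boolP (b j).
  apply: (congr1 (fun G => derive G _ _)); apply/funext => p.
  by rewrite /= mxE bj.
by apply: derive_affine_along => h; rewrite /= !mxE (negbTE bj).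
Qed.

Let DPhi_u k p : 'D_(dir (iu k)) Phi p = Hb (px p.1) p.2 k 0.
Proof. exact: (congr1 (fun g => g p) (derive_Phi_u fb hb gb Hb Gb k)). Qed.
Let DPhi_v k p : 'D_(dir (iv k)) Phi p = Gb (px p.1) p.2 k 0.
Proof. exact: (congr1 (fun g => g p) (derive_Phi_v fb hb gb Hb Gb k)). Qed.
Let DPhi_mu k p : 'D_(dir (imu k)) Phi p = hb (px p.1) (py p.1) p.2 k 0.
Proof. exact: (congr1 (fun g => g p) (derive_Phi_mu fb hb gb Hb Gb k)). Qed.
Let DPhi_lam k p : 'D_(dir (ilam k)) Phi p = - gb (px p.1) (py p.1) p.2 k 0.
Proof. exact: (congr1 (fun g => g p) (derive_Phi_lam fb hb gb Hb Gb k)). Qed.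

Let F0 : F (e0, t0) = 0.
Proof.
have [Ex Ey EH Eh [sv sl]] := K0.
have [Exx [Eyy [Euu [Evv [Emm Ell]]]]] := emb_entry x0 y0 u0 v0 mu0 lam0.
apply/matrixP => j k; rewrite (ord1 k) {k} [RHS]mxE [LHS]mxE; move: j; apply: edim_case => i.
- rewrite bx; apply: etrans; first by apply: derive_Phi_x; eassumption.
  by rewrite Ex mxE.
- by rewrite by_ derive_Phi_y Ey mxE.
- by rewrite bu DPhi_u /= p_emb -[Hb x0 t0]/(mm_H (P t0) x0) EH mxE.
- rewrite bv inE DPhi_v /= p_emb -[Gb x0 t0]/(mm_G (P t0) x0).
  case: eqP => // gi; rewrite Evv.
  by case: (sv i) => -[].
- by rewrite bmu DPhi_mu /= !p_emb -[hb x0 y0 t0]/(mm_h (P t0) x0 y0) Eh mxE.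
- rewrite blam inE DPhi_lam /= !p_emb -[gb x0 y0 t0]/(mm_g (P t0) x0 y0).
  case: eqP => [->|gi]; first by rewrite oppr0.
  by rewrite Ell; case: (sl i) => -[].
Qed.

Let Finj d : 'D_((d, 0) : E * 'cV[R]_l) F (e0, t0) = 0 -> d = 0.
Proof.
move=> D0.
have D0' j : (if b j then 'D_((d, 0) : E * 'cV[R]_l) ('D_(dir j) Phi) (e0, t0)
              else d j 0) = 0.
  by rewrite -DF D0 mxE.
have [_ [_ [_ [Evv [_ Ell]]]]] := emb_entry (px d) (py d) (pu d) (pv d) (pmu d) (plam d).
rewrite embK in Evv Ell.
rewrite -(embK d); apply: (hess_kernel _ _ _ _ _ _ _ _ _ _ _ reg0); try eassumption.
- by move=> i; have := D0' (ix i); rewrite bx embK.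
- by move=> i; have := D0' (iy i); rewrite by_ embK.
- by move=> i; have := D0' (iu i); rewrite bu embK.
- by move=> i; have := D0' (imu i); rewrite bmu embK.
- by move=> i; have := D0' (iv i); rewrite bv embK Evv; case: (i \in Iu).
- by move=> i; have := D0' (ilam i); rewrite blam embK Ell; case: (i \in al).
Qed.

Lemma KKT_path_exists : exists2 e : 'cV[R]_l -> E, e t0 = e0 &
  \forall t \near t0, [/\ dom (e t, t), F (e t, t) = 0 & C1_at e t].
Proof. exact: (implicit_function dom_open' FC1 dom0 F0 Finj). Qed.

(** [F] supplies the equations of strict complementarity and the sign hypotheses its inequalities;
    together they force the active sets at [e] to be those of [t0]. The derivative of [Phi] in [lam]
    is the opposite of [g], hence the reversed sign. *)
Let KKT_point (e : E) (t : 'cV[R]_l) : dom (e, t) -> F (e, t) = 0 ->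
  (forall i, if i \in Iu then 0 < e (iv i) 0 else 'D_(dir (iv i)) Phi (e, t) < 0) ->
  (forall i, if i \in al then 0 < e (ilam i) 0 else 0 < 'D_(dir (ilam i)) Phi (e, t)) ->
  regular_at (P t) (px e) (pu e) (pv e) (py e) (pmu e) (plam e) Iu al ->
  jacobian_uniqueness (P t) (px e) (pu e) (pv e) (py e) (pmu e) (plam e).
Proof.
move=> [/= Oxe Oye Tte] Fe pv0 pl0 reg.
have Fj j : (if b j then 'D_(dir j) Phi (e, t) else e j 0) = 0.
  by have := congr1 (fun M : E => M j 0) Fe; rewrite !mxE.
have [_ [_ [_ [Evv [_ Ell]]]]] := emb_entry (px e) (py e) (pu e) (pv e) (pmu e) (plam e).
rewrite embK in Evv Ell.
have sv : strict_compl (pv e) (Gb (px e) t).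
  move=> i; have := Fj (iv i); have := pv0 i; rewrite bv -Evv.
  case: (i \in Iu) => [v_gt0 G0|G_lt0 ->]; [left|right]; split=> //.
    by rewrite -G0 DPhi_v.
  by move: G_lt0; rewrite DPhi_v.
have sl : strict_compl (plam e) (gb (px e) (py e) t).
  move=> i; have := Fj (ilam i); have := pl0 i; rewrite blam -Ell.
  case: (i \in al) => [v_gt0 G0|G_gt0 ->]; [left|right]; split=> //.
    by apply/eqP; rewrite -oppr_eq0; apply/eqP; rewrite -G0 DPhi_lam.
  by move: G_gt0; rewrite DPhi_lam oppr_gt0.
have IuE : upper_active (P t) (px e) = Iu.
  apply/setP => i; rewrite [LHS]inE /=; have := sv i; have := pv0 i; have := Fj (iv i).
  rewrite bv -Evv; case: (i \in Iu) => E1 E2 [[-> E3]|[E3 E4]]; rewrite ?eqxx//.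
    by move: E2; rewrite E4 ltxx.
    by move: E3; rewrite E1 ltxx.
  by rewrite lt_eqF.
have alE : lower_active (P t) (px e) (py e) = al.
  apply/setP => i; rewrite [LHS]inE /=; have := sl i; have := pl0 i; have := Fj (ilam i).
  rewrite blam -Ell; case: (i \in al) => E1 E2 [[-> E3]|[E3 E4]]; rewrite ?eqxx//.
    by move: E2; rewrite E4 ltxx.
    by move: E3; rewrite E1 ltxx.
  by rewrite lt_eqF.
apply/jacobian_uniquenessP; first by apply: gradyL_expand; eassumption.
rewrite IuE alE; split=> //; split=> //.
- apply/matrixP => i j; rewrite (ord1 j) [RHS]mxE.
  have := Fj (ix i); rewrite bx; apply: etrans.
  have H : 'D_(dir (ix i)) Phi (emb (px e) (py e) (pu e) (pv e) (pmu e) (plam e), t) =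
      (gradxL (P t) (px e) (py e) (pmu e) (plam e) + (jac (mm_H (P t)) (px e))^T *m pu e +
      (jac (mm_G (P t)) (px e))^T *m pv e) i 0.
    by apply: derive_Phi_x; eassumption.
  by rewrite embK in H; exact: esym H.
- apply/matrixP => i j; rewrite (ord1 j) [RHS]mxE.
  have := Fj (iy i); rewrite by_; apply: etrans.
  have := derive_Phi_y fb hb gb Hb Gb (px e) (py e) (pu e) (pv e) (pmu e) (plam e) t i.
  by rewrite embK => H; exact: esym H.
- apply/matrixP => i j; rewrite (ord1 j) [RHS]mxE.
  by have := Fj (iu i); rewrite bu DPhi_u.
- apply/matrixP => i j; rewrite (ord1 j) [RHS]mxE.
  by have := Fj (imu i); rewrite bmu DPhi_mu.
Qed.

Let D2_continuous i j p : dom p -> {for p, continuous ('D_(dir i) ('D_(dir j) Phi))}.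
Proof. by move=> Dp; have [_ /(_ (dir j))[_ /(_ (dir i))]] := Phi_C2'; apply. Qed.

Let D1_continuous j p : dom p -> {for p, continuous ('D_(dir j) Phi)}.
Proof.
move=> Dp; have [_ /(_ (dir j))[dD _]] := Phi_C2'.
by apply: differentiable_continuous; exact: dD.
Qed.

Section Convergence.
Variables (e : 'cV[R]_l -> E).
Hypotheses (et0 : e t0 = e0) (ce : {for t0, continuous e}).
Hypothesis ndom : \forall t \near t0, dom (e t, t).
Local Notation D2 i j t := ('D_(dir i) ('D_(dir j) Phi) (e t, t)).

Let domt0 : dom (e t0, t0). Proof. by rewrite et0. Qed.

Let pc : (e t, t) @[t --> t0] --> ((e t0, t0) : E * 'cV[R]_l).
Proof.
by apply: (@cvg_pair_nbhs _ (nbhs t0) (nbhs_filter t0)); [exact: ce|exact: cvg_id].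
Qed.

Let c2 i j : D2 i j t @[t --> t0] --> D2 i j t0.
Proof. exact: (cvg_comp _ _ pc (D2_continuous (i := i) (j := j) domt0)). Qed.

(** The entries are identified with derivatives of [Phi] only on the domain, where the path stays
    for [t] near [t0]. *)
Let cmx q r (X : 'cV[R]_l -> 'M[R]_(q, r)) (c : 'I_q -> 'I_r -> 'cV[R]_l -> R) :
  (forall i j, c i j t @[t --> t0] --> c i j t0) ->
  (forall t, dom (e t, t) -> forall i j, X t i j = c i j t) -> X @ t0 --> X t0.
Proof.
move=> cc Xc; apply/(@cvg_mxP _ _ (nbhs t0)) => i j.
rewrite (Xc t0 domt0).
have nE : \forall t \near t0, c i j t = X t i j.
  by apply: filterS ndom => t Dt; rewrite Xc.
exact: cvg_trans (near_eq_cvg nE) (cc i j).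
Qed.

Let near_regular : \forall t \near t0,
  regular_at (P t) (px (e t)) (pu (e t)) (pv (e t)) (py (e t)) (pmu (e t))
    (plam (e t)) Iu al.
Proof.
have reg : regular_at (P t0) (px (e t0)) (pu (e t0)) (pv (e t0)) (py (e t0))
    (pmu (e t0)) (plam (e t0)) Iu al by rewrite et0 !p_emb.
apply: (regular_near (FF := nbhs_filter t0) _ _ _ _ _ _ _ _ _ reg).
- apply: (cmx (c := fun i j t => D2 (ix j) (iu i) t)) => [*|t Dt i j]; first exact: c2.
  have H := D2_xu fb hb gb Hb Gb (px (e t)) (py (e t)) (pu (e t)) (pv (e t)) (pmu (e t)) (plam (e t)) t j i.
  by rewrite embK in H; exact: esym H.
- apply: (cmx (c := fun i j t => D2 (ix j) (iv i) t)) => [*|t Dt i j]; first exact: c2.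
  have H := D2_xv fb hb gb Hb Gb (px (e t)) (py (e t)) (pu (e t)) (pv (e t)) (pmu (e t)) (plam (e t)) t j i.
  by rewrite embK in H; exact: esym H.
- apply: (cmx (c := fun i j t => D2 (ix j) (imu i) t)) => [*|t Dt i j]; first exact: c2.
  have H := D2_xmu fb hb gb Hb Gb (px (e t)) (py (e t)) (pu (e t)) (pv (e t)) (pmu (e t)) (plam (e t)) t j i.
  by rewrite embK in H; exact: esym H.
- apply: (cmx (c := fun i j t => D2 (iy j) (imu i) t)) => [*|t Dt i j]; first exact: c2.
  have H := D2_ymu fb hb gb Hb Gb (px (e t)) (py (e t)) (pu (e t)) (pv (e t)) (pmu (e t)) (plam (e t)) t j i.
  by rewrite embK in H; exact: esym H.
(* [lam] enters [Phi] with a minus sign, so the Jacobians of [g] are negated blocks. *)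
- apply: (cmx (c := fun i j t => - D2 (ix j) (ilam i) t)) => [*|t [Dx Dy Dt] i j].
    by apply: (@cvgN _ _ _ (nbhs t0) (nbhs_filter t0)); exact: c2.
  have H : 'D_(dir (ix j)) ('D_(dir (ilam i)) Phi) (emb (px (e t)) (py (e t)) (pu (e t)) (pv (e t)) (pmu (e t)) (plam (e t)), t) =
      - jac (fun x' => mm_g (P t) x' (py (e t))) (px (e t)) i j by apply: D2_xlam; eassumption.
  by rewrite embK in H; exact: esym (etrans (congr1 -%R H) (opprK _)).
- apply: (cmx (c := fun i j t => - D2 (iy j) (ilam i) t)) => [*|t [Dx Dy Dt] i j].
    by apply: (@cvgN _ _ _ (nbhs t0) (nbhs_filter t0)); exact: c2.
  have H : 'D_(dir (iy j)) ('D_(dir (ilam i)) Phi) (emb (px (e t)) (py (e t)) (pu (e t)) (pv (e t)) (pmu (e t)) (plam (e t)), t) =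
      - jac (mm_g (P t) (px (e t))) (py (e t)) i j by apply: D2_ylam; eassumption.
  by rewrite embK in H; exact: esym (etrans (congr1 -%R H) (opprK _)).
- apply: (cmx (c := fun i j t => D2 (ix i) (ix j) t)) => [*|t [Dx Dy Dt] i j]; first exact: c2.
  have H : 'D_(dir (ix i)) ('D_(dir (ix j)) Phi) (emb (px (e t)) (py (e t)) (pu (e t)) (pv (e t)) (pmu (e t)) (plam (e t)), t) =
      (hessxxL (P t) (px (e t)) (py (e t)) (pmu (e t)) (plam (e t)) + upper_constraint_hess (P t) (px (e t)) (pu (e t)) (pv (e t))) i j.
    by apply: D2_xx; eassumption.
  by rewrite embK in H; exact: esym H.
- apply: (cmx (c := fun i j t => D2 (iy i) (ix j) t)) => [*|t [Dx Dy Dt] i j]; first exact: c2.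
  have H : 'D_(dir (iy i)) ('D_(dir (ix j)) Phi) (emb (px (e t)) (py (e t)) (pu (e t)) (pv (e t)) (pmu (e t)) (plam (e t)), t) = hessyxL (P t) (px (e t)) (py (e t)) (pmu (e t)) (plam (e t)) i j.
    by apply: D2_yx; eassumption.
  by rewrite embK in H; exact: esym H.
- apply: (cmx (c := fun i j t => D2 (iy i) (iy j) t)) => [*|t [Dx Dy Dt] i j]; first exact: c2.
  have H := D2_yy fb hb gb Hb Gb (px (e t)) (py (e t)) (pu (e t)) (pv (e t)) (pmu (e t)) (plam (e t)) t i j.
  by rewrite embK in H; exact: esym H.
Qed.

Let ce_entry j : e t j 0 @[t --> t0] --> e t0 j 0.
Proof. by apply: (@cvg_entry _ _ (nbhs t0) (nbhs_filter t0)); exact: ce. Qed.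

Let c1 j : 'D_(dir j) Phi (e t, t) @[t --> t0] --> 'D_(dir j) Phi (e t0, t0).
Proof. exact: (cvg_comp _ _ pc (D1_continuous (j := j) domt0)). Qed.

(** Finitely many strict inequalities, true at [t0], between quantities continuous along the
    path. *)
Let near_upper : \forall t \near t0, forall i,
  if i \in Iu then 0 < e t (iv i) 0 else 'D_(dir (iv i)) Phi (e t, t) < 0.
Proof.
have [_ _ _ _ [sv _]] := K0.
have [_ [_ [_ [Evv _]]]] := emb_entry x0 y0 u0 v0 mu0 lam0.
apply: (@filter_forall _ _ (fun i t => if i \in Iu then 0 < e t (iv i) 0
  else 'D_(dir (iv i)) Phi (e t, t) < 0) _ (nbhs_filter t0)) => i.
have [iI|iI] := boolP (i \in Iu).
  apply: (@cvgr_gt _ _ _ (nbhs_filter t0) _ _ (ce_entry (j := iv i))); rewrite et0 Evv.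
  by move: iI; rewrite inE => /eqP Gi; case: (sv i) => -[] //; rewrite Gi ltxx.
apply: (@cvgr_lt _ _ _ (nbhs_filter t0) _ _ (c1 (j := iv i))); rewrite et0 DPhi_v /= p_emb.
by move: iI; rewrite inE => Gi; case: (sv i) => -[] // /eqP E0; rewrite E0 in Gi.
Qed.

Let near_lower : \forall t \near t0, forall i,
  if i \in al then 0 < e t (ilam i) 0 else 0 < 'D_(dir (ilam i)) Phi (e t, t).
Proof.
have [_ _ _ _ [_ sl]] := K0.
have [_ [_ [_ [_ [_ Ell]]]]] := emb_entry x0 y0 u0 v0 mu0 lam0.
apply: (@filter_forall _ _ (fun i t => if i \in al then 0 < e t (ilam i) 0
  else 0 < 'D_(dir (ilam i)) Phi (e t, t)) _ (nbhs_filter t0)) => i.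
have [iI|iI] := boolP (i \in al).
  apply: (@cvgr_gt _ _ _ (nbhs_filter t0) _ _ (ce_entry (j := ilam i))); rewrite et0 Ell.
  by move: iI; rewrite inE => /eqP Gi; case: (sl i) => -[] //; rewrite Gi ltxx.
apply: (@cvgr_gt _ _ _ (nbhs_filter t0) _ _ (c1 (j := ilam i))); rewrite et0 DPhi_lam /= !p_emb oppr_gt0.
by move: iI; rewrite inE => Gi; case: (sl i) => -[] // /eqP E0; rewrite E0 in Gi.
Qed.

Lemma near_jacobian_uniqueness : (\forall t \near t0, F (e t, t) = 0) ->
  \forall t \near t0, jacobian_uniqueness (P t)
    (px (e t)) (pu (e t)) (pv (e t)) (py (e t)) (pmu (e t)) (plam (e t)).
Proof.
move=> nF.
have n12 : \forall t \near t0, dom (e t, t) /\ F (e t, t) = 0.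
  by apply: filterS2 ndom nF => t ? ?; split.
apply: filterS3 n12 near_upper (filterI near_lower near_regular).
by move=> t [Dt Ft] Ut [Lt Rt]; exact: KKT_point.
Qed.

End Convergence.

Lemma KKT_path : exists2 e : 'cV[R]_l -> E, e t0 = e0 &
  \forall t \near t0, C1_at e t /\ jacobian_uniqueness (P t)
    (px (e t)) (pu (e t)) (pv (e t)) (py (e t)) (pmu (e t)) (plam (e t)).
Proof.
have [e et0 ne] := KKT_path_exists; exists e => //.
(* A property true near [t0] holds at [t0] itself; its C^1 part gives continuity there. *)
have ce : {for t0, continuous e}.
  have [_ _ [ed _]] := nbhs_singleton ne.
  by apply: differentiable_continuous; exact: (nbhs_singleton ed).
have nD : \forall t \near t0, dom (e t, t) by apply: filterS ne => t [].
have nF : \forall t \near t0, F (e t, t) = 0 by apply: filterS ne => t [].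
have nC : \forall t \near t0, C1_at e t by apply: filterS ne => t [].
apply: filterS2 nC (near_jacobian_uniqueness et0 ce nD nF) => t ? ?.
by split.
Qed.

End KKTPath.
(** * Euclidean balls and the main theorem *)

Section EuclideanBalls.
Context {R : realType}.

Lemma norm_le_enorm p (a : 'cV[R]_p) : `|a| <= enorm a.
Proof.
apply: norm_mx_le => [|i j]; first exact: sqrtr_ge0.
rewrite (ord1 j) -sqrtr_sqr ler_wsqrtr// /dot (bigD1 i)//= expr2 lerDl.
by apply: sumr_ge0 => k _; rewrite -expr2 sqr_ge0.
Qed.

(** The Euclidean norm dominates the sup norm, and halving [r] passes from an open ball to a closed
    one. *)
Lemma nbhs_eball p (a : 'cV[R]_p) (A : set 'cV[R]_p) : nbhs a A ->
  exists2 r : R, 0 < r & eball a r `<=` A.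
Proof.
move=> /nbhs_normP[r /= r0 rA]; exists (r / 2); first by rewrite divr_gt0.
move=> a' aa'; apply: rA; rewrite /ball_/= distrC.
rewrite (le_lt_trans (norm_le_enorm _))// (le_lt_trans aa')//.
by rewrite ltr_pdivrMr// ltr_pMr// ltr1n.
Qed.

(** The squared Euclidean norm is continuous in the entries, so it is compared with [eps ^+ 2] and
    the root is taken afterwards. *)
Lemma near_eball (T : topologicalType) p (f : T -> 'cV[R]_p) (t0 : T) (eps : R) :
  {for t0, continuous f} -> 0 < eps -> \forall t \near t0, eball (f t0) eps (f t).
Proof.
move=> cf eps0.
have c1 : f t - f t0 @[t --> t0] --> (0 : 'cV[R]_p).
  have E : f t0 - f t0 = 0 by rewrite subrr.
  rewrite -E; apply: (@cvgB _ _ _ _ (nbhs_filter t0)); first exact: cf.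
  exact: cvg_cst.
have c2 := @cvg_dot _ _ _ (nbhs_filter t0) _ _ _ _ _ c1 c1.
have eps2 : dot (0 : 'cV[R]_p) 0 < eps ^+ 2 by rewrite dot0l exprn_gt0.
have n := @cvgr_lt _ _ _ (nbhs_filter t0) _ _ c2 _ eps2.
apply: filterS n => t dt; rewrite /eball /= /enorm.
by rewrite -(gtr0_norm eps0) -sqrtr_sqr ler_wsqrtr// ltW.
Qed.

Lemma eball_le p (a : 'cV[R]_p) (r r' : R) : r <= r' -> eball a r `<=` eball a r'.
Proof. by move=> rr a' /le_trans; apply. Qed.

End EuclideanBalls.

Lemma C1_at_compl (R : realType) (V W W' : normedModType R) (L : {linear W -> W'})
    (f : V -> W) a : continuous L -> C1_at f a -> C1_at (fun x => L (f x)) a.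
Proof.
move=> cL [df Df]; split.
  apply: filterS df => x dx.
  by apply: (@differentiable_comp _ _ _ _ f L) => //; exact: linear_differentiable.
move=> d; have DE x : differentiable f x -> L ('D_d f x) = 'D_d (fun x => L (f x)) x.
  by move=> dx; rewrite (derive_compl cL)//; exact: diff_derivable.
rewrite /prop_for /continuous_at -(DE _ (nbhs_singleton df)).
have nE : \forall x \near a, L ('D_d f x) = 'D_d (fun x => L (f x)) x.
  by apply: filterS df => x dx; exact: DE.
apply: cvg_trans (near_eq_cvg nE) _.
exact: (@continuous_comp _ _ _ ('D_d f) L a (Df d) (cL _)).
Qed.

Lemma C1_at_pair (R : realType) (V W W' : normedModType R) (f : V -> W) (g : V -> W') a :
  C1_at f a -> C1_at g a -> C1_at (fun x => (f x, g x)) a.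
Proof.
move=> [df Df] [dg Dg]; split.
  by apply: filterS2 df dg => x dx dx'; exact: differentiable_pair.
move=> d.
have DE x : differentiable f x -> differentiable g x ->
    ('D_d f x, 'D_d g x) = 'D_d (fun x => (f x, g x)) x.
  move=> dx dx'; rewrite [RHS]deriveE; last exact: differentiable_pair.
  by rewrite (diff_pair dx dx') (deriveE _ dx) (deriveE _ dx').
rewrite /prop_for /continuous_at -(DE _ (nbhs_singleton df) (nbhs_singleton dg)).
have nE : \forall x \near a, ('D_d f x, 'D_d g x) = 'D_d (fun x => (f x, g x)) x.
  by apply: filterS2 df dg => x; exact: DE.
apply: cvg_trans (near_eq_cvg nE) _.
exact: (@cvg_pair_nbhs _ _ (nbhs_filter a) _ _ _ _ _ _ (Df d) (Dg d)).
Qed.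

Lemma linear_continuous_cV (R : realType) p q (g : 'cV[R]_p -> 'cV[R]_q) : linear g -> continuous g.
Proof.
move=> gl; pose gL : {linear 'cV[R]_p -> 'cV[R]_q} :=
  HB.pack g (GRing.isLinear.Build _ _ _ _ _ gl).
exact: (linear_cV_continuous (g := gL)).
Qed.

Lemma C1_at_linear (R : realType) (V : normedModType R) p q
    (g : 'cV[R]_p -> 'cV[R]_q) (f : V -> 'cV[R]_p) a :
  linear g -> C1_at f a -> C1_at (fun x => g (f x)) a.
Proof.
move=> gl; pose gL : {linear 'cV[R]_p -> 'cV[R]_q} :=
  HB.pack g (GRing.isLinear.Build _ _ _ _ _ gl).
exact: (C1_at_compl (L := gL) (linear_cV_continuous (g := gL))).
Qed.

Section Components.
Context {R : realType} {n m m1 m2 n1 n2 : nat}.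
Local Notation E := ('cV[R]_(@edim n m m1 m2 n1 n2)).

Lemma pu_linear : linear (pu : E -> _).
Proof. by move=> a e e'; rewrite /pu !linearP. Qed.
Lemma pv_linear : linear (pv : E -> _).
Proof. by move=> a e e'; rewrite /pv !linearP. Qed.
Lemma pmu_linear : linear (pmu : E -> _).
Proof. by move=> a e e'; rewrite /pmu !linearP. Qed.
Lemma plam_linear : linear (plam : E -> _).
Proof. by move=> a e e'; rewrite /plam !linearP. Qed.

End Components.

Lemma pospart_id (R : realType) p (a : 'cV[R]_p) :
  (forall i, 0 <= a i 0) -> a = pospart a.
Proof. by move=> a0; apply/matrixP => i j; rewrite (ord1 j) !mxE max_l. Qed.

Theorem theorem3p1 (R : realType) (n m m1 m2 n1 n2 l : nat)
  (fb : 'cV[R]_n -> 'cV[R]_m -> 'cV[R]_l -> R)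
  (hb : 'cV[R]_n -> 'cV[R]_m -> 'cV[R]_l -> 'cV[R]_m1)
  (gb : 'cV[R]_n -> 'cV[R]_m -> 'cV[R]_l -> 'cV[R]_m2)
  (Hb : 'cV[R]_n -> 'cV[R]_l -> 'cV[R]_n1)
  (Gb : 'cV[R]_n -> 'cV[R]_l -> 'cV[R]_n2)
  (t0 : 'cV[R]_l)
  (xs : 'cV[R]_n) (us : 'cV[R]_n1) (vs : 'cV[R]_n2)
  (ys : 'cV[R]_m) (mus : 'cV[R]_m1) (lams : 'cV[R]_m2)
  (O1 : set 'cV[R]_n) (O2 : set 'cV[R]_m) (Theta : set 'cV[R]_l)
  (hJU : jacobian_uniqueness (perturbed fb hb gb Hb Gb t0) xs us vs ys mus lams)
  (hC2 : local_C2_perturbation fb hb gb Hb Gb O1 O2 Theta xs ys t0) :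
  exists eps delta : R,
    [/\ 0 < eps, 0 < delta, eball t0 delta `<=` Theta,
        eball xs eps `<=` O1 & eball ys eps `<=` O2] /\
  exists (x : 'cV[R]_l -> 'cV[R]_n) (y : 'cV[R]_l -> 'cV[R]_m)
         (u : 'cV[R]_l -> 'cV[R]_n1) (v : 'cV[R]_l -> 'cV[R]_n2)
         (mu : 'cV[R]_l -> 'cV[R]_m1) (lam : 'cV[R]_l -> 'cV[R]_m2)
         (w : 'cV[R]_l -> 'cV[R]_n2) (xi : 'cV[R]_l -> 'cV[R]_m2),
    [/\ forall t, eball t0 delta t ->
          [/\ eball xs eps (x t), eball ys eps (y t) & eball us eps (u t)] /\
          [/\ eball vs eps (v t), eball mus eps (mu t) & eball lams eps (lam t)],
        forall t, eball t0 delta t ->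
          v t = pospart (w t) /\ lam t = pospart (xi t),
        (x t0, y t0, u t0, v t0, mu t0, lam t0) = (xs, ys, us, vs, mus, lams),
        forall t, eball t0 delta t ->
          C1_at (fun s => (x s, y s, u s, v s, mu s, lam s)) t
      & forall t, eball t0 delta t ->
          jacobian_uniqueness (perturbed fb hb gb Hb Gb t)
            (x t) (u t) (v t) (y t) (mu t) (lam t)].
Proof.
have [[oO1 oO2 oTh] [Ox Oy Tt] [fC hC gC] [HC GC]] := hC2.
have gE : gradyL (perturbed fb hb gb Hb Gb t0) xs ys mus lams =
    grad (mm_f (perturbed fb hb gb Hb Gb t0) xs) ys +
    (Jyh (perturbed fb hb gb Hb Gb t0) xs ys)^T *m mus -
    (jac (mm_g (perturbed fb hb gb Hb Gb t0) xs) ys)^T *m lams.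
  by apply: gradyL_expand; eassumption.
have [K0 reg0] := (jacobian_uniquenessP us vs gE).1 hJU.
have [e et0 ne] : exists2 e : 'cV[R]_l -> 'cV[R]_(@edim n m m1 m2 n1 n2),
    e t0 = emb xs ys us vs mus lams &
    \forall t \near t0, C1_at e t /\ jacobian_uniqueness (perturbed fb hb gb Hb Gb t)
      (px (e t)) (pu (e t)) (pv (e t)) (py (e t)) (pmu (e t)) (plam (e t)).
  by apply: KKT_path; eassumption.
have [r1 r10 r1O] := nbhs_eball (open_nbhs_nbhs (conj oO1 Ox)).
have [r2 r20 r2O] := nbhs_eball (open_nbhs_nbhs (conj oO2 Oy)).
(* [eps] depends on [O1] and [O2] alone; [del] is chosen afterwards, from the continuity of the
   path. *)
pose eps := Num.min r1 r2.
have eps0 : 0 < eps by rewrite lt_min r10 r20.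
have ce : {for t0, continuous e}.
  have [[de _] _] := nbhs_singleton ne.
  exact: differentiable_continuous (nbhs_singleton de).
have nb q (pr : 'cV[R]_(@edim n m m1 m2 n1 n2) -> 'cV[R]_q) : linear pr ->
    \forall t \near t0, eball (pr (e t0)) eps (pr (e t)).
  move=> /linear_continuous_cV cpr.
  apply: (@near_eball _ _ _ (fun t => pr (e t)) _ _ _ eps0).
  exact: (@continuous_comp _ _ _ e pr t0 ce (cpr _)).
have nI := @filterI _ _ (nbhs_filter t0).
have n1' := nI _ _ (nb _ _ px_linear) (nI _ _ (nb _ _ py_linear) (nb _ _ pu_linear)).
have n2' := nI _ _ (nb _ _ pv_linear) (nI _ _ (nb _ _ pmu_linear) (nb _ _ plam_linear)).
rewrite et0 !p_emb in n1' n2'.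
have [del del0 delP] := nbhs_eball
  (nI _ _ (open_nbhs_nbhs (conj oTh Tt)) (nI _ _ ne (nI _ _ n1' n2'))).
exists eps, del; split.
  split=> //.
  - by move=> t /delP[].
  - by apply: subset_trans r1O; apply: eball_le; rewrite /eps ge_min lexx.
  - by apply: subset_trans r2O; apply: eball_le; rewrite /eps ge_min lexx orbT.
exists (fun t => px (e t)), (fun t => py (e t)), (fun t => pu (e t)),
  (fun t => pv (e t)), (fun t => pmu (e t)), (fun t => plam (e t)),
  (fun t => pv (e t)), (fun t => plam (e t)); split.
- by move=> t /delP[_ [_ [[? [? ?]] [? [? ?]]]]].
(* [v0] and [l0] are the sign parts of the complementarity conditions in [upper_KKT] and
   [lower_jacobian_uniqueness]. *)
- move=> t /delP[_ [[_ [[_ [_ _ [v0 _ _]]] _ _ [_ [[_ _ [l0 _ _]] _ _ _]] _]] _]].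
  by split; exact: pospart_id.
- by rewrite et0 !p_emb.
- move=> t /delP[_ [[Ce _] _]].
  exact: (C1_at_pair (C1_at_pair (C1_at_pair (C1_at_pair (C1_at_pair
    (C1_at_linear px_linear Ce) (C1_at_linear py_linear Ce))
    (C1_at_linear pu_linear Ce)) (C1_at_linear pv_linear Ce))
    (C1_at_linear pmu_linear Ce)) (C1_at_linear plam_linear Ce)).
- by move=> t /delP[_ [[_ JU] _]].
Qed.
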